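(* Let $E=(E^0,E^1,r,s)$ be a countable directed graph and let $\lambda=\{\lambda_e\}_{e\in E^1}$ be a family of strictly positive numbers. The following conditions are equivalent: (i) the formula $$\mathcal{L}_\lambda(a)(\mu)=\sum_{e\in E^1,\ e\mu\in\partial E}\lambda_e\,a(e\mu),\qquad a\in C_0(\partial E),\ \mu\in\partial E,$$ defines a bounded operator $\mathcal{L}_\lambda:C_0(\partial E)\to C_0(\partial E)$; (ii) the following conditions are satisfied: $$\Big\{\sum_{e\in s^{-1}(v)}\lambda_e\Big\}_{v\in s(E^1)}\in\ell_\infty(s(E^1)),\qquad \Big\{\sum_{e\in r^{-1}(v)\cap s^{-1}(w)}\lambda_e\Big\}_{w\in s(r^{-1}(v))}\in c_0\big(s(r^{-1}(v))\big)\ \text{ for all }v\in r(E^1);$$ (iii) the sum $u_\lambda:=\sum_{e\in E^1}\sqrt{\lambda_e}\,s_e$ converges strictly in $M(C^*(E))$; (iv) the sum $\sum_{e,f\in E^1}\sqrt{\lambda_e\lambda_f}\,s_e^*as_f$ converges in norm for every $a\in C^*(E)$ and $$\Phi_{*,\lambda}(a):=\sum_{e,f\in E^1}\sqrt{\lambda_e\lambda_f}\,s_e^*as_f,\qquad a\in C^*(E),$$ defines a completely positive map $\Phi_{*,\lambda}:C^*(E)\to C^*(E)$. If the equivalent conditions (i)–(iv) hold, then $\Phi_{*,\lambda}(a)=u_\lambda^*au_\lambda$ for $a\in C^*(E)$, and the isomorphism $\mathcal{D}_E\cong C_0(\partial E)$ determined by $s_\mu s_\mu^*\mapsto\chi_{D_\mu}$,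 $\mu\in E^*$, intertwines $\Phi_{*,\lambda}|_{\mathcal{D}_E}$ and $\mathcal{L}_\lambda$.
   Context: $E^0,E^1$ are countable sets and $r,s:E^1\to E^0$ are arbitrary maps. $E^n$ ($n>0$) is the set of paths $\mu=\mu_1\cdots\mu_n$, $\mu_i\in E^1$, $s(\mu_i)=r(\mu_{i+1})$; $E^*=\bigcup_{n\ge0}E^n$ (vertices are paths of length zero); $E^\infty$ is the set of infinite paths $\mu_1\mu_2\cdots$ with $s(\mu_i)=r(\mu_{i+1})$; $r(\mu)=r(\mu_1)$ and, for finite $\mu$, $s(\mu)=s(\mu_n)$ ($r(v)=s(v)=v$ for $v\in E^0$). Put $E^*_{inf}=\{\mu\in E^*:|r^{-1}(s(\mu))|=\infty\}$, $E^*_s=\{\mu\in E^*:r^{-1}(s(\mu))=\emptyset\}$. The boundary space is $\partial E:=E^\infty\cup E^*_{inf}\cup E^*_s$ with the topology generated by the cylinders $D_\eta:=\{\mu\in\partial E:\mu\text{ begins with }\eta\}$, $\eta\in E^*$ (for $v\in E^0$, $D_v=\{\mu\in\partial E:r(\mu)=v\}$), and their complements; it is a locally compact Hausdorff space. For $e\in E^1$ and $\mu\in\partial E$ with $s(e)=r(\mu)$, $e\mu$ is the concatenation ($e\mu:=e$ if $\mu=s(e)\in E^0$). $C^*(E)$ is the universal $C^*$-algebra generated by partial isometries $\{s_e:e\in E^1\}$ and mutually orthogonal projections $\{p_v:v\in E^0\}$ with $s_e^*s_e=p_{s(e)}$, $s_es_e^*\le p_{r(e)}$ and $p_v=\sum_{r(e)=v}s_es_e^*$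 whenever $0<|r^{-1}(v)|<\infty$ (ranges $s_es_e^*$ of distinct edges being mutually orthogonal). $s_\mu=s_{\mu_1}\cdots s_{\mu_n}$, $s_v=p_v$; $\mathcal{D}_E:=\overline{\mathrm{span}}\{s_\mu s_\mu^*:\mu\in E^*\}$. It is known that $s_\mu s_\mu^*\mapsto\chi_{D_\mu}$, $\mu\in E^*$, determines an isomorphism $\mathcal{D}_E\cong C_0(\partial E)$. Infinite sums are limits of the nets of finite partial sums; $M(\cdot)$ is the multiplier algebra; empty sums are zero. *)

(* Defs.v *)
From HB Require Import structures.
From mathcomp Require Import all_boot all_order all_algebra finmap.
From mathcomp Require Import complex.
From mathcomp Require Import all_classical all_reals all_analysis.
Import Order.TTheory GRing.Theory Num.Theory numFieldNormedType.Exports.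

Set Implicit Arguments.
Unset Strict Implicit.
Unset Printing Implicit Defensive.

Local Open Scope classical_set_scope.
Local Open Scope ring_scope.

(* The directed set of finite subsets of [I]; infinite sums are limits along
   this filter. *)
Definition finsubsets (I : choiceType) : set_system {fset I} :=
  filter_from setT (fun A : {fset I} => [set B | A `<=` B]%fset).
Arguments finsubsets I : clear implicits.

Definition partial_sum (I : choiceType) (V : zmodType) (f : I -> V)
    (F : {fset I}) : V := \sum_(i <- F) f i.

(* [x] is only evaluated on the index set [W]. *)
Definition in_linfty (R : realType) (I : Type) (W : set I) (x : I -> \bar R) :=
  exists M : R, forall w, W w -> (`|x w| <= M%:E)%E.

Definition in_c0 (R : realType) (I : Type) (W : set I) (x : I -> \bar R) :=
  (forall w, W w -> x w \is a fin_num) /\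
  forall eps : R, 0 < eps -> finite_set [set w | W w /\ (eps%:E <= `|x w|)%E].

Section C0.
Context (R : realType) (T : topologicalType).

Definition C0 : set (T -> R[i]^o) :=
  [set f | continuous f /\
    forall eps : R, 0 < eps -> compact [set x | eps%:C%C <= `|f x|]].

Definition supnorm (f : T -> R[i]^o) : R :=
  sup [set complex.Re `|f x| | x in [set: T]].

Definition bounded_operator_C0 (L : (T -> R[i]^o) -> (T -> R[i]^o)) : Prop :=
  [/\ forall a, C0 a -> C0 (L a),
      forall (k : R[i]) (a b : T -> R[i]^o), C0 a -> C0 b ->
        L (fun x => k * a x + b x) = (fun x => k * L a x + L b x) &
      exists M : R, forall a, C0 a -> supnorm (L a) <= M * supnorm a].

End C0.

(* Complex C*-algebras, not necessarily unital. The norm takes values in the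
   nonnegative reals of [R[i]], as for every normed module over [R[i]]. *)
HB.mixin Record CompleteNormedModule_isCStar (R : realType) A
    of CompleteNormedModule R[i] A := {
  cmul : A -> A -> A ;
  star : A -> A ;
  cmulA : associative cmul ;
  cmulDl : left_distributive cmul +%R ;
  cmulDr : right_distributive cmul +%R ;
  cmulZl : forall (k : R[i]) (x y : A), cmul (k *: x) y = k *: cmul x y ;
  cmulZr : forall (k : R[i]) (x y : A), cmul x (k *: y) = k *: cmul x y ;
  starK : involutive star ;
  starD : {morph star : x y / x + y} ;
  starZ : forall (k : R[i]) (x : A), star (k *: x) = k^*%C *: star x ;
  starM : forall x y : A, star (cmul x y) = cmul (star y) (star x) ;
  norm_cmul_le : forall x y : A, `|cmul x y| <= `|x| * `|y| ;
  norm_cstar : forall x : A, `|cmul (star x) x| = `|x| ^+ 2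
}.

#[short(type="cstarType")]
HB.structure Definition CStar (R : realType) :=
  {A of CompleteNormedModule R[i] A & CompleteNormedModule_isCStar R A}.

Infix "**" := cmul (at level 40, left associativity) : ring_scope.

Section CStarTheory.
Context (R : realType).

Definition is_proj (A : cstarType R) (p : A) : Prop := p ** p = p /\ star p = p.

(* The order [q <= p] between projections. *)
Definition proj_le (A : cstarType R) (q p : A) : Prop := p ** q = q.

Definition star_hom (A B : cstarType R) (f : A -> B) : Prop :=
  [/\ forall (k : R[i]) (x y : A), f (k *: x + y) = k *: f x + f y,
      forall x y : A, f (x ** y) = f x ** f y &
      forall x : A, f (star x) = star (f x)].

Definition closed_star_subalg (A : cstarType R) (B : set A) : Prop :=
  [/\ closed B, B 0,
      forall (k : R[i]) (x y : A), B x -> B y -> B (k *: x + y),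
      forall x y : A, B x -> B y -> B (x ** y) &
      forall x : A, B x -> B (star x)].

(* The positive cone of the C*-algebra M_n(A). *)
Definition positive_mx (A : cstarType R) (n : nat) (X : 'M[A]_n) : Prop :=
  exists Y : 'M[A]_n,
    X = \matrix_(i, j) \sum_(k < n) (star (Y k i) ** Y k j).

Definition completely_positive (A B : cstarType R) (Phi : A -> B) : Prop :=
  (forall (k : R[i]) (x y : A), Phi (k *: x + y) = k *: Phi x + Phi y) /\
  (forall (n : nat) (X : 'M[A]_n),
     positive_mx X -> positive_mx (map_mx Phi X)).

(* M(A) as the algebra of double centralizers of [A]: [lmul u a] is the product
   [u a] and [rmul u a] is the product [a u]. *)
Record multiplier (A : cstarType R) := Multiplier {
  lmul : A -> A ;
  rmul : A -> A ;
  multiplierP : forall a b : A, a ** lmul b = rmul a ** b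
}.

Section Multipliers.
Context (A : cstarType R).

Lemma mult_of_subproof (x a b : A) : a ** (x ** b) = (a ** x) ** b.
Proof. exact: cmulA. Qed.

Definition mult_of (x : A) : multiplier A :=
  Multiplier (mult_of_subproof x).

Lemma mult_adj_subproof (u : multiplier A) (a b : A) :
  a ** star (rmul u (star b)) = star (lmul u (star a)) ** b.
Proof. by apply: (can_inj starK); rewrite !starM !starK (multiplierP u). Qed.

Definition mult_adj (u : multiplier A) : multiplier A :=
  Multiplier (mult_adj_subproof u).

(* [u^* a u] is an element of [A]. *)
Definition mult_compress (u : multiplier A) (a : A) : A :=
  rmul u (lmul (mult_adj u) a).

Definition strict_cvg (I : Type) (x : I -> multiplier A) (F : set_system I)
    (u : multiplier A) : Prop :=
  forall a : A, (fun i => lmul (x i) a) @ F --> lmul u a /\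
                (fun i => rmul (x i) a) @ F --> rmul u a.

End Multipliers.
End CStarTheory.

Record digraph := Digraph {
  vert : countType ;
  edge : countType ;
  rng : edge -> vert ;
  src : edge -> vert
}.

Section Paths.
Context (E : digraph).

Fixpoint is_path (v : vert E) (w : seq (edge E)) : bool :=
  if w is e :: w' then (rng e == v) && is_path (src e) w' else true.

(* Finite paths: the range vertex, then the edges; an empty word is a path of
   length zero. *)
Record fin_path := FPath {
  fp_rng : vert E ;
  fp_word : seq (edge E) ;
  fp_pathP : is_path fp_rng fp_word
}.

Definition fp_src (p : fin_path) : vert E :=
  last (fp_rng p) [seq src e | e <- fp_word p].

Record inf_path := IPath {
  ip_edge : nat -> edge E ;
  ip_pathP : forall i, src (ip_edge i) = rng (ip_edge i.+1)
}.

Definition in_edges (v : vert E) : set (edge E) := [set e | rng e = v].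
Definition out_edges (v : vert E) : set (edge E) := [set e | src e = v].

Definition singular (v : vert E) : Prop :=
  infinite_set (in_edges v) \/ in_edges v = set0.

Inductive bpath :=
  | BFin (p : fin_path) of singular (fp_src p)
  | BInf of inf_path.

Definition brng (mu : bpath) : vert E :=
  match mu with
  | BFin p _ => fp_rng p
  | BInf x => rng (ip_edge x 0)
  end.

Definition begins_with (mu : bpath) (eta : fin_path) : Prop :=
  brng mu = fp_rng eta /\
  match mu with
  | BFin p _ => prefix (fp_word eta) (fp_word p)
  | BInf x => fp_word eta = mkseq (ip_edge x) (size (fp_word eta))
  end.

Definition bcylinder (eta : fin_path) : set bpath :=
  [set mu | begins_with mu eta].

HB.instance Definition _ := gen_eqMixin bpath.
HB.instance Definition _ := gen_choiceMixin bpath.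
HB.instance Definition _ := @isSubBaseTopological.Build bpath (set bpath)
  [set U | exists eta, U = bcylinder eta \/ U = ~` bcylinder eta] id.

Lemma fcons_subproof (e : edge E) (p : fin_path) :
  src e = fp_rng p -> is_path (rng e) (e :: fp_word p).
Proof. by case: p => v w wP /= ->; rewrite eqxx. Qed.

Definition fcons e p (h : src e = fp_rng p) : fin_path :=
  FPath (fcons_subproof h).

Lemma fp_src_fcons e p (h : src e = fp_rng p) : fp_src (fcons h) = fp_src p.
Proof. by rewrite /fp_src /= h. Qed.

Lemma fcons_singular e p (h : src e = fp_rng p) :
  singular (fp_src p) -> singular (fp_src (fcons h)).
Proof. by rewrite fp_src_fcons. Qed.

Lemma icons_subproof (e : edge E) (x : inf_path) : src e = rng (ip_edge x 0) ->
  let y i := if i is j.+1 then ip_edge x j else e in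
  forall i, src (y i) = rng (y i.+1).
Proof. by move=> h y [|i] //=; exact: ip_pathP. Qed.

Definition icons e x (h : src e = rng (ip_edge x 0)) : inf_path :=
  IPath (icons_subproof h).

(* The concatenation [e mu], defined when [s(e) = r(mu)]; it then always lies
   in the boundary space. *)
Definition bcons (e : edge E) (mu : bpath) : src e = brng mu -> bpath :=
  match mu return src e = brng mu -> bpath with
  | BFin p ps => fun h => BFin (fcons_singular h ps)
  | BInf x => fun h => BInf (icons h)
  end.

End Paths.

Section Transfer.
Context (R : realType) (E : digraph) (lam : edge E -> R).

(* The [e]-th term of L_lambda(a)(mu), extended by 0 to the edges [e] that
   cannot be concatenated with [mu]. *)
Definition transfer_term (a : bpath E -> R[i]^o) (mu : bpath E) (e : edge E) :
    R[i]^o :=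
  match pselect (src e = brng mu) with
  | left h => (lam e)%:C%C * a (bcons h)
  | right _ => 0
  end.

Definition transfer (a : bpath E -> R[i]^o) (mu : bpath E) : R[i]^o :=
  lim (partial_sum (transfer_term a mu) @ finsubsets (edge E)).

Definition transfer_defines_bounded_operator : Prop :=
  (forall a, C0 a -> forall mu,
     cvg (partial_sum (transfer_term a mu) @ finsubsets (edge E))) /\
  bounded_operator_C0 transfer.

Definition weight_conditions : Prop :=
  in_linfty (range (@src E)) (fun v => \esum_(e in out_edges v) (lam e)%:E) /\
  forall v, range (@rng E) v ->
    in_c0 (@src E @` in_edges v)
      (fun w => \esum_(e in in_edges v `&` out_edges w) (lam e)%:E).

End Transfer.

Section GraphAlgebra.
Context (R : realType) (E : digraph).

Record ck_family (A : cstarType R) (s : edge E -> A) (p : vert E -> A) :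
    Prop := CKFamily {
  ck_proj : forall v, is_proj (p v) ;
  ck_orth : forall v w, v <> w -> p v ** p w = 0 ;
  ck_partial_isometry : forall e, s e ** star (s e) ** s e = s e ;
  ck_src : forall e, star (s e) ** s e = p (src e) ;
  ck_rng : forall e, proj_le (s e ** star (s e)) (p (rng e)) ;
  ck_range_orth : forall e f, e <> f ->
    (s e ** star (s e)) ** (s f ** star (s f)) = 0 ;
  ck_sum : forall v, finite_set (in_edges v) -> in_edges v !=set0 ->
    p v = \sum_(e \in in_edges v) (s e ** star (s e))
}.

Record is_graph_algebra (A : cstarType R) (s : edge E -> A) (p : vert E -> A) :
    Prop := IsGraphAlgebra {
  ga_ck : ck_family s p ;
  ga_generated : forall B : set A, closed_star_subalg B ->
    (forall e, B (s e)) -> (forall v, B (p v)) -> B = setT ;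
  ga_universal : forall (B : cstarType R) (S : edge E -> B) (P : vert E -> B),
    ck_family S P ->
    exists pi : A -> B, [/\ star_hom pi, forall e, pi (s e) = S e &
                            forall v, pi (p v) = P v]
}.

Context (A : cstarType R) (s : edge E -> A) (p : vert E -> A).

Definition spath (mu : fin_path E) : A :=
  if fp_word mu is e :: w then foldl (fun x f => x ** s f) (s e) w
  else p (fp_rng mu).

Definition diag_subalg : set A :=
  closure [set a | exists (n : nat) (c : 'I_n -> R[i]) (mu : 'I_n -> fin_path E),
    a = \sum_(i < n) c i *: (spath (mu i) ** star (spath (mu i)))].

Definition diag_iso (Psi : A -> (bpath E -> R[i]^o)) : Prop :=
  [/\ set_bij diag_subalg (@C0 R (bpath E)) Psi,
      forall (k : R[i]) (a b : A), diag_subalg a -> diag_subalg b ->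
        Psi (k *: a + b) = (fun x => k * Psi a x + Psi b x),
      forall a b : A, diag_subalg a -> diag_subalg b ->
        Psi (a ** b) = (fun x => Psi a x * Psi b x) &
      forall a : A, diag_subalg a -> Psi (star a) = (fun x => (Psi a x)^*%C)].

Context (lam : edge E -> R).

Definition u_partial (F : {fset edge E}) : A :=
  partial_sum (fun e => (Num.sqrt (lam e))%:C%C *: s e) F.

Definition is_strict_sum (u : multiplier A) : Prop :=
  strict_cvg (fun F => mult_of (u_partial F)) (finsubsets (edge E)) u.

(* The double sum is the limit over finite [F] of the sums over [F x F]; it is
   not an unconditional sum over arbitrary finite sets of pairs. *)
Definition Phi_partial (a : A) (F : {fset edge E}) : A :=
  partial_sum (fun e => partial_sum (fun f =>
    (Num.sqrt (lam e * lam f))%:C%C *: (star (s e) ** a ** s f)) F) F.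

Definition Phi (a : A) : A := lim (Phi_partial a @ finsubsets (edge E)).

Definition Phi_defines_cp_map : Prop :=
  (forall a, cvg (Phi_partial a @ finsubsets (edge E))) /\
  completely_positive Phi.

End GraphAlgebra.

(* Main.v *)
(* The diagonal of C*(E) is faithfully represented on l2 of the boundary path
   space, by the partial isometries [delta_mu |-> delta_(e mu)]: every diagonal
   element acts there as a multiplication operator, and its norm is the supremum
   of the multiplier.  This gives the isomorphism with C_0, under which
   [a |-> sum_(e, f in F) sqrt(lambda_e lambda_f) s_e^* a s_f] becomes the
   partial sum over [F] of the transfer operator, because the terms with
   [e <> f] vanish on the diagonal; hence (iv) implies (i).

   Since [u_F^* u_F = sum_(e in F) lambda_e p_(s(e))], the norms of the partial
   sums [u_F] are governed by the sums of lambda over the edges with a given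
   source, while [p_v u_F] is governed by the sums over the edges from a given
   source to [v].  As the vertex projections form an approximate unit, (ii)
   therefore gives strict convergence.  Conversely, a gliding hump argument
   shows that the first sums stay bounded under (iii) or (iv).  Finally, (i)
   applied to the indicator of a cylinder [D_v], which is compact, gives the
   c_0-condition.
*)

(* The universal property yields a representation [pi] on l2 but says nothing about its injectivity.
   One half of the isometry on the diagonal is therefore proved inside [A], by induction on path
   length: the norm of a finite combination of the projections [s_mu s_mu^*] is at most the supremum
   of its symbol, the same combination of indicator functions. The other half is contractivity of
   [pi]. Both rest on the C*-identity: iterated squaring bounds orthogonal sums, and a square root
   built by fixed-point iteration gives contractivity.

   Conditions (iii) and (iv) speak of convergent nets over finite subsets, and a convergent net of
   operators can be unbounded. This is the obstacle that the gliding humps remove: a test element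
   with coefficients [2^-n] stays in the diagonal, while fiber sums chosen beyond [4^n] outweigh
   these coefficients, even when they enter squared. Once the fiber sums are bounded, all [u_F] are
   bounded, and convergence has to be tested only against vertex projections: [u_F p_v] needs the
   tail of one convergent sum, [p_v u_F] needs tails that are small uniformly over all sources,
   which is the c_0-condition. *)
From HB Require Import structures.
Require Import Defs.
From mathcomp Require Import all_boot all_order all_algebra finmap.
From mathcomp Require Import complex ring lra.
From mathcomp Require Import all_classical all_reals all_analysis.
Import Order.TTheory GRing.Theory Num.Theory numFieldNormedType.Exports.
Set Implicit Arguments.
Unset Strict Implicit.
Unset Printing Implicit Defensive.

Local Open Scope classical_set_scope.
Local Open Scope ring_scope.

(** * Norms and nets *)

Section ComplexNorm.
Context (R : realType).
Implicit Types (V : normedModType R[i]).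

(** Norms take values in [R[i]], whose order is only partial; their real part allows suprema and
    real arithmetic. *)
Definition nrm V (v : V) : R := complex.Re `|v|.

Lemma normE V (v : V) : `|v| = (nrm v)%:C%C.
Proof. by rewrite /nrm RRe_real// ger0_real. Qed.

Lemma nrm_le V (v : V) (r : R) : (nrm v <= r) = (`|v| <= r%:C%C).
Proof. by rewrite normE lecR. Qed.

Lemma nrm_lt V (v : V) (r : R) : (nrm v < r) = (`|v| < r%:C%C).
Proof. by rewrite normE ltcR. Qed.

Lemma nrm_ge0 V (v : V) : 0 <= nrm v.
Proof. by rewrite -lecR -normE normr_ge0. Qed.

Lemma nrm0 V : nrm (0 : V) = 0.
Proof. by rewrite /nrm normr0. Qed.

Lemma nrm_eq0 V (v : V) : (nrm v == 0) = (v == 0).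
Proof. by rewrite -[RHS]normr_eq0 normE (inj_eq (@complexI R) _ 0). Qed.

Lemma nrmD V (u v : V) : nrm (u + v) <= nrm u + nrm v.
Proof. by rewrite nrm_le rmorphD /= -!normE ler_normD. Qed.

Lemma nrmN V (v : V) : nrm (- v) = nrm v.
Proof. by rewrite /nrm normrN. Qed.

Lemma nrmBC V (u v : V) : nrm (u - v) = nrm (v - u).
Proof. by rewrite -nrmN opprB. Qed.

Lemma nrm_trans V (u v w : V) : nrm (u - w) <= nrm (u - v) + nrm (v - w).
Proof. by apply: le_trans (nrmD _ _); rewrite addrA subrK. Qed.

Lemma nrm_dist V (u v : V) : nrm u <= nrm (v - u) + nrm v.
Proof. by rewrite nrmBC; apply: le_trans (nrmD _ _); rewrite subrK. Qed.

Lemma nrmZ V (k : R[i]) (v : V) : nrm (k *: v) = nrm (k : R[i]^o) * nrm v.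
Proof.
by apply: (@complexI R); rewrite rmorphM /= -!normE normrZ.
Qed.

Lemma nrm_sum V (I : Type) (r : seq I) (P : pred I) (f : I -> V) :
  nrm (\sum_(i <- r | P i) f i) <= \sum_(i <- r | P i) nrm (f i).
Proof.
elim/big_ind2: _ => //; first by rewrite nrm0.
by move=> ? ? ? ? h1 h2; apply: le_trans (nrmD _ _) _; apply: lerD.
Qed.

Lemma nrmM (x y : R[i]^o) : nrm (x * y : R[i]^o) = nrm x * nrm y.
Proof. exact: nrmZ. Qed.

Lemma nrmR (x : R) : nrm (x%:C%C : R[i]^o) = `|x|.
Proof. by rewrite /nrm normc_def /= expr0n addr0 sqrtr_sqr. Qed.

Lemma nrmZR V (k : R) (v : V) : 0 <= k -> nrm (k%:C%C *: v) = k * nrm v.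
Proof. by move=> k0; rewrite nrmZ nrmR ger0_norm. Qed.

Lemma nrmJ (x : R[i]^o) : nrm (x^*%C : R[i]^o) = nrm x.
Proof. by rewrite /nrm normcJ. Qed.

Lemma nrm_sqr (x : R[i]^o) : (nrm x ^+ 2)%:C%C = x * x^*%C.
Proof. by rewrite rmorphXn /= -normE sqr_normc. Qed.

Lemma nrm_ge_Re (x : R[i]^o) : `|complex.Re x| <= nrm x.
Proof. by rewrite -lecR -normE normc_ge_Re. Qed.

Lemma nrm_ge_Im (x : R[i]^o) : `|complex.Im x| <= nrm x.
Proof.
have := nrm_ge_Re (x * 'i%C); rewrite ReiNIm normrN => /le_trans; apply.
by rewrite nrmM /nrm [X in _ * X]/= expr0n /= add0r expr1n sqrtr1 mulr1.
Qed.

Lemma nrm_le_ReIm (x : R[i]^o) : nrm x <= `|complex.Re x| + `|complex.Im x|.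
Proof.
rewrite {1}(complexE x); apply: le_trans (nrmD _ _) _.
rewrite nrmM !nrmR /nrm [X in _ + X * _]/= expr0n /= add0r expr1n sqrtr1 mul1r.
by [].
Qed.

Lemma cvg_nrm V (T : Type) (F : set_system T) (FF : Filter F) (f : T -> V) l :
  f @ F --> l <-> forall eps : R, 0 < eps -> \forall x \near F,
    nrm (l - f x) < eps.
Proof.
rewrite cvgrPdist_lt; split=> h eps e0.
  have := h eps%:C%C; rewrite (ltcR 0) => /(_ e0); apply: filterS => x.
  by rewrite nrm_lt.
have er : (complex.Re eps)%:C%C = eps by rewrite RRe_real// gtr0_real.
have := h (complex.Re eps); rewrite -(ltcR 0) er => /(_ e0);
  apply: filterS => x.
by rewrite nrm_lt er.
Qed.

Lemma cvg_nrm_lim V (T : Type) (F : set_system T) (FF : ProperFilter F)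
  (f : T -> V) l : f @ F --> l -> lim (f @ F) = l.
Proof. by move=> h; apply: cvg_lim => //; exact: norm_hausdorff. Qed.

Lemma cauchy_nrm V (F : set_system V) (FF : Filter F) :
  cauchy F <->
  forall eps : R, 0 < eps -> \forall x & y \near F, nrm (x - y) < eps.
Proof.
rewrite -cauchy_ballP; split=> h eps e0.
  have := h eps%:C%C; rewrite (ltcR 0) => /(_ e0); apply: filterS => -[x y] /=.
  by rewrite -ball_normE /= nrm_lt.
have er : (complex.Re eps)%:C%C = eps by rewrite RRe_real// gtr0_real.
have := h (complex.Re eps); rewrite -(ltcR 0) er => /(_ e0).
by apply: filterS => -[x y] /=; rewrite nrm_lt er -ball_normE.
Qed.

(** Completeness is inherited from the real line through real and imaginary parts. *)
Lemma complex_complete (F : set_system R[i]^o) (FF : ProperFilter F) :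
  cauchy F -> cvg F.
Proof.
move=> /cauchy_nrm Fc.
have real_cvg (g : R[i]^o -> R) : (forall x y, g (x - y) = g x - g y) ->
    (forall x, `|g x| <= nrm x) -> cvg (g @ F).
  move=> gB gle; apply: cauchy_cvg; apply/cauchy_ballP => eps e0.
  have [[A B] /= [FA FB] AB] := Fc _ e0.
  exists (g @` A, g @` B) => /=.
    by split; [apply: filterS FA|apply: filterS FB] => x ?; exists x.
  move=> [_ _] /= [[x Ax <-] [y By <-]]; rewrite -ball_normE /= -gB.
  by apply: le_lt_trans (gle _) _; exact: (AB (x, y)).
have cRe : cvg ((fun x : R[i]^o => complex.Re x) @ F).
  apply: real_cvg; last exact: nrm_ge_Re.
  by move=> [? ?] [? ?].
have cIm : cvg ((fun x : R[i]^o => complex.Im x) @ F).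
  apply: real_cvg; last exact: nrm_ge_Im.
  by move=> [? ?] [? ?].
apply/cvg_ex; exists ((lim ((fun x : R[i]^o => complex.Re x) @ F)) +i*
  (lim ((fun x : R[i]^o => complex.Im x) @ F)))%C.
have -> : F = (@id R[i]^o) @ F by rewrite /fmap; apply/funext.
apply/cvg_nrm => eps e0.
have e20 : 0 < eps / 2 by rewrite divr_gt0.
move/cvgrPdist_lt: cRe => /(_ _ e20) cRe.
move/cvgrPdist_lt: cIm => /(_ _ e20) cIm.
near=> x.
apply: le_lt_trans (nrm_le_ReIm _) _.
have -> : eps = eps / 2 + eps / 2 by rewrite -splitr.
rewrite (_ : _ - x = (lim ((fun x : R[i]^o => complex.Re x) @ F) - complex.Re x)
 +i* (lim ((fun x : R[i]^o => complex.Im x) @ F) - complex.Im x))%C /=;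
   last first.
  by case: (x).
by apply: ltrD; near: x.
Unshelve. all: by end_near. Qed.

End ComplexNorm.

Notation nrmc z := (nrm (z : _[i]^o)).

Section Nets.
Context (R : realType) (I : choiceType).

Lemma finsubsets_filter : ProperFilter (finsubsets I).
Proof.
apply: filter_from_proper.
  apply: filter_from_filter; first by exists fset0.
  move=> A B _ _; exists (A `|` B)%fset => // C /= ABC; split.
    exact: fsubset_trans (fsubsetUl _ _) ABC.
  exact: fsubset_trans (fsubsetUr _ _) ABC.
by move=> A _; exists A => /=.
Qed.
#[global] Existing Instance finsubsets_filter.

Lemma near_finsubsets (P : set {fset I}) :
  (\forall F \near finsubsets I, P F) <->
  exists F0, forall F, (F0 `<=` F)%fset -> P F.
Proof.
by split=> [[F0 _ h]|[F0 h]]; exists F0 => // F; apply: h.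
Qed.

Context (V : normedModType R[i]).
Implicit Types (f g : {fset I} -> V) (l : V).

Lemma cvg_netP f l : f @ finsubsets I --> l <->
  forall eps : R, 0 < eps ->
    exists F0, forall F, (F0 `<=` F)%fset -> nrm (l - f F) < eps.
Proof.
rewrite cvg_nrm; split=> h eps e0; first by apply/near_finsubsets/h.
by apply/near_finsubsets/h.
Qed.

Lemma lim_net f l : f @ finsubsets I --> l -> lim (f @ finsubsets I) = l.
Proof. exact: cvg_nrm_lim. Qed.

Lemma cvg_net_unique f l l' :
  f @ finsubsets I --> l -> f @ finsubsets I --> l' -> l = l'.
Proof. by move=> /lim_net <- /lim_net <-. Qed.

Lemma cauchy_netP f : cauchy (f @ finsubsets I) <->
  forall eps : R, 0 < eps ->
    exists F0, forall F, (F0 `<=` F)%fset -> nrm (f F - f F0) < eps.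
Proof.
rewrite cauchy_nrm; split=> h eps e0.
  have [[A B] /= [[F1 _ FA] [F2 _ FB]] AB] := h _ e0.
  exists (F1 `|` F2)%fset => F FF; apply: (AB (_, _)); split => /=.
    by apply: FA => /=; apply: fsubset_trans (fsubsetUl _ _) FF.
  by apply: FB => /=; apply: fsubsetUr.
have [F0 h0] := h _ (divr_gt0 e0 (ltr0n _ 2)).
have h1 : (f @ finsubsets I) (f @` [set F | (F0 `<=` F)%fset]).
  by exists F0 => // F /= ?; exists F.
exists (f @` [set F | (F0 `<=` F)%fset], f @` [set F | (F0 `<=` F)%fset]) => //.
move=> [_ _] /= [[F FF <-] [G GG <-]].
apply: le_lt_trans (nrm_trans _ (f F0) _) _.
have -> : eps = eps / 2 + eps / 2 by rewrite -splitr.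
by apply: ltrD; [|rewrite nrmBC]; apply: h0.
Qed.

Lemma cvg_net_cauchy f : cvg (f @ finsubsets I) ->
  forall eps : R, 0 < eps ->
    exists F0, forall F, (F0 `<=` F)%fset -> nrm (f F - f F0) < eps.
Proof. by move=> /cvg_cauchy /cauchy_netP. Qed.

Lemma cvg_net_le f l (M : R) :
  f @ finsubsets I --> l -> (forall F, nrm (f F) <= M) -> nrm l <= M.
Proof.
move=> /cvg_netP fl fM; apply/ler_addgt0Pr => eps e0.
have [F0 /(_ F0 (fsubset_refl _)) h] := fl _ e0.
have := nrm_dist l (f F0); rewrite nrmBC => /le_trans; apply.
by rewrite addrC lerD // ltW.
Qed.

End Nets.
#[global] Existing Instance finsubsets_filter.

(** * Unconditional sums *)

Section PartialSums.
Context (R : realType) (I : choiceType).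

Lemma partial_sum_subD (V : zmodType) (f : I -> V) (A B : {fset I}) :
  (A `<=` B)%fset ->
  partial_sum f B = partial_sum f A + partial_sum f (B `\` A)%fset.
Proof.
move=> AB; rewrite /partial_sum (big_fsetID _ (fun i => i \in A)) /=.
congr (_ + _); apply: eq_fbigl => i; rewrite !inE /=.
  by apply/andP/idP => [[]//|iA]; split=> //; exact: (fsubsetP AB).
by rewrite andbC.
Qed.

Lemma partial_sum_ge0 (g : I -> R) (A : {fset I}) :
  (forall i, 0 <= g i) -> 0 <= partial_sum g A.
Proof. by move=> g0; apply: sumr_ge0. Qed.

Lemma partial_sum_le (g : I -> R) (A B : {fset I}) :
  (forall i, 0 <= g i) -> (A `<=` B)%fset -> partial_sum g A <= partial_sum g B.
Proof.
by move=> g0 /partial_sum_subD ->; rewrite lerDl partial_sum_ge0.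
Qed.

(** [F0] is a finite set whose sum comes within [eps] of the supremum. *)
Lemma bounded_tail (g : I -> R) (M : R) : (forall i, 0 <= g i) ->
  (forall F, partial_sum g F <= M) -> forall eps, 0 < eps ->
  exists F0, forall F, (F0 `<=` F)%fset -> partial_sum g (F `\` F0)%fset < eps.
Proof.
move=> g0 gM eps e0.
have hs : has_sup (range (partial_sum g)).
  split; first by exists (partial_sum g fset0); exists fset0.
  by exists M => _ [F _ <-].
have [_ [F0 _ <-] h] := sup_adherent e0 hs.
exists F0 => F F0F.
have : partial_sum g F <= sup (range (partial_sum g)).
  by apply: sup_upper_bound => //; exists F.
by rewrite (partial_sum_subD g F0F); lra.
Qed.

Context (V : normedModType R[i]).
Implicit Types f : I -> V.

Definition abs_summable f :=
  exists M : R, forall F, partial_sum (fun i => nrm (f i)) F <= M.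

Lemma abs_summable_cauchy f :
  abs_summable f -> cauchy (partial_sum f @ finsubsets I).
Proof.
move=> [M fM]; apply/cauchy_netP => eps e0.
have [|F0 h] := bounded_tail _ fM e0; first by move=> i; exact: nrm_ge0.
exists F0 => F F0F; rewrite (partial_sum_subD f F0F) addrAC subrr add0r.
by apply: le_lt_trans (h _ F0F); exact: nrm_sum.
Qed.

End PartialSums.

Section ComplexSums.
Context (R : realType) (I : choiceType).
Implicit Types f g : I -> R[i]^o.

Definition csum f : R[i]^o := lim (partial_sum f @ finsubsets I).

Lemma csum_cvg f : abs_summable f -> partial_sum f @ finsubsets I --> csum f.
Proof. by move=> /abs_summable_cauchy /complex_complete. Qed.

Lemma csum_unique f l : partial_sum f @ finsubsets I --> l -> csum f = l.
Proof. exact: lim_net. Qed.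

Lemma csumZD (k : R[i]) f g : abs_summable f -> abs_summable g ->
  csum (fun i => k * f i + g i : R[i]^o) = k * csum f + csum g.
Proof.
move=> fs gs; apply: csum_unique.
rewrite (_ : partial_sum _ = (k \*: partial_sum f) + partial_sum g).
  by apply: cvgD; [apply: cvgZr|]; exact: csum_cvg.
apply/funext => F; rewrite /partial_sum big_split /= -big_distrr /=.
by [].
Qed.

Lemma csumJ f : abs_summable f -> csum (fun i =>
  (f i)^*%C : R[i]^o) = (csum f)^*%C.
Proof.
move=> fs; apply: csum_unique; apply/cvg_netP => eps e0.
have /cvg_netP /(_ _ e0) [F0 h] := csum_cvg fs.
exists F0 => F /h; rewrite -nrmJ rmorphB /=.
by rewrite /partial_sum raddf_sum.
Qed.

Lemma csum_le f M : abs_summable f ->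
  (forall F, nrm (partial_sum f F) <= M) -> nrm (csum f) <= M.
Proof. by move=> /csum_cvg /cvg_net_le; apply. Qed.

End ComplexSums.

Section ReindexSum.
Context (R : realType) (I J : choiceType) (g : I -> option J) (h : J -> option
  I).
Hypothesis gh : forall i j, g i = Some j <-> h j = Some i.

(** By [gh], [g] and [h] are mutually inverse partial bijections. Composition with [g], extended by
    0, is the form in which edges and vertices will act on l2. *)
Definition pull (T : nmodType) (f : J -> T) (i : I) : T :=
  if g i is Some j then f j else 0.

Definition pull_fset (F : {fset I}) : {fset J} :=
  [fset j | j in pmap g (enum_fset F)]%fset.

Lemma mem_pull_fset (F : {fset I}) j : (j \in pull_fset F) = 
  (if h j is Some i then i \in F else false).
Proof.
rewrite !inE /= mem_pmap; apply/mapP/idP.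
  by move=> [i iF /esym/gh ->].
by case E : (h j) => [i|//] iF; exists i => //; apply/esym/gh.
Qed.

Lemma partial_sum_pull (T : nmodType) (f : J -> T) (F : {fset I}) :
  \sum_(i <- F) pull f i = \sum_(j <- pull_fset F) f j.
Proof.
rewrite (perm_big (pmap g (enum_fset F))) /=; last first.
  apply: uniq_perm; [exact: fset_uniq| |by move=> j; rewrite !inE].
  have := fset_uniq F; elim: (enum_fset F) => //= i s IH /andP[is_ us].
  case E : (g i) => [j|] /=; last exact: IH.
  rewrite IH // andbT mem_pmap; apply/mapP => -[i' i's] /esym /gh.
  by move/gh: E => -> [ii']; move: is_; rewrite ii' i's.
elim: (enum_fset F) => [|i s IH] /=; first by rewrite !big_nil.
rewrite big_cons IH /pull; case: (g i) => [j|] /=; last by rewrite add0r.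
by rewrite big_cons.
Qed.
End ReindexSum.

Lemma csum_pull (R : realType) (I J : choiceType) (g : I -> option J)
  (h : J -> option I) (gh : forall i j, g i = Some j <-> h j = Some i)
  (f : J -> R[i]^o) :
  (forall j, h j = None -> f j = 0) -> abs_summable f ->
  csum (pull g f) = csum f.
Proof.
move=> fh fs; apply: csum_unique; apply/cvg_netP => eps e0.
have /cvg_netP /(_ _ e0) [F0 hF0] := csum_cvg fs.
have hg j i : h j = Some i <-> g i = Some j by rewrite gh.
exists (pull_fset h F0) => F /fsubsetP hF.
rewrite /partial_sum (partial_sum_pull gh).
(* The reindexed set may miss elements of [F0], but only those outside the domain of [h], where [f]
   vanishes; adding them changes nothing. *)
rewrite (_ : \sum_(j <- _) _ = partial_sum f (F0 `|` pull_fset g F)%fset);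
  last first.
  apply/big_fset_incl; first exact: fsubsetUr.
  move=> j; rewrite inE (mem_pull_fset gh); case/orP => [jF0|-> //].
  case E : (h j) => [i|]; last by rewrite fh.
  move/negP => []; apply: hF; rewrite (mem_pull_fset hg).
  by move/hg: E => ->.
exact: hF0 (fsubsetUl _ _).
Qed.

(** * The C*-algebra of bounded operators on l2 *)

Section SquareSummable.
Context (R : realType) (X : choiceType).

Lemma csum_nneg (g : X -> R) (M : R) : (forall x, 0 <= g x) ->
  (forall F, partial_sum g F <= M) ->
  csum (fun x => (g x)%:C%C : R[i]^o) = (sup (range (partial_sum g)))%:C%C.
Proof.
move=> g0 gM; apply: csum_unique; apply/cvg_netP => eps e0.
have hs : has_sup (range (partial_sum g)).
  split; first by exists (partial_sum g fset0); exists fset0.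
  by exists M => _ [F _ <-].
have [_ [F0 _ <-] h] := sup_adherent e0 hs.
exists F0 => F F0F.
have h1 : partial_sum g F <= sup (range (partial_sum g)).
  by apply: sup_upper_bound => //; exists F.
rewrite /partial_sum -rmorph_sum /= -rmorphB nrmR ger0_norm ?subr_ge0 //.
by have := partial_sum_le g0 F0F; rewrite /partial_sum in h h1 *; lra.
Qed.

Lemma csum_single (f : X -> R[i]^o) x : (forall y, y != x -> f y = 0) ->
  csum f = f x.
Proof.
move=> f0; apply: csum_unique; apply/cvg_netP => eps e0.
exists [fset x]%fset => F; rewrite fsub1set => xF.
rewrite /partial_sum (big_fsetD1 x) //= big1_seq ?addr0 ?subrr ?nrm0 //.
by move=> y; rewrite !inE => /andP[_ /andP[/f0]].
Qed.

Definition sqs (f : X -> R[i]) := partial_sum (fun x => nrmc (f x) ^+ 2).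

Definition l2_pred : {pred X -> R[i]} :=
  fun f => `[< exists M, forall F, sqs f F <= M >].

Lemma l2_predP (f : X -> R[i]) M : (forall F, sqs f F <= M) -> f \in l2_pred.
Proof. by move=> fM; apply/asboolP; exists M. Qed.

Lemma l2_submod_closed : submod_closed l2_pred.
Proof.
split.
  apply: (@l2_predP _ 0) => F; rewrite /sqs /partial_sum big1 // => x _.
  by rewrite nrm0 expr0n.
move=> k f g /asboolP[M fM] /asboolP[N gN].
apply: (@l2_predP _ (2 * nrmc k ^+ 2 * M + 2 * N)) => F.
apply: (@le_trans _ _ (2 * nrmc k ^+ 2 * sqs f F + 2 * sqs g F)); last first.
  by have := sqr_ge0 (nrmc k); have := fM F; have := gN F; nra.
rewrite /sqs /partial_sum !big_distrr -big_split /=; apply: ler_sum => x _.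
have := nrmD (k * f x : R[i]^o) (g x); rewrite nrmM => h.
have -> : (k *: f + g) x = k * f x + g x by [].
move: h (nrm_ge0 (k * f x + g x : R[i]^o)).
rewrite -mulrA -exprMn; set c := nrm (_ + _).
move: (nrmc k * nrmc (f x)) (nrmc (g x)) => a b h c0.
by have := sqr_ge0 (a - b); nra.
Qed.

HB.instance Definition _ := GRing.isSubmodClosed.Build R[i] (X -> R[i]) l2_pred
  l2_submod_closed.

Record l2 := L2 { l2_fun :> X -> R[i] ; _ : l2_fun \in l2_pred }.

HB.instance Definition _ := [isSub for l2_fun].
HB.instance Definition _ := [Choice of l2 by <:].
HB.instance Definition _ := [SubChoice_isSubLmodule of l2 by <:].

Implicit Types f g h : l2.

Lemma l2_ext f g : f =1 g -> f = g.
Proof. by move=> fg; apply: val_inj; apply/funext. Qed.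

Lemma l2_bounded f : exists M, forall F, sqs f F <= M.
Proof. by case: f => f /= /asboolP. Qed.

(** The free parameter [t] is what later yields Cauchy-Schwarz from termwise estimates. *)
Lemma nrmM_le (a b t : R) : 0 < t -> a * b <= (t * a ^+ 2 + t^-1 * b ^+ 2) / 2.
Proof.
move=> t0; rewrite ler_pdivlMr //.
have t1 := ltW t0; have ti : 0 <= t^-1 by rewrite invr_ge0.
have st : Num.sqrt t * Num.sqrt t^-1 = 1.
  by rewrite -sqrtrM // mulfV ?gt_eqF // sqrtr1.
have := sqr_ge0 (Num.sqrt t * a - Num.sqrt t^-1 * b).
rewrite sqrrB !exprMn !sqr_sqrtr // mulrACA st mul1r.
lra.
Qed.

Lemma ip_partial_le f g t F : 0 < t ->
  partial_sum (fun x => nrmc (f x * (g x)^*%C)) F <=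
  (t * sqs f F + t^-1 * sqs g F) / 2.
Proof.
move=> t0; rewrite /sqs /partial_sum !big_distrr -big_split /= big_distrl /=.
by apply: ler_sum => x _; rewrite nrmM nrmJ; exact: nrmM_le.
Qed.

Lemma ip_summable f g : abs_summable (fun x => f x * (g x)^*%C : R[i]^o).
Proof.
have [M fM] := l2_bounded f; have [N gN] := l2_bounded g.
exists ((1 * M + 1^-1 * N) / 2) => F.
apply: le_trans (ip_partial_le _ _ _ (@ltr01 R)) _.
by rewrite invr1 !mul1r ler_wpM2r // lerD.
Qed.

Definition ip f g : R[i]^o := csum (fun x => f x * (g x)^*%C : R[i]^o).

Lemma ipZDl (k : R[i]) f g h : ip (k *: f + g) h = k * ip f h + ip g h.
Proof.
rewrite /ip -csumZD; [|exact: ip_summable|exact: ip_summable].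
by congr csum; apply/funext => x; rewrite /= mulrDl mulrA.
Qed.

Lemma ipC f g : ip g f = (ip f g)^*%C.
Proof.
rewrite /ip -csumJ; last exact: ip_summable.
by congr csum; apply/funext => x; rewrite rmorphM /= conjcK mulrC.
Qed.

Lemma ip0l f : ip 0 f = 0.
Proof. by have := ipZDl (-1) 0 0 f; rewrite scaler0 addr0 mulN1r addNr. Qed.

Lemma ip0r f : ip f 0 = 0.
Proof. by rewrite ipC ip0l conjc0. Qed.

Lemma ipDl f g h : ip (f + g) h = ip f h + ip g h.
Proof. by have := ipZDl 1 f g h; rewrite scale1r mul1r. Qed.

Lemma ipZl (k : R[i]) f h : ip (k *: f) h = k * ip f h.
Proof. by have := ipZDl k f 0 h; rewrite addr0 ip0l addr0. Qed.

Lemma ipNl f h : ip (- f) h = - ip f h.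
Proof. by rewrite -scaleN1r ipZl mulN1r. Qed.

Lemma ipDr f g h : ip f (g + h) = ip f g + ip f h.
Proof. by rewrite ipC ipDl rmorphD /= -!ipC. Qed.

Lemma ipZr (k : R[i]) f h : ip f (k *: h) = k^*%C * ip f h.
Proof. by rewrite ipC ipZl rmorphM /= -!ipC. Qed.

Lemma ipNr f h : ip f (- h) = - ip f h.
Proof. by rewrite ipC ipNl rmorphN /= -!ipC. Qed.

Definition hsq f : R := sup (range (sqs f)).

Lemma ip_hsq f : ip f f = (hsq f)%:C%C.
Proof.
have [M fM] := l2_bounded f.
rewrite /hsq -(csum_nneg _ fM); last by move=> x; rewrite sqr_ge0.
by congr csum; apply/funext => x; rewrite nrm_sqr.
Qed.

Lemma hsq_le f M : (forall F, sqs f F <= M) -> hsq f <= M.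
Proof.
move=> fM; apply: ge_sup; first by exists (sqs f fset0); exists fset0.
by move=> _ [F _ <-].
Qed.

Lemma sqs_le_hsq f F : sqs f F <= hsq f.
Proof.
apply: sup_upper_bound; last by exists F.
split; first by exists (sqs f fset0); exists fset0.
by have [M fM] := l2_bounded f; exists M => _ [? _ <-].
Qed.

Lemma hsq_ge0 f : 0 <= hsq f.
Proof. by have := sqs_le_hsq f fset0; rewrite /sqs /partial_sum big_nil. Qed.

Definition hn f : R := Num.sqrt (hsq f).

Lemma hn_ge0 f : 0 <= hn f. Proof. exact: sqrtr_ge0. Qed.

Lemma hn_sqr f : hn f ^+ 2 = hsq f.
Proof. by rewrite sqr_sqrtr // hsq_ge0. Qed.

Lemma hn_le f (M : R) : 0 <= M -> hsq f <= M ^+ 2 -> hn f <= M.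
Proof. by move=> M0; rewrite -hn_sqr ler_pXn2r // nnegrE hn_ge0. Qed.

Lemma nrm_le_hn f x : nrmc (f x) <= hn f.
Proof.
rewrite -(ler_pXn2r (ltn0Sn 1)) ?nnegrE ?hn_ge0 ?nrm_ge0 // hn_sqr.
by have := sqs_le_hsq f [fset x]%fset; rewrite /sqs /partial_sum big_seq_fset1.
Qed.

Lemma hn_eq0 f : hn f = 0 -> f = 0.
Proof.
move=> f0; apply: l2_ext => x; apply/eqP; rewrite -(@nrm_eq0 _ R[i]^o).
by have := nrm_le_hn f x; rewrite f0 eq_le => ->; exact: nrm_ge0.
Qed.

Lemma cauchy_schwarz f g : nrmc (ip f g) <= hn f * hn g.
Proof.
have [/eqP/hn_eq0 ->|f0] := boolP (hn f == 0).
  by rewrite ip0l nrm0 mulr_ge0 // hn_ge0.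
have [/eqP/hn_eq0 ->|g0] := boolP (hn g == 0).
  by rewrite ip0r nrm0 mulr_ge0 // hn_ge0.
have f1 : 0 < hn f by rewrite lt_def f0 hn_ge0.
have g1 : 0 < hn g by rewrite lt_def g0 hn_ge0.
(* This ratio balances the two halves of the bound, which then equals [hn f * hn g]. *)
have t0 : 0 < hn g / hn f by rewrite divr_gt0.
apply: csum_le; first exact: ip_summable.
move=> F; apply: le_trans (nrm_sum _ _ _) _.
apply: le_trans (ip_partial_le f g F t0) _.
apply: (@le_trans _ _ ((hn g / hn f * hn f ^+ 2 + (hn g / hn f)^-1 * hn g ^+ 2)
  / 2)).
  rewrite ler_wpM2r //; apply: lerD; apply: ler_wpM2l.
  - exact: ltW.
  - by rewrite hn_sqr sqs_le_hsq.
  - by rewrite invr_ge0 ltW.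
  - by rewrite hn_sqr sqs_le_hsq.
rewrite le_eqVlt; apply/orP; left; apply/eqP; field.
by rewrite f0 g0.
Qed.

Lemma hsqD f g : hsq (f + g) = hsq f + hsq g + 2 * complex.Re (ip f g).
Proof.
apply: (@complexI R).
rewrite !rmorphD /= -!ip_hsq ipDl !ipDr (ipC f g) rmorphM /= rmorph_nat.
by rewrite -addcJ /=; ring.
Qed.

Lemma hnD f g : hn (f + g) <= hn f + hn g.
Proof.
apply: hn_le; first by rewrite addr_ge0 ?hn_ge0.
rewrite hsqD -!hn_sqr.
have := le_trans (nrm_ge_Re _) (cauchy_schwarz f g).
by rewrite ler_norml => /andP[_]; nra.
Qed.

Lemma hnZ (k : R[i]) f : hn (k *: f) = nrmc k * hn f.
Proof.
apply/eqP; rewrite -(eqrXn2 (ltn0Sn 1)) ?mulr_ge0 ?hn_ge0 ?nrm_ge0 //.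
rewrite exprMn !hn_sqr; apply/eqP/(@complexI R).
by rewrite rmorphM /= nrm_sqr -!ip_hsq ipZl ipZr mulrA.
Qed.

Lemma hn_0 : hn 0 = 0.
Proof. by have := hnZ 0 0; rewrite scale0r nrm0 mul0r. Qed.

Lemma delta_subproof x : (fun y : X => (y == x)%:R : R[i]) \in l2_pred.
Proof.
apply: (@l2_predP _ 1) => F; rewrite /sqs /partial_sum.
have h (G : {fset X}) : x \notin G -> \sum_(y <- G) nrmc ((y == x)%:R : R[i]) ^+
  2 = 0.
  move=> xG; rewrite big1_seq // => y /andP[_ yG]; case: eqP => [E|_].
    by move: xG; rewrite -E yG.
  by rewrite nrm0 expr0n.
have [xF|xF] := boolP (x \in F); last by rewrite h.
rewrite (big_fsetD1 x) //= h ?addr0 ?inE ?eqxx //.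
by rewrite (nrmR 1) normr1 expr1n.
Qed.

Definition delta x : l2 := L2 (delta_subproof x).

Lemma deltaE x y : delta x y = (y == x)%:R.
Proof. by []. Qed.

Lemma ip_delta f x : ip f (delta x) = f x.
Proof.
rewrite /ip (@csum_single _ x) /= ?eqxx ?rmorph1 ?mulr1 //.
by move=> y /negbTE ->; rewrite rmorph0 mulr0.
Qed.

Lemma ip_inj f g : (forall h, ip f h = ip g h) -> f = g.
Proof. by move=> h; apply: l2_ext => x; rewrite -!ip_delta h. Qed.

Lemma hn_delta x : hn (delta x) = 1.
Proof.
rewrite /hn -(_ : 1 = hsq (delta x)) ?sqrtr1 //.
by apply: (@complexI R); rewrite -ip_hsq ip_delta deltaE eqxx.
Qed.

End SquareSummable.

Section BoundedOperators.
Context (R : realType) (X : choiceType).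
Notation H := (l2 R X).
Implicit Types (S T : H -> H) (f g h : H).

Definition is_adjoint T T' := forall f g, ip (T f) g = ip f (T' g).

Definition op_bound T (M : R) := 0 <= M /\ forall f, hn (T f) <= M * hn f.

(** Having an adjoint forces linearity (see [bopD] and [bopZ]), and it supplies the involution at
    once. *)
Definition bop_pred : {pred H -> H} :=
  fun T => `[< (exists T', is_adjoint T T') /\ (exists M, op_bound T M) >].

Lemma bop_submod_closed : submod_closed bop_pred.
Proof.
split.
  apply/asboolP; split; first by exists 0 => f g; rewrite ip0l ip0r.
  by exists 0; split=> // f; rewrite hn_0 mul0r.
move=> k S T /asboolP[[S' SS'] [M [M0 SM]]] /asboolP[[T' TT'] [N [N0 TN]]].
apply/asboolP; split.
  exists (k^*%C *: S' + T') => f g.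
  by rewrite ipZDl ipDr ipZr conjcK -SS' -TT'.
exists (nrmc k * M + N); split.
  by rewrite addr_ge0 // mulr_ge0 // nrm_ge0.
move=> f; rewrite mulrDl -mulrA; apply: le_trans (hnD _ _) _.
by rewrite hnZ lerD // ler_wpM2l // nrm_ge0.
Qed.

HB.instance Definition _ := GRing.isSubmodClosed.Build R[i] (H -> H) bop_pred
  bop_submod_closed.

Record bop := Bop { bop_fun :> H -> H ; _ : bop_fun \in bop_pred }.

HB.instance Definition _ := [isSub for bop_fun].
HB.instance Definition _ := [Choice of bop by <:].
HB.instance Definition _ := [SubChoice_isSubLmodule of bop by <:].

Implicit Types a b c : bop.

Lemma bop_ext a b : (forall f, a f = b f) -> a = b.
Proof. by move=> ab; apply: val_inj; apply/funext. Qed.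

Definition opnorm a : R := inf [set M | op_bound a M].

Lemma op_bound_ex a : [set M | op_bound a M] !=set0.
Proof. by case: a => a /= /asboolP[_ []M]; exists M. Qed.

Lemma op_bound_lb a : lbound [set M | op_bound a M] 0.
Proof. by move=> M []. Qed.

Lemma opnorm_ge0 a : 0 <= opnorm a.
Proof. exact: lb_le_inf (op_bound_ex a) (@op_bound_lb a). Qed.

Lemma opnormP a f : hn (a f) <= opnorm a * hn f.
Proof.
have [f0|f0] := eqVneq (hn f) 0.
  by have [M [_ /(_ f)]] := op_bound_ex a; rewrite f0 !mulr0.
have fp : 0 < hn f by rewrite lt_def f0 hn_ge0.
rewrite -ler_pdivrMr //; apply: lb_le_inf; first exact: op_bound_ex.
by move=> M [_ h]; rewrite ler_pdivrMr.
Qed.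

Lemma opnorm_le a M : 0 <= M -> (forall f, hn (a f) <= M * hn f) ->
  opnorm a <= M.
Proof.
by move=> M0 h; apply: ge_inf => //; exists 0; exact: op_bound_lb.
Qed.

Lemma bop_adjoint_ex a : exists T', is_adjoint a T'.
Proof. by case: a => a /= /asboolP[]. Qed.

Definition adjoint a : H -> H := projT1 (cid (bop_adjoint_ex a)).

Lemma adjointP a : is_adjoint a (adjoint a).
Proof. by rewrite /adjoint; case: cid. Qed.

Lemma adjointP' a f g : ip f (a g) = ip (adjoint a f) g.
Proof. by rewrite ipC adjointP -ipC. Qed.

(** The square of the left side is the inner product of [f] with [a (adjoint a f)]; Cauchy-Schwarz
    bounds it and one factor [hn (adjoint a f)] cancels. *)
Lemma adjoint_bound a f : hn (adjoint a f) <= opnorm a * hn f.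
Proof.
have [h0|h0] := eqVneq (hn (adjoint a f)) 0.
  by rewrite h0 mulr_ge0 ?opnorm_ge0 ?hn_ge0.
have hp : 0 < hn (adjoint a f) by rewrite lt_def h0 hn_ge0.
rewrite -(ler_pM2r hp) -expr2 hn_sqr.
have E : nrmc (ip f (a (adjoint a f))) = hsq (adjoint a f).
  by rewrite adjointP' ip_hsq nrmR ger0_norm // hsq_ge0.
rewrite -E; apply: le_trans (cauchy_schwarz _ _) _.
by rewrite [opnorm a * _]mulrC -mulrA ler_wpM2l ?hn_ge0 // opnormP.
Qed.

Lemma bop_adj_subproof a : adjoint a \in bop_pred.
Proof.
apply/asboolP; split; first by exists a => f g; rewrite adjointP'.
by exists (opnorm a); split; [exact: opnorm_ge0|exact: adjoint_bound].
Qed.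

Definition bop_adj a : bop := Bop (bop_adj_subproof a).

Lemma bop_mul_subproof a b : (a : H -> H) \o b \in bop_pred.
Proof.
apply/asboolP; split.
  by exists (adjoint b \o adjoint a) => f g /=; rewrite !adjointP.
exists (opnorm a * opnorm b); split; first by rewrite mulr_ge0 ?opnorm_ge0.
move=> f /=; apply: le_trans (opnormP _ _) _.
by rewrite -mulrA ler_wpM2l ?opnorm_ge0 // opnormP.
Qed.

Definition bop_mul a b : bop := Bop (bop_mul_subproof a b).

Lemma bop_adj_unique a b : (forall f g, ip (a f) g = ip f (b g)) ->
  bop_adj a = b.
Proof.
move=> h; apply: bop_ext => f; apply: ip_inj => g /=.
by rewrite -adjointP' ipC h -ipC.
Qed.

Lemma bopD a f g : a (f + g) = a f + a g.
Proof. by apply: ip_inj => h; rewrite ipDl !adjointP ipDl. Qed.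

Lemma bopZ a (k : R[i]) f : a (k *: f) = k *: a f.
Proof. by apply: ip_inj => h; rewrite ipZl !adjointP ipZl. Qed.

Lemma opnormD a b : opnorm (a + b) <= opnorm a + opnorm b.
Proof.
apply: opnorm_le; first by rewrite addr_ge0 ?opnorm_ge0.
move=> f; rewrite mulrDl; apply: le_trans (hnD _ _) _.
by rewrite lerD // opnormP.
Qed.

Lemma opnormZ_le (k : R[i]) a : opnorm (k *: a) <= nrmc k * opnorm a.
Proof.
apply: opnorm_le; first by rewrite mulr_ge0 ?opnorm_ge0 ?nrm_ge0.
by move=> f; rewrite hnZ -mulrA ler_wpM2l ?nrm_ge0 // opnormP.
Qed.

Lemma opnorm_0 : opnorm 0 = 0.
Proof.
apply/eqP; rewrite eq_le opnorm_ge0 andbT; apply: opnorm_le => // f.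
by rewrite mul0r (hn_0 R X).
Qed.

Lemma opnormZ (k : R[i]) a : opnorm (k *: a) = nrmc k * opnorm a.
Proof.
have [->|k0] := eqVneq k 0; first by rewrite scale0r nrm0 mul0r opnorm_0.
apply/eqP; rewrite eq_le opnormZ_le /=.
have kp : 0 < nrmc k by rewrite lt_def nrm_eq0 k0 nrm_ge0.
have := opnormZ_le k^-1 (k *: a); rewrite scalerA mulVf // scale1r.
rewrite -(ler_pM2l kp) mulrA -(@nrmM _ k k^-1) mulfV //.
by rewrite (nrmR 1) normr1 mul1r.
Qed.

Lemma bop_norm_triangle a b :
  (opnorm (a + b))%:C%C <= (opnorm a)%:C%C + (opnorm b)%:C%C.
Proof. by rewrite -rmorphD lecR opnormD. Qed.

Lemma bop_normZ (k : R[i]) a : (opnorm (k *: a))%:C%C = `|k| * (opnorm a)%:C%C.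
Proof. by rewrite opnormZ rmorphM /= -(normE (k : R[i]^o)). Qed.

Lemma bop_norm_eq0 a : (opnorm a)%:C%C = 0 -> a = 0.
Proof.
move=> /complexI a0; apply: bop_ext => f; apply: hn_eq0; apply/eqP.
by rewrite eq_le hn_ge0 andbT; have := opnormP a f; rewrite a0 mul0r.
Qed.

HB.instance Definition _ := Lmodule_isNormed.Build R[i] bop
  bop_norm_triangle bop_normZ bop_norm_eq0.

Lemma nrm_bop a : nrm a = opnorm a.
Proof. by []. Qed.

End BoundedOperators.

Section BopComplete.
Context (R : realType) (X : choiceType).
Notation H := (l2 R X).
Notation bop := (bop R X).

Lemma cvg_nrmR (V : normedModType R[i]) (T : Type) (F : set_system T)
  (FF : Filter F) (f : T -> V) l : f @ F --> l -> (nrm (f x) : R) @[x --> F] -->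
    nrm l.
Proof.
move=> /cvg_nrm fl; apply/cvgrPdist_lt => eps e0.
apply: filterS (fl _ e0) => x; apply: le_lt_trans.
have := nrm_dist (f x) l; have := nrm_dist l (f x); rewrite nrmBC ler_norml.
by move=> h1 h2; apply/andP; split; lra.
Qed.

(** The limit is taken coordinate by coordinate. It is stated for an arbitrary family [h] because it
    will be applied to a Cauchy filter and also to the adjoints of its members. *)
Lemma bop_pointwise_limit (T : Type) (F : set_system T) (FF : ProperFilter F)
    (h : T -> bop) :
  (forall eps : R, 0 < eps -> \forall x & y \near F,
    opnorm (h x - h y) < eps) ->
  exists L : H -> H, forall eps : R, 0 < eps ->
    \forall t \near F, forall f, hn (L f - h t f) <= eps * hn f.
Proof.
move=> hc.
have pc f x : cvg ((fun t => h t f x : R[i]^o) @ F).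
  apply: complex_complete; apply/cauchy_nrm => eps e0.
  have d0 : 0 < eps / (hn f + 1) by rewrite divr_gt0 // ltr_wpDl // hn_ge0.
  have [[A B] /= [FA FB] AB] := hc _ d0.
  exists ((fun t => h t f x) @` A, (fun t => h t f x) @` B) => /=.
    by split; [apply: filterS FA|apply: filterS FB] => t ?; exists t.
  move=> [_ _] /= [[t At <-] [u Bu <-]].
  have := AB (t, u) (conj At Bu); rewrite /= => htu.
  rewrite (_ : _ - _ = (h t - h u) f x) //.
  apply: le_lt_trans (nrm_le_hn _ _) _; apply: le_lt_trans (opnormP _ _) _.
  have : opnorm (h t - h u) * (hn f + 1) < eps.
    by rewrite -ltr_pdivlMr // ltr_wpDl // hn_ge0.
  by apply: le_lt_trans; rewrite ler_wpM2l ?opnorm_ge0 // lerDl.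
pose l f x : R[i] := lim ((fun t => h t f x : R[i]^o) @ F).
have lP eps : 0 < eps -> \forall t \near F, forall f G,
    sqs (fun x => l f x - h t f x) G <= (eps * hn f) ^+ 2.
  move=> e0; have [[A B] /= [FA FB] AB] := hc _ e0.
  apply: filterS FA => t At f G.
  (* On a finite set [G] the square sum depends on finitely many coordinates, so a bound uniform in
     [G] survives the limit. *)
  have c1 : sqs (fun x => h u f x - h t f x) G @[u --> F] -->
      sqs (fun x => l f x - h t f x) G.
    apply: cvg_big; first exact: add_continuous.
    move=> x _; apply: cvgM; apply: cvg_nrmR; apply: cvgB.
    - exact: pc.
    - exact: cvg_cst.
    - exact: pc.
    - exact: cvg_cst.
  apply: (cvgr_to_le c1); apply: filterS FB => u Bu.
  have := AB (t, u) (conj At Bu); rewrite /= => htu.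
  apply: (@le_trans _ _ (hsq ((h u - h t) f)));
    first exact: (sqs_le_hsq ((h u - h t) f) G).
  have eh : 0 <= eps * hn f := mulr_ge0 (ltW e0) (hn_ge0 f).
  rewrite -hn_sqr ler_pXn2r ?nnegrE ?hn_ge0 //.
  apply: le_trans (opnormP _ _) _; rewrite ler_wpM2r ?hn_ge0 //.
  by rewrite -nrm_bop nrmBC nrm_bop ltW.
have lm f : l f \in @l2_pred R X.
  have [t /(_ f) h1] := filter_ex (lP 1 ltr01).
  have h2 : (fun x => l f x - h t f x) \in @l2_pred R X by apply: l2_predP (h1).
  rewrite (_ : l f = L2 h2 + h t f); last by apply/funext => x /=;
    rewrite subrK.
  exact: valP.
exists (fun f => L2 (lm f)) => eps e0; apply: filterS (lP _ e0) => t h1 f.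
apply: hn_le; first by rewrite mulr_ge0 ?hn_ge0 // ltW.
by apply: hsq_le => G; exact: h1.
Qed.

Lemma bop_adjB (a b : bop) : bop_adj (a - b) = bop_adj a - bop_adj b.
Proof.
apply: bop_adj_unique => f g /=.
by rewrite ipDl ipNl !adjointP ipDr ipNr.
Qed.

Lemma opnorm_adj (a : bop) : opnorm (bop_adj a) <= opnorm a.
Proof. by apply: opnorm_le; [exact: opnorm_ge0|exact: adjoint_bound]. Qed.

(** The limit must itself have an adjoint; the limit [L'] of the adjoints serves as one. *)
Lemma bop_complete (F : set_system bop) : ProperFilter F -> cauchy F -> cvg F.
Proof.
move=> FF /cauchy_nrm Fc.
have [L LP] := @bop_pointwise_limit _ F _ id Fc.
have [|L' LP'] := @bop_pointwise_limit _ F _ (@bop_adj R X).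
  move=> eps /Fc; apply: filterS => -[x y] /=; apply: le_lt_trans.
  by rewrite -bop_adjB opnorm_adj.
have LB : L \in @bop_pred R X.
  apply/asboolP; split.
    exists L' => f g; apply/eqP; rewrite -subr_eq0 -(@nrm_eq0 _ R[i]^o) eq_le.
    rewrite nrm_ge0 andbT; apply/ler_addgt0Pr => eps e0; rewrite add0r.
    set M := hn f * hn g.
    have M0 : 0 <= M by rewrite mulr_ge0 ?hn_ge0.
    have d0 : 0 < eps / (2 * (M + 1)) by rewrite divr_gt0 // mulr_gt0 //
      ltr_wpDl.
    have [T [h1 h2]] := filter_ex (filterI (LP _ d0) (LP' _ d0)).
    have -> : ip (L f) g - ip f (L' g) =
        ip (L f - T f) g - ip f (L' g - bop_adj T g).
      by rewrite ipDl ipNl ipDr ipNr adjointP; ring.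
    apply: (@le_trans _ _ (2 * (eps / (2 * (M + 1)) * M))).
      apply: le_trans (nrmD _ _) _; rewrite nrmN mulr_natl mulr2n; apply: lerD.
        apply: le_trans (cauchy_schwarz _ _) _; rewrite mulrA.
        by rewrite ler_wpM2r ?hn_ge0.
      apply: le_trans (cauchy_schwarz _ _) _; rewrite mulrCA.
      by rewrite ler_wpM2l ?hn_ge0.
    have -> : 2 * (eps / (2 * (M + 1)) * M) = eps * (M / (M + 1)).
      by field; rewrite gt_eqF // ltr_wpDl.
    rewrite ger_pMr // ler_pdivrMr ?mul1r ?lerDl //.
    by rewrite ltr_wpDl.
  have [T h1] := filter_ex (LP 1 ltr01).
  exists (1 + opnorm T); split; first by rewrite addr_ge0 // opnorm_ge0.
  move=> f; rewrite -[L f](subrK (T f)) mulrDl; apply: le_trans (hnD _ _) _.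
  by rewrite lerD ?opnormP.
apply/cvg_ex; exists (Bop LB).
have -> : F = (@id bop) @ F by rewrite /fmap; apply/funext.
apply/cvg_nrm => eps e0; have e20 : 0 < eps / 2 by rewrite divr_gt0.
apply: filterS (LP _ e20) => T h1; rewrite nrm_bop.
apply: (@le_lt_trans _ _ (eps / 2));
  last by rewrite gtr_pMr // invf_lt1 // ltr1n.
by apply: opnorm_le => //; exact: ltW.
Qed.

HB.instance Definition _ := Uniform_isComplete.Build bop bop_complete.

Lemma bop_mulA : associative (@bop_mul R X).
Proof. by move=> a b c; apply: bop_ext. Qed.
Lemma bop_mulDl : left_distributive (@bop_mul R X) +%R.
Proof. by move=> a b c; apply: bop_ext. Qed.
Lemma bop_mulDr : right_distributive (@bop_mul R X) +%R.
Proof. by move=> a b c; apply: bop_ext => f; exact: bopD. Qed.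
Lemma bop_mulZl (k : R[i]) (x y : bop) : bop_mul (k *: x) y = k *: bop_mul x y.
Proof. exact: bop_ext. Qed.
Lemma bop_mulZr (k : R[i]) (x y : bop) : bop_mul x (k *: y) = k *: bop_mul x y.
Proof. by apply: bop_ext => f; exact: bopZ. Qed.
Lemma bop_adjK : involutive (@bop_adj R X).
Proof. by move=> a; apply: bop_adj_unique => f g; rewrite adjointP'. Qed.
Lemma bop_adjD : {morph @bop_adj R X : x y / x + y}.
Proof.
move=> a b; apply: bop_adj_unique => f g /=.
by rewrite ipDl !adjointP ipDr.
Qed.
Lemma bop_adjZ (k : R[i]) (x : bop) : bop_adj (k *: x) = k^*%C *: bop_adj x.
Proof.
apply: bop_adj_unique => f g /=.
by rewrite ipZl adjointP ipZr conjcK.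
Qed.
Lemma bop_adjM (x y : bop) :
  bop_adj (bop_mul x y) = bop_mul (bop_adj y) (bop_adj x).
Proof. by apply: bop_adj_unique => f g /=; rewrite !adjointP. Qed.
Lemma opnormM (x y : bop) : opnorm (bop_mul x y) <= opnorm x * opnorm y.
Proof.
apply: opnorm_le; first by rewrite mulr_ge0 ?opnorm_ge0.
move=> f /=; apply: le_trans (opnormP _ _) _.
by rewrite -mulrA ler_wpM2l ?opnorm_ge0 // opnormP.
Qed.
Lemma bop_normM (x y : bop) : `|bop_mul x y| <= `|x| * `|y|.
Proof. by rewrite !normE !nrm_bop -rmorphM lecR opnormM. Qed.
Lemma bop_norm_cstar (x : bop) : `|bop_mul (bop_adj x) x| = `|x| ^+ 2.
Proof.
rewrite !normE !nrm_bop -rmorphXn; congr (_%:C)%C; apply/eqP; rewrite eq_le.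
apply/andP; split.
  apply: le_trans (opnormM _ _) _.
  by rewrite expr2 ler_wpM2r ?opnorm_ge0 // opnorm_adj.
set M := opnorm (bop_mul _ _).
rewrite -[M]sqr_sqrtr ?opnorm_ge0 // ler_pXn2r ?nnegrE ?opnorm_ge0 ?sqrtr_ge0
  //.
apply: opnorm_le; first exact: sqrtr_ge0.
move=> f; apply: hn_le; first by rewrite mulr_ge0 ?sqrtr_ge0 ?hn_ge0.
rewrite exprMn sqr_sqrtr ?opnorm_ge0 //.
have -> : hsq (x f) = nrmc (ip (bop_mul (bop_adj x) x f) f).
  by rewrite /= -adjointP' ip_hsq nrmR ger0_norm // hsq_ge0.
apply: le_trans (cauchy_schwarz _ _) _.
by rewrite expr2 mulrA ler_wpM2r ?hn_ge0 // opnormP.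
Qed.

HB.instance Definition _ := CompleteNormedModule_isCStar.Build R bop
  bop_mulA bop_mulDl bop_mulDr bop_mulZl bop_mulZr bop_adjK bop_adjD bop_adjZ
  bop_adjM bop_normM bop_norm_cstar.

End BopComplete.

(** * C*-algebra preliminaries *)

Section GeometricSequences.
Context (R : realType) (V : completeNormedModType R[i]).

(** The explicit rate serves the square root iteration, the surjectivity of the diagonal isomorphism
    and the dyadic series of the gliding humps. *)
Lemma geometric_cvg (x : nat -> V) (C r : R) : 0 <= r < 1 ->
  (forall n, nrm (x n.+1 - x n) <= C * r ^+ n) ->
  exists l, forall n, nrm (l - x n) <= C * r ^+ n / (1 - r).
Proof.
move=> /andP[r0 r1] xr.
have r1' : 0 < 1 - r by rewrite subr_gt0.
have C0 : 0 <= C by have := le_trans (nrm_ge0 _) (xr 0%N); rewrite expr0 mulr1.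
have B0 n : 0 <= C * r ^+ n / (1 - r).
  exact: divr_ge0 (mulr_ge0 C0 (exprn_ge0 _ r0)) (ltW r1').
(* The full geometric tail is an invariant of this induction: the tail from [n.+1] plus the step at
   [n] is exactly the tail from [n]. *)
have xk k : forall n, nrm (x (n + k)%N - x n) <= C * r ^+ n / (1 - r).
  elim: k => [|k IH] n; first by rewrite addn0 subrr nrm0.
  apply: le_trans (nrm_trans _ (x n.+1) _) _; rewrite addnS -addSn.
  apply: le_trans (lerD (IH n.+1) (xr n)) _.
  rewrite le_eqVlt; apply/orP; left; apply/eqP; rewrite exprS; field.
  by rewrite gt_eqF.
have c0 : (C * r ^+ n / (1 - r)) @[n --> \oo] --> (0 : R).
  rewrite (_ : 0 = C * 0 / (1 - r)); last by rewrite mulr0 mul0r.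
  by apply: cvgMr_tmp; apply: cvgMl_tmp; apply: cvg_expr; rewrite ger0_norm.
have xc : cvg (x @ \oo).
  apply: cauchy_cvg; apply/cauchy_nrm => eps e0.
  have e2 : 0 < eps / 2 by rewrite divr_gt0.
  move/cvgrPdist_lt : c0 => /(_ _ e2) [N _ /(_ N (leqnn N))].
  rewrite sub0r normrN ger0_norm // => h.
  have h1 : (x @ \oo) (x @` [set m | (N <= m)%N]).
    by exists N => // m /= ?; exists m.
  exists (x @` [set m | (N <= m)%N], x @` [set m | (N <= m)%N]) => //.
  move=> [_ _] /= [[m Nm <-] [k Nk <-]].
  apply: le_lt_trans (nrm_trans _ (x N) _) _; rewrite (splitr eps).
  apply: ltrD; [|rewrite nrmBC]; apply: le_lt_trans h.
    by rewrite -(subnKC Nm).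
  by rewrite -(subnKC Nk).
exists (lim (x @ \oo)) => n; apply/ler_addgt0Pr => eps e0.
have [N _ h] := (cvg_nrm _ _ _).1 xc _ e0.
apply: le_trans (nrm_trans _ (x (n + N)%N) _) _.
rewrite addrC lerD // ltW //; apply: h => /=; exact: leq_addl.
Qed.

End GeometricSequences.

Section CStarLemmas.
Context (R : realType) (A : cstarType R).
Implicit Types x y z : A.

Lemma cmul0l x : 0 ** x = 0.
Proof. by apply: (addrI (0 ** x)); rewrite -cmulDl !addr0. Qed.

Lemma cmul0r x : x ** 0 = 0.
Proof. by apply: (addrI (x ** 0)); rewrite -cmulDr !addr0. Qed.

Lemma cmulNl x y : (- x) ** y = - (x ** y).
Proof. by rewrite -[- x]scaleN1r cmulZl scaleN1r. Qed.

Lemma cmulNr x y : x ** (- y) = - (x ** y).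
Proof. by rewrite -[- y]scaleN1r cmulZr scaleN1r. Qed.

Lemma cmulBl x y z : (x - y) ** z = x ** z - y ** z.
Proof. by rewrite cmulDl cmulNl. Qed.

Lemma cmulBr x y z : x ** (y - z) = x ** y - x ** z.
Proof. by rewrite cmulDr cmulNr. Qed.

Lemma cmul_suml (I : Type) (r : seq I) (P : pred I) (f : I -> A) x :
  (\sum_(i <- r | P i) f i) ** x = \sum_(i <- r | P i) f i ** x.
Proof.
elim/big_rec2: _ => [|i a b _ <-]; first exact: cmul0l.
exact: cmulDl.
Qed.

Lemma cmul_sumr (I : Type) (r : seq I) (P : pred I) (f : I -> A) x :
  x ** (\sum_(i <- r | P i) f i) = \sum_(i <- r | P i) x ** f i.
Proof.
elim/big_rec2: _ => [|i a b _ <-]; first exact: cmul0r.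
exact: cmulDr.
Qed.

Lemma star0 : star (0 : A) = 0.
Proof. by apply: (addrI (star 0)); rewrite -starD !addr0. Qed.

Lemma starN x : star (- x) = - star x.
Proof. by rewrite -scaleN1r starZ rmorphN rmorph1 scaleN1r. Qed.

Lemma starB x y : star (x - y) = star x - star y.
Proof. by rewrite starD starN. Qed.

Lemma star_sum (I : Type) (r : seq I) (P : pred I) (f : I -> A) :
  star (\sum_(i <- r | P i) f i) = \sum_(i <- r | P i) star (f i).
Proof.
elim/big_rec2: _ => [|i a b _ <-]; first exact: star0.
exact: starD.
Qed.

Lemma starZR (k : R) x : star (k%:C%C *: x) = k%:C%C *: star x.
Proof. by rewrite starZ conjc_real. Qed.

Lemma nrm_cmul x y : nrm (x ** y) <= nrm x * nrm y.
Proof. by rewrite nrm_le rmorphM /= -!normE norm_cmul_le. Qed.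

Lemma nrm_cstar x : nrm (star x ** x) = nrm x ^+ 2.
Proof. by apply: (@complexI R); rewrite rmorphXn /= -!normE norm_cstar. Qed.

Lemma nrm_star x : nrm (star x) = nrm x.
Proof.
have le y : nrm y <= nrm (star y).
  have [->|y0] := eqVneq (nrm y) 0; first exact: nrm_ge0.
  have yp : 0 < nrm y by rewrite lt_def y0 nrm_ge0.
  by rewrite -(ler_pM2r yp) -expr2 -nrm_cstar nrm_cmul.
by apply/eqP; rewrite eq_le le andbT -{2}(starK x) le.
Qed.

Lemma selfadjoint_sum_le (I : eqType) (r : seq I) (h : I -> A) (K : R) :
  uniq r -> (forall i, i \in r -> star (h i) = h i) ->
  (forall i j, i \in r -> j \in r -> i != j -> h i ** h j = 0) ->
  (forall i, i \in r -> nrm (h i) <= K) -> 0 <= K ->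
  nrm (\sum_(i <- r) h i) <= K.
Proof.
move=> ur hs ho hK K0.
(* Squaring an orthogonal self-adjoint family squares the norm of its sum, so
   the crude bound [size r * K] improves to [(size r) ^ (2^-n) * K]. *)
have sqb n : nrm (\sum_(i <- r) h i) ^+ (2 ^ n) <= (size r)%:R * K ^+ (2 ^ n).
  elim: n h K hs ho hK K0 => [|n IH] h K hs ho hK K0.
    rewrite !expr1; apply: le_trans (nrm_sum _ _ _) _.
    rewrite -sum1_size natr_sum big_distrl /= big_seq [X in _ <= X]big_seq.
    by apply: ler_sum => i ir; rewrite mul1r hK.
  have E : \sum_(i <- r) h i ** h i =
      star (\sum_(i <- r) h i) ** (\sum_(i <- r) h i).
    rewrite star_sum cmul_suml big_seq [RHS]big_seq; apply: eq_bigr => i ir.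
    rewrite cmul_sumr (bigD1_seq i) //= big_seq_cond big1 ?addr0 ?hs // => j.
    by move=> /andP[jr ji]; rewrite ho // eq_sym.
  have := IH (fun i => h i ** h i) (K ^+ 2); rewrite E nrm_cstar.
  rewrite -!exprM -expnS; apply.
  - by move=> i ir; rewrite starM hs.
  - by move=> i j ir jr ij; rewrite cmulA -(cmulA (h i)) ho // cmul0r cmul0l.
  - move=> i ir; apply: le_trans (nrm_cmul _ _) _.
    by rewrite -expr2 ler_pXn2r ?nnegrE ?nrm_ge0 ?hK.
  - exact: exprn_ge0.
rewrite leNgt; apply/negP => Kx; set m := nrm _ in sqb Kx.
have [K00|Kn0] := eqVneq K 0.
  have := sqb 0%N; rewrite !expr1 K00 mulr0; lra.
have Kp : 0 < K by rewrite lt_def Kn0.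
(* As [m = K * (1 + t)], the bounds become [(1 + t) ^ (2 ^ n) <= size r] for all [n], and
   Bernoulli's inequality refutes them. *)
pose t := m / K - 1.
have t0 : 0 < t by rewrite subr_gt0 ltr_pdivlMr ?mul1r.
have mK : m = K * (1 + t) by rewrite /t addrC subrK mulrCA mulfV // mulr1.
have bern n : 1 + n%:R * t <= (1 + t) ^+ n.
  elim: n => [|n IH]; first by rewrite mul0r addr0.
  rewrite exprS -natr1.
  have n0 : 0 <= n%:R :> R by rewrite ler0n.
  by move: IH; set z := _ ^+ n; nra.
pose N := Num.truncn ((size r)%:R / t).
have hN : (size r)%:R < N.+1%:R * t.
  rewrite -ltr_pdivrMr // /N; apply: truncnS_gt.
have := sqb N.+1; rewrite mK exprMn mulrC ler_pM2r ?exprn_gt0 //.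
have := bern (2 ^ N.+1)%N.
have : N.+1%:R * t <= (2 ^ N.+1)%:R * t.
  by rewrite ler_pM2r // ler_nat ltnW // ltn_expl.
lra.
Qed.

(** The C*-identity reduces this to the self-adjoint elements [star (b i) ** b i]: the first
    orthogonality relation removes the cross terms, the second makes these elements mutually
    orthogonal. *)
Lemma orthogonal_sum_le (I : eqType) (r : seq I) (b : I -> A) (M : R) :
  uniq r ->
  (forall i j, i \in r -> j \in r -> i != j ->
     star (b i) ** b j = 0 /\ b i ** star (b j) = 0) ->
  (forall i, i \in r -> nrm (b i) <= M) -> 0 <= M ->
  nrm (\sum_(i <- r) b i) <= M.
Proof.
move=> ur bo bM M0.
rewrite -(ler_pXn2r (ltn0Sn 1)) ?nnegrE ?nrm_ge0 // -nrm_cstar.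
rewrite (_ : _ ** _ = \sum_(i <- r) star (b i) ** b i); last first.
  rewrite star_sum cmul_suml big_seq [RHS]big_seq; apply: eq_bigr => i ir.
  rewrite cmul_sumr (bigD1_seq i) //= big_seq_cond big1 ?addr0 // => j.
  by move=> /andP[jr ji]; case: (bo i j) => //; rewrite eq_sym.
apply: selfadjoint_sum_le => //.
- by move=> i _; rewrite starM starK.
- move=> i j ir jr ij; rewrite cmulA -(cmulA (star (b i))).
  by case: (bo _ _ ir jr ij) => _ ->; rewrite cmul0r cmul0l.
- by move=> i ir; rewrite nrm_cstar ler_pXn2r ?nnegrE ?nrm_ge0 ?bM.
- exact: exprn_ge0.
Qed.

Lemma nrm_proj_le1 x : is_proj x -> nrm x <= 1.
Proof.
move=> [xx xs]; have [->|x0] := eqVneq (nrm x) 0 => //.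
have xp : 0 < nrm x by rewrite lt_def x0 nrm_ge0.
by rewrite -(ler_pM2l xp) mulr1 -expr2 -nrm_cstar xs xx.
Qed.

End CStarLemmas.

(** * Contractivity of representations on l2 *)

Section StarHomContraction.
Context (R : realType) (A : cstarType R) (X : choiceType) (pi : A -> bop R X).
Hypothesis pi_hom : star_hom pi.

(* [b = 1 - sqrt (1 - h ^ 2)], as the fixed point of [b |-> (h ^ 2 + b ^ 2) / 2]
   because [A] need not have a unit. *)
Lemma quasi_sqrt (h : A) : star h = h -> nrm h < 1 ->
  exists b : A, star b = b /\ h ** h + b ** b = 2%:R *: b.
Proof.
move=> hs h1; set r := nrm h in h1.
pose g (b : A) := (2^-1)%:C%C *: (h ** h + b ** b).
have half0 : 0 <= 2^-1 :> R by rewrite invr_ge0.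
have r0 : 0 <= r := nrm_ge0 h.
have gD (b c : A) : nrm (g b - g c) <= 2^-1 * ((nrm b + nrm c) * nrm (b - c)).
  rewrite /g -scalerBr nrmZR // ler_wpM2l //.
  have -> : h ** h + b ** b - (h ** h + c ** c) = b ** (b - c) + (b - c) ** c.
    by rewrite cmulBr cmulBl opprD addrACA subrr add0r addrA subrK.
  apply: le_trans (nrmD _ _) _; rewrite mulrDl; apply: lerD.
    exact: nrm_cmul.
  by rewrite mulrC nrm_cmul.
(* The ball of radius [r] is invariant because [(r^2 + r^2) / 2 <= r], and by [gD] the map [g]
   contracts it by the factor [r < 1]. *)
have x_le n : nrm (iter n g 0) <= r.
  elim: n => [|n IH] /=; first by rewrite nrm0.
  rewrite nrmZR //; apply: (@le_trans _ _ (2^-1 * (r ^+ 2 + r ^+ 2))).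
    rewrite ler_wpM2l //; apply: le_trans (nrmD _ _) _; apply: lerD.
      exact: nrm_cmul.
    apply: le_trans (nrm_cmul _ _) _.
    by rewrite -expr2 ler_pXn2r ?nnegrE ?nrm_ge0.
  nra.
have x_star n : star (iter n g 0) = iter n g 0.
  elim: n => [|n IH] /=; first exact: star0.
  by rewrite {1}/g starZR starD !starM hs IH.
have [|n|b hb] := @geometric_cvg _ _ (fun n => iter n g 0) r r.
- by rewrite r0.
- elim: n => [|n IH]; first by rewrite expr0 mulr1 subr0 x_le.
  rewrite !iterS; apply: le_trans (gD _ _) _.
  have l1 := x_le n; have l2 := x_le n.+1; rewrite !iterS in l2 IH *.
  move: l1 l2 IH (nrm_ge0 (iter n g 0)) (nrm_ge0 (g (iter n g 0)))
    (nrm_ge0 (g (iter n g 0) - iter n g 0)) (exprn_ge0 n r0).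
  rewrite exprS.
  set a := nrm (_ - _); set u := nrm _; set v := nrm _; set w := r ^+ n.
  move=> l1 l2 IH u0 v0 a0 w0.
  have : (v + u) * a <= (r + r) * (r * w) by apply: ler_pM => //; nra.
  nra.
have x_cvg : (r * r ^+ n / (1 - r)) @[n --> \oo] --> (0 : R).
  rewrite (_ : 0 = r * 0 / (1 - r)); last by rewrite mulr0 mul0r.
  by apply: cvgMr_tmp; apply: cvgMl_tmp; apply: cvg_expr; rewrite ger0_norm.
have x_eps eps : 0 < eps -> exists n, nrm (b - iter n g 0) < eps /\
    nrm (b - iter n.+1 g 0) < eps.
  move=> e0; move/cvgrPdist_lt : x_cvg => /(_ _ e0) [N _ hN]; exists N.
  split; apply: le_lt_trans (hb _) _.
    have := hN N (leqnn N); rewrite sub0r normrN; apply: le_lt_trans.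
    exact: ler_norm.
  have := hN N.+1 (leqnSn N); rewrite sub0r normrN; apply: le_lt_trans.
  exact: ler_norm.
exists b; split.
  apply/eqP; rewrite -subr_eq0 -nrm_eq0 eq_le nrm_ge0 andbT.
  apply/ler_addgt0Pr => eps e0; rewrite add0r.
  have [n [hn _]] := x_eps _ (divr_gt0 e0 (ltr0n _ 2)).
  apply: le_trans (nrm_trans _ (iter n g 0) _) _.
  rewrite -{1}x_star -starB nrm_star (nrmBC _ b); lra.
have bg : b = g b.
  apply/eqP; rewrite -subr_eq0 -nrm_eq0 eq_le nrm_ge0 andbT.
  apply/ler_addgt0Pr => eps e0; rewrite add0r.
  have d0 : 0 < eps / (1 + (r + nrm b)).
    by rewrite divr_gt0 // ltr_pwDl // addr_ge0 // nrm_ge0.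
  have [n [h1n h2n]] := x_eps _ d0.
  apply: le_trans (nrm_trans _ (iter n.+1 g 0) _) _.
  apply: (@le_trans _ _ (eps / (1 + (r + nrm b)) * (1 + (r + nrm b)))).
    rewrite mulrDr mulr1; apply: lerD; first exact: ltW.
    apply: le_trans (gD _ _) _; rewrite (nrmBC _ b).
    have l1 := x_le n; have l2 := nrm_ge0 b; have l3 := nrm_ge0 (iter n g 0).
    have l4 := nrm_ge0 (b - iter n g 0).
    apply: (@le_trans _ _ (1 * ((nrm (iter n g 0) + nrm b) * nrm (b - iter n g
      0)))).
      by rewrite ler_wpM2r ?mulr_ge0 ?addr_ge0 // invf_le1 // ler1n.
    rewrite mul1r mulrC; apply: ler_pM => //; first exact: addr_ge0.
      exact: ltW.
    by rewrite lerD2r.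
  by rewrite divfK // gt_eqF // ltr_pwDl // addr_ge0 // nrm_ge0.
by rewrite {3}bg /g scalerA fmorphV rmorph_nat mulfV ?scale1r //.
Qed.

Lemma hom_selfadjoint_le (h : A) : star h = h -> opnorm (pi h) <= nrm h.
Proof.
have [piL piM piS] := pi_hom.
have pi0 : pi 0 = 0.
  have := piL (-1) 0 0; rewrite scaler0 addr0 => ->.
  by rewrite scaleN1r addNr.
have piD x y : pi (x + y) = pi x + pi y.
  by have := piL 1 x y; rewrite !scale1r.
have piZ k x : pi (k *: x) = k *: pi x.
  by have := piL k x 0; rewrite !addr0 pi0 addr0.
have le1 (k : A) : star k = k -> nrm k < 1 -> opnorm (pi k) <= 1.
  move=> ks k1; have [b [bs bE]] := quasi_sqrt ks k1.
  apply: opnorm_le => // f; rewrite mul1r; apply: hn_le; first exact: hn_ge0.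
  rewrite hn_sqr.
  have sa (x : A) g g' : star x = x -> ip (pi x g) g' = ip g (pi x g').
    by move=> xs; rewrite adjointP -[adjoint _ _]/(star (pi x) g') -piS xs.
  have sq (x : A) : star x = x -> ip (pi (x ** x) f) f = (hsq (pi x f))%:C%C.
    by move=> xs; rewrite piM -ip_hsq /= sa.
  (* [1 - k^2 = (1 - b)^2], so [|k f|^2 + |f - b f|^2 = |f|^2] *)
  have E : hsq (f - pi b f) + hsq (pi k f) = hsq f.
    apply: (@complexI R); rewrite rmorphD /= -(sq k ks) -!ip_hsq.
    rewrite ipDl ipNl !ipDr !ipNr (ip_hsq (pi b f)) -(sq b bs) -(sa b f f bs).
    have E2 : ip (pi (k ** k) f) f + ip (pi (b ** b) f) f = 2%:R * ip (pi b f)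
      f.
      rewrite -ipZl -ipDl; move/(congr1 pi): bE; rewrite piD piZ.
      by move=> /(congr1 (fun T : bop R X => ip (T f) f)).
    have -> : ip (pi (k ** k) f) f = 2%:R * ip (pi b f) f - ip (pi (b ** b) f)
      f.
      by rewrite -E2 addrK.
    by ring.
  have := hsq_ge0 (f - pi b f); lra.
move=> hs; apply/ler_addgt0Pr => eps e0.
have tp : 0 < nrm h + eps by rewrite ltr_wpDl // nrm_ge0.
have ti : 0 <= (nrm h + eps)^-1 by rewrite invr_ge0 ltW.
have := le1 ((nrm h + eps)^-1%:C%C *: h).
rewrite starZR hs nrmZR // mulrC ltr_pdivrMr // mul1r ltrDl => /(_ erefl e0).
rewrite piZ opnormZ nrmR ger0_norm // mulrC.
by rewrite ler_pdivrMr // mul1r.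
Qed.

Lemma hom_contractive (a : A) : opnorm (pi a) <= nrm a.
Proof.
have [_ piM piS] := pi_hom.
rewrite -(ler_pXn2r (ltn0Sn 1)) ?nnegrE ?opnorm_ge0 ?nrm_ge0 //.
rewrite -nrm_cstar -nrm_bop -nrm_cstar -piS -piM nrm_bop.
by apply: hom_selfadjoint_le; rewrite starM starK.
Qed.

End StarHomContraction.

(** * The boundary path space *)

Section BoundaryPaths.
Context (E : digraph).
Implicit Types (x y : bpath E) (e f : edge E) (v : vert E) (eta : fin_path E).

Lemma bfin_eq p q (ps : singular (fp_src p)) (qs : singular (fp_src q)) :
  fp_rng p = fp_rng q -> fp_word p = fp_word q -> @BFin E p ps = BFin qs.
Proof.
case: p q ps qs => [v w vw] [v' w' vw'] /= ps qs vv ww.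
move: v' w' vw' qs vv ww => v' w' vw' qs vv ww; subst v' w'.
have E1 : vw = vw' by exact: bool_irrelevance.
by subst vw'; congr BFin; exact: Prop_irrelevance.
Qed.

Lemma binf_eq (a b : inf_path E) : ip_edge a =1 ip_edge b -> BInf a = BInf b.
Proof.
case: a b => [a aP] [b bP] /= /funext ab; subst b; congr (BInf (IPath _)).
exact: Prop_irrelevance.
Qed.

Definition vpath v : fin_path E := @FPath E v [::] isT.

Lemma fin_path_eq (p q : fin_path E) :
  fp_rng p = fp_rng q -> fp_word p = fp_word q -> p = q.
Proof.
case: p q => [v w vw] [v' w' vw'] /= vv ww; subst v' w'.
by congr FPath; exact: bool_irrelevance.
Qed.

Lemma fin_pathP eta : (eta = vpath (fp_rng eta)) \/
  exists e (eta' : fin_path E) (h : src e = fp_rng eta'), eta = fcons h.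
Proof.
case: eta => v [|e w] P; first by left; exact: fin_path_eq.
right; have := P; rewrite /= => /andP[/eqP ev ew].
have h : src e = fp_rng (FPath ew) by [].
by exists e, (FPath ew), h; exact: fin_path_eq.
Qed.

(** Splitting off the first edge treats finite and infinite boundary paths alike; most pointwise
    arguments below start from this case distinction. *)
Lemma vpath_or_bcons x :
  (exists ps : singular (fp_src (vpath (brng x))), x = BFin ps) \/
  exists e y (h : src e = brng y), x = bcons h.
Proof.
case: x => [[v [|e w] P] ps|[a aP]].
- left; have ps' : singular (fp_src (vpath v)) by [].
  by exists ps'; apply: bfin_eq.
- right; have := P; rewrite /= => /andP[/eqP ev ew].
  have qs : singular (fp_src (FPath ew)) by move: ps; rewrite /fp_src.
  have h : src e = brng (BFin qs) by [].
  by exists e, (BFin qs), h; exact: bfin_eq.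
- right; pose b : inf_path E := @IPath E (fun n => a n.+1) (fun n => aP n.+1).
  have h : src (a 0%N) = brng (BInf b) by exact: aP.
  by exists (a 0%N), (BInf b), h; apply: binf_eq; case.
Qed.

Lemma brng_bcons e y (h : src e = brng y) : brng (bcons h) = rng e.
Proof. by case: y h. Qed.

Lemma bcons_inj e f x y (h : src e = brng x) (k : src f = brng y) :
  bcons h = bcons k -> e = f /\ x = y.
Proof.
case: x y h k => [p ps|a] [q qs|b] //= h k [].
  by move=> _ ef pq; split=> //; apply: bfin_eq => //; rewrite -h -k ef.
move=> ab; have ab' n := congr1 (fun g : nat -> edge E => g n) ab.
by split; [exact: (ab' 0%N)|apply: binf_eq => n; exact: (ab' n.+1)].
Qed.

Lemma bcons_irr e x (h k : src e = brng x) : bcons h = bcons k.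
Proof. by rewrite (Prop_irrelevance h k). Qed.

Lemma begins_vpath x v : begins_with x (vpath v) <-> brng x = v.
Proof. by split=> [[]//|xv]; split=> //; case: (x) => // p _ /=;
  rewrite prefix0s. Qed.

Lemma vpath_not_bcons v (ps : singular (fp_src (vpath v))) e y
  (h : src e = brng y) : BFin ps <> bcons h.
Proof. by case: y h. Qed.

Lemma begins_bcons e y (h : src e = brng y) f eta (k : src f = fp_rng eta) :
  begins_with (bcons h) (fcons k) <-> e = f /\ begins_with y eta.
Proof.
case: y h => [p ps|a] h.
  rewrite /begins_with /=; split.
    move=> [_ /andP[/eqP fe pre]]; split=> //; split=> //.
    by move: h; rewrite /= -k fe.
  by move=> [ef [pe pre]]; split; [rewrite ef|rewrite ef eqxx].
have E0 n : mkseq (ip_edge (icons h)) n.+1 = e :: mkseq (ip_edge a) n.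
  by rewrite /mkseq /= -[in LHS](addn0 1%N) iotaDl -map_comp.
split.
  move=> [_ we].
  have : f :: fp_word eta = mkseq (ip_edge (icons h)) (size (fp_word eta)).+1 :=
    we.
  by rewrite E0 => -[fe we']; split=> //; split=> //; rewrite -k fe -h.
move=> [ef [re we]]; subst f; split=> //.
change (e :: fp_word eta = mkseq (ip_edge (icons h)) (size (fp_word eta)).+1).
by rewrite E0 -we.
Qed.

Lemma vpath_not_begins v (ps : singular (fp_src (vpath v))) f eta
  (k : src f = fp_rng eta) : ~ begins_with (BFin ps) (fcons k).
Proof. by move=> []. Qed.

(** Keep choosing incoming edges. Either this stops at a vertex that receives none, which is
    singular, or it produces an infinite path. Hence every vertex is seen by suprema over boundary
    paths. *)
Lemma bpath_ex v : exists x, brng x = v.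
Proof.
pose nx (u : vert E) : option (edge E) :=
  if pselect (exists e, rng e = u) is left h then Some (projT1 (cid h)) else
    None.
have nxP u e : nx u = Some e -> rng e = u.
  by rewrite /nx; case: pselect => // h [<-]; case: cid.
have nxN u : nx u = None -> in_edges u = set0.
  rewrite /nx; case: pselect => // h _; apply/seteqP; split=> // e /= eu.
  by apply: h; exists e.
have fin_case n : forall u, iter n (fun o => if o is Some w then
    omap (@src E) (nx w) else None) (Some u) = None -> exists x, brng x = u.
  elim: n => [//|n IH] u; rewrite iterSr.
  case nu : (nx u) => [e|] /=.
    move=> /IH [y ye].
    exists (@bcons E e y (esym ye)); rewrite brng_bcons; exact: nxP.
  move=> _; have ps : singular (fp_src (vpath u)) by right; exact: nxN.
  by exists (BFin ps).
have [[n hn]|hn] := pselect (exists n, iter n (fun o => if o is Some w then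
    omap (@src E) (nx w) else None) (Some v) = None); first exact: (fin_case n).
have ex_edge n : exists e, exists2 w, iter n (fun o => if o is Some w then
    omap (@src E) (nx w) else None) (Some v) = Some w & nx w = Some e.
  case En : (iter n _ _) => [w|]; last by case: hn; exists n.
  case Ew : (nx w) => [e|]; first by exists e, w.
  by case: hn; exists n.+1; rewrite iterS En Ew.
pose a n := projT1 (cid (ex_edge n)).
have aP n : exists2 w, iter n (fun o => if o is Some w then
    omap (@src E) (nx w) else None) (Some v) = Some w & nx w = Some (a n).
  by rewrite /a; case: cid.
have ap n : src (a n) = rng (a n.+1).
  have [w wn wa] := aP n; have [w' wn' wa'] := aP n.+1.
  by rewrite (nxP _ _ wa'); move: wn'; rewrite iterS wn wa => -[].
exists (BInf (IPath ap)) => /=.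
by have [w [<-] /nxP] := aP 0%N.
Qed.

Definition bnth x (n : nat) : option (edge E) :=
  match x with
  | BFin p _ => nth None [seq Some e | e <- fp_word p] n
  | BInf a => Some (ip_edge a n)
  end.

Lemma bnth_bcons e y (h : src e = brng y) n :
  bnth (bcons h) n = if n is m.+1 then bnth y m else Some e.
Proof. by case: y h n => [p ps|a] h []. Qed.

(** A letterwise form of [begins_with]: it makes a cylinder a finite intersection of conditions on
    single letters, and it makes sense for words not yet known to be paths. *)
Definition follows x (w : seq (edge E)) :=
  forall i e, nth None [seq Some e | e <- w] i = Some e -> bnth x i = Some e.

Lemma follows_cons e w x : follows x (e :: w) <->
  exists y (h : src e = brng y), x = bcons h /\ follows y w.
Proof.
split=> [xw|[y [h [-> yw]]] [|i] f /=]; last 2 first.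
- by move=> [<-]; rewrite bnth_bcons.
- by move=> /yw; rewrite bnth_bcons.
have [[ps xE]|[f [y [h xE]]]] := vpath_or_bcons x.
  by have := xw 0%N e erefl; rewrite xE.
have ef : f = e by have := xw 0%N e erefl; rewrite xE bnth_bcons => -[].
subst f; exists y, h; split=> // i f fi.
by have := xw i.+1 f fi; rewrite xE bnth_bcons.
Qed.

Lemma begins_follows x eta :
  begins_with x eta <-> brng x = fp_rng eta /\ follows x (fp_word eta).
Proof.
case: eta => v w P; elim: w v x P => [|e w IH] v x P.
  rewrite (_ : FPath P = vpath v); last exact: fin_path_eq.
  by rewrite begins_vpath /=; split=> [h|[]//]; split=> // -[].
have := P; rewrite /= => /andP[/eqP ev ew].
have h : src e = fp_rng (FPath ew) by [].
rewrite (_ : FPath P = fcons h); last exact: fin_path_eq.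
rewrite follows_cons.
have [[ps ->]|[f [y [k ->]]]] := vpath_or_bcons x.
  split=> [/vpath_not_begins//|[_ [y [k [/vpath_not_bcons]]]]//].
rewrite begins_bcons IH brng_bcons; split.
  by move=> [fe [yr yw]]; subst f; split=> //; exists y, k.
move=> [_ [y' [k' [E1 yw]]]]; have [fe yy] := bcons_inj E1; subst f y'.
by split=> //; split=> //; rewrite -k.
Qed.

Lemma follows_path w x : follows x w -> is_path (brng x) w.
Proof.
elim: w x => [//|e w IH] x /follows_cons [y [h [-> yw]]].
by rewrite brng_bcons /= eqxx h IH.
Qed.

Lemma follows_next w x : follows x w -> 
  match bnth x (size w) with
  | Some e => rng e = last (brng x) [seq src e | e <- w]
  | None => exists p ps, x = @BFin E p ps /\ fp_word p = w
  end.
Proof.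
elim: w x => [|e w IH] x.
  move=> _; have [[ps ->]|[f [y [k ->]]]] := vpath_or_bcons x.
    by rewrite /=; eexists; exists ps.
  by rewrite bnth_bcons brng_bcons.
move=> /follows_cons [y [h [-> yw]]]; rewrite bnth_bcons /=.
have := IH y yw; case: (bnth y _) => [f|]; first by rewrite h.
move=> [p [ps [yE pw]]]; subst y.
by exists (fcons h), (fcons_singular h ps); split=> //=; rewrite pw.
Qed.

(** Cylinders and their complements form a subbase, so convergence to [x] has to be tested only on
    them. *)
Lemma bpath_nbhs (x : bpath E) (F : set_system (bpath E)) : Filter F ->
  (forall eta, begins_with x eta -> F (bcylinder eta)) ->
  (forall eta, ~ begins_with x eta -> F (~` bcylinder eta)) ->
  nbhs x `<=` F.
Proof.
move=> FF F1 F2 A; rewrite nbhsE => -[B [[D' sD BE] Bx] BA].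
apply: filterS BA _.
move: Bx; rewrite -BE => -[C DC Cx].
have [G GD GE] := sD _ DC.
apply: (@filterS _ F _ C); first by move=> y Cy; exists C.
rewrite -GE; apply: filter_bigI => S SG.
have := GD _ SG; rewrite inE /= => -[eta [SE|SE]]; rewrite SE.
  by apply: F1; move: Cx; rewrite -GE => /(_ S SG); rewrite SE.
by apply: F2; move: Cx; rewrite -GE => /(_ S SG); rewrite SE.
Qed.

Lemma bcylinder_open eta : open (bcylinder eta).
Proof.
exists [set bcylinder eta]; last by rewrite bigcup_set1.
move=> _ ->; exists [fset bcylinder eta]%fset.
  by move=> S; rewrite in_fset1 => /eqP ->; apply/mem_set; exists eta; left.
by rewrite set_fset1 bigcap_set1.
Qed.

Lemma bcylinder_closed eta : closed (bcylinder eta).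
Proof.
rewrite -[bcylinder eta]setCK; apply: open_closedC.
exists [set ~` bcylinder eta]; last by rewrite bigcup_set1.
move=> _ ->; exists [fset ~` bcylinder eta]%fset.
  by move=> S; rewrite in_fset1 => /eqP ->; apply/mem_set; exists eta; right.
by rewrite set_fset1 bigcap_set1.
Qed.

Lemma bnth_next n x e f :
  bnth x n = Some e -> bnth x n.+1 = Some f -> src e = rng f.
Proof.
elim: n x => [|n IH] x; have [[ps ->]|[g [y [h ->]]]] := vpath_or_bcons x => //.
  rewrite !bnth_bcons => -[<-]; rewrite h.
  have [[ps ->]|[g' [y' [h' ->]]]] := vpath_or_bcons y => //.
  by rewrite bnth_bcons brng_bcons => -[->].
by rewrite !bnth_bcons; exact: IH.
Qed.

Lemma bnth0 x e : bnth x 0 = Some e -> brng x = rng e.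
Proof.
have [[ps ->]|[g [y [h ->]]]] := vpath_or_bcons x => //.
by rewrite bnth_bcons brng_bcons => -[->].
Qed.

(** An ultrafilter [U] decides at most one letter [e] at each position [n], written [P n e]. If
    every position is decided, these letters form an infinite path and [U] converges to it.
    Otherwise the letters before the first undecided position form a finite path, which is the
    limit. *)
Lemma bcylinder_vpath_compact v : compact (bcylinder (vpath v)).
Proof.
rewrite compact_ultra => U UU Uv.
have Ur : U [set x | brng x = v].
  by apply: filterS Uv => x /begins_vpath.
pose P n e := U [set x | bnth x n = Some e].
have PU n e f : P n e -> P n f -> e = f.
  by move=> h1 h2; have [x [/= -> []]] := filter_ex (filterI h1 h2).
pose stable w := forall i e, nth None [seq Some e | e <- w] i = Some e -> P i e.
have Uf w : stable w -> U [set y | follows y w].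
  move=> sw; have : U (\bigcap_(i in [set` [fset i in iota 0 (size w)]%fset])
      [set y | forall e, nth None [seq Some e | e <- w] i = Some e ->
         bnth y i = Some e]).
    apply: filter_bigI => i _.
    case E1 : (nth None _ i) => [e|]; last by apply: filterE.
    by apply: filterS (sw _ _ E1) => y /= yi f [<-].
  apply: filterS => y /= h i e ie; apply: (h i) => //=.
  rewrite !inE mem_iota add0n /= ltnNge; apply/negP => wi.
  by move: ie; rewrite nth_default // size_map.
have conv x : brng x = v -> (forall i e, bnth x i = Some e -> P i e) ->
    (forall w, stable w -> follows x w) -> nbhs x `<=` U.
  move=> xv h1 h2; apply: bpath_nbhs => eta.
    rewrite begins_follows => -[xr xf].
    apply: filterS (filterI Ur (Uf (fp_word eta) _)).
      by move=> y [/= yv yf]; apply/begins_follows; rewrite yv -xv.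
    by move=> i e /xf /h1.
  move=> nx; have [Ueta|//] := in_ultra_setVsetC (bcylinder eta) UU.
  case: nx; apply/begins_follows; split.
    have [y [/= yv /begins_follows[yr _]]] := filter_ex (filterI Ur Ueta).
    by rewrite xv -yv.
  apply: h2 => i e ie; apply: filterS Ueta => y /begins_follows[_ ]; exact.
have [inf|] := pselect (forall n, exists e, P n e).
  pose a n := projT1 (cid (inf n)).
  have aP n : P n (a n) by rewrite /a; case: cid.
  have ap n : src (a n) = rng (a n.+1).
    have [y [/= y1 y2]] := filter_ex (filterI (aP n) (aP n.+1)).
    exact: bnth_next y1 y2.
  have xv : brng (BInf (IPath ap)) = v.
    have [y [/= y1 y2]] := filter_ex (filterI (aP 0%N) Ur).
    by rewrite -y2 (bnth0 y1).
  exists (BInf (IPath ap)); split; first exact/begins_vpath.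
  apply: conv => // [i e [<-]//|w sw i e /sw ie /=].
  by rewrite (PU _ _ _ (aP i) ie).
move=> ninf.
have exn : exists n, `[< ~ exists e, P n e >].
  apply: contrapT => h; apply: ninf => n; apply: contrapT => hn.
  by apply: h; exists n; apply/asboolP.
case: (ex_minnP exn) => n /asboolP nP nmin.
have wex k : (k <= n)%N -> exists w, size w = k /\ stable w.
  elim: k => [_|k IH kn]; first by exists [::]; split=> // -[].
  have [w [wk sw]] := IH (ltnW kn).
  have [e ke] : exists e, P k e.
    apply: contrapT => h; have := nmin k; rewrite leqNgt kn => h'.
    by have := h' (asboolT h).
  exists (rcons w e); split; first by rewrite size_rcons wk.
  move=> i f; rewrite map_rcons nth_rcons size_map wk.
  case: ltngtP => [ik|//|ik]; first exact: sw.
  by move=> [<-]; rewrite ik.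
have [w [wn sw]] := wex n (leqnn n).
have US : U ([set x | brng x = v] `&` [set y | follows y w]).
  exact: filterI Ur (Uf w sw).
have wP : is_path v w.
  by have [y [/= <- /follows_path]] := filter_ex US.
(* Were the source of [w] regular, all continuations of [w] would use one of finitely many edges;
   [U] avoids each of them at position [n], hence all of them at once. *)
have ps : singular (fp_src (FPath wP)).
  apply: contrapT => /not_orP[/contrapT fin ne0].
  have Un : U (\bigcap_(e in [set` fset_set (in_edges (fp_src (FPath wP)))])
      ~` [set y | bnth y n = Some e]).
    apply: filter_bigI => e _.
    have [Ue|//] := in_ultra_setVsetC [set y | bnth y n = Some e] UU.
    by case: nP; exists e.
  have [y [/= [yv yw] yn]] := filter_ex (filterI US Un).
  have := follows_next yw; rewrite wn; case yE : (bnth y n) => [e|].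
    rewrite yv => re; apply: (yn e) => //=; rewrite in_fset_set // inE.
    exact: re.
  move=> [q [qs [yq qw]]].
  have E1 : fp_src q = fp_src (FPath wP) by rewrite /fp_src qw /= -yv yq.
  by case: (qs); rewrite E1.
exists (BFin ps); split; first exact/begins_vpath.
apply: conv => // w' sw' i e ie /=.
have iw' : (i < size w')%N.
  by rewrite ltnNge; apply/negP => h; move: ie; rewrite nth_default // size_map.
have iw : (i < size w)%N.
  (* A stable word longer than [n] would decide the undecided position [n]. *)
  rewrite wn ltnNge; apply/negP => ni; apply: nP; exists (nth e w' n).
  apply: sw'; rewrite (nth_map e) //; exact: leq_ltn_trans iw'.
rewrite (nth_map e) //; congr Some; apply: (PU i); last exact: sw'.
by apply: sw; rewrite (nth_map e).
Qed.

Lemma bcylinder_compact eta : compact (bcylinder eta).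
Proof.
apply: (@subclosed_compact _ _ (bcylinder (vpath (fp_rng eta)))).
- exact: bcylinder_closed.
- exact: bcylinder_vpath_compact.
- by move=> x [xr _]; apply/begins_vpath.
Qed.

End BoundaryPaths.

(** * The path space representation *)

Section PartialBijections.
Context (R : realType) (X : choiceType) (g h : X -> option X).
Hypothesis gh : forall x y, g x = Some y <-> h y = Some x.

Lemma sqs_pull (f : l2 R X) F : sqs (pull g (f : X -> R[i])) F <= hsq f.
Proof.
apply: le_trans (sqs_le_hsq f (pull_fset g F)); rewrite /sqs /partial_sum.
rewrite -(partial_sum_pull gh); apply: ler_sum => x _.
by rewrite /pull; case: (g x) => [//|]; rewrite nrm0 expr0n.
Qed.

Definition pcomp_fun (f : l2 R X) : l2 R X := L2 (l2_predP (sqs_pull f)).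

Lemma pcomp_funE f x : pcomp_fun f x = if g x is Some y then f y else 0.
Proof. by []. Qed.

End PartialBijections.

Section PartialBijectionOperators.
Context (R : realType) (X : choiceType) (g h : X -> option X).
Hypothesis gh : forall x y, g x = Some y <-> h y = Some x.

Let hg x y : h x = Some y <-> g y = Some x.
Proof. by rewrite gh. Qed.

Lemma pcomp_adjoint : is_adjoint (@pcomp_fun R X g h gh) (pcomp_fun hg).
Proof.
move=> f k; rewrite /ip.
rewrite -(csum_pull gh (f := fun y => f y * (pcomp_fun hg k y)^*%C)).
- congr csum; apply/funext => x; rewrite /pull /=.
  case E : (g x) => [y|]; last by rewrite /pull E mul0r.
  by rewrite /pull E; move/gh: E => ->.
- by move=> y E; rewrite pcomp_funE E rmorph0 mulr0.
- exact: ip_summable.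
Qed.

Lemma pcomp_subproof : @pcomp_fun R X g h gh \in @bop_pred R X.
Proof.
apply/asboolP; split; first by eexists; exact: pcomp_adjoint.
exists 1; split=> // f; rewrite mul1r; apply: hn_le; first exact: hn_ge0.
rewrite hn_sqr; apply: hsq_le => F; exact: sqs_pull.
Qed.

Definition pcomp : bop R X := Bop pcomp_subproof.

Lemma pcomp_starE f x : star pcomp f x = if h x is Some y then f y else 0.
Proof.
have E1 : adjoint pcomp f = pcomp_fun hg f.
  by apply: ip_inj => k; rewrite -adjointP' ipC pcomp_adjoint -ipC.
by rewrite -[star pcomp f x]/(adjoint pcomp f x) E1.
Qed.

End PartialBijectionOperators.

Section PathRepresentation.
Context (R : realType) (E : digraph).
Notation X := (bpath E).
Notation B := (bop R X).
Implicit Types (e : edge E) (v : vert E) (x y : X).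

Definition bcons_opt e y : option X :=
  if pselect (src e = brng y) is left h then Some (bcons h) else None.

Definition buncons e x : option X :=
  if pselect (exists y (h : src e = brng y), x = bcons h) is left h
  then Some (projT1 (cid h)) else None.

Lemma bcons_optP e x y : bcons_opt e y = Some x <-> exists h : src e = brng y,
  x = bcons h.
Proof.
rewrite /bcons_opt; case: pselect => h; split=> //.
- by move=> [<-]; exists h.
- by move=> [k ->]; rewrite (bcons_irr h k).
- by move=> [].
Qed.

Lemma bcons_opt_bcons e y (h : src e = brng y) : bcons_opt e y = Some (bcons h).
Proof. by apply/bcons_optP; exists h. Qed.

Lemma bunconsP e x y : buncons e x = Some y <-> bcons_opt e y = Some x.
Proof.
rewrite bcons_optP /buncons; case: pselect => [h|nh]; split=> //.
- by move=> [<-]; case: cid.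
- move=> [k xk]; case: cid => z [j /= xj].
  by rewrite xj in xk; have [_ ->] := bcons_inj xk.
- by move=> [k xE]; case: nh; exists y, k.
Qed.

Lemma buncons_bcons e f y (h : src f = brng y) :
  buncons e (bcons h) = if e == f then Some y else None.
Proof.
case: eqP => [->|ef]; first by apply/bunconsP/bcons_optP; exists h.
case E1 : buncons => [z|//]; move/bunconsP/bcons_optP : E1 =>
  [k /bcons_inj[fe _]].
by rewrite fe in ef.
Qed.

Lemma buncons_vpath e v (ps : singular (fp_src (vpath v))) : buncons e (BFin ps)
  = None.
Proof.
by case E1 : buncons => [z|//]; move/bunconsP/bcons_optP : E1 =>
  [k /vpath_not_bcons].
Qed.

Lemma buncons_rng e x y : buncons e x = Some y -> brng x = rng e /\ src e = brng
  y.
Proof. by move/bunconsP/bcons_optP => [h ->]; rewrite brng_bcons. Qed.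

Lemma buncons_edge e f x y z : buncons e x = Some y -> buncons f x = Some z -> e
  = f.
Proof.
by move/bunconsP/bcons_optP => [h ->]; rewrite buncons_bcons; case: eqP =>
  // ->.
Qed.

Definition at_vert v x : option X := if brng x == v then Some x else None.

Lemma at_vertP v x y : at_vert v x = Some y <-> at_vert v y = Some x.
Proof.
rewrite /at_vert; split; (case: ifP => // xv [xy]; subst) => //; by rewrite xv.
Qed.

(** Sending basis vectors forward along [mu |-> e mu] means pulling functions back along the
    deletion of [e], hence [buncons] here and [bcons_opt] in the adjoint. *)
Definition rep_edge e : B := pcomp R (bunconsP e).
Definition rep_vert v : B := pcomp R (at_vertP v).

Lemma rep_edgeE e f x : rep_edge e f x = if buncons e x is Some y then f y else
  0.
Proof. by []. Qed.

Lemma rep_edge_starE e f x :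
  star (rep_edge e) f x = if bcons_opt e x is Some y then f y else 0.
Proof. exact: pcomp_starE. Qed.

Lemma rep_vertE v f x : rep_vert v f x = if brng x == v then f x else 0.
Proof. by rewrite /= /at_vert /pull; case: ifP. Qed.

Lemma bop_mulE (a b : B) f : (a ** b) f = a (b f).
Proof. by []. Qed.

Lemma bop_sumE (I : Type) (r : seq I) (P : pred I) (F : I -> B) f x :
  (\sum_(i <- r | P i) F i) f x = \sum_(i <- r | P i) F i f x.
Proof. by elim/big_rec2: _ => // i y T _ <-. Qed.

Lemma bop_eqP (a b : B) : (forall f x, a f x = b f x) -> a = b.
Proof. by move=> h; apply: bop_ext => f; apply: l2_ext => x. Qed.

Lemma rep_range e f x : (rep_edge e ** star (rep_edge e)) f x =
  if buncons e x is Some _ then f x else 0.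
Proof.
rewrite bop_mulE rep_edgeE; case E1 : buncons => [y|//].
by rewrite rep_edge_starE; move/bunconsP : E1 => ->.
Qed.

Lemma rep_ck : ck_family rep_edge rep_vert.
Proof.
split.
- move=> v; split; apply: bop_eqP => f x.
    by rewrite bop_mulE !rep_vertE; case: (_ == _).
  by rewrite rep_vertE pcomp_starE /at_vert; case: (_ == _).
- move=> v w vw; apply: bop_eqP => f x; rewrite bop_mulE !rep_vertE.
  by case: eqP => // ->; case: eqP.
- move=> e; apply: bop_eqP => f x; rewrite bop_mulE rep_range rep_edgeE.
  by case: (buncons e x).
- move=> e; apply: bop_eqP => f x; rewrite bop_mulE rep_edge_starE rep_vertE.
  case E1 : (bcons_opt e x) => [y|].
    rewrite rep_edgeE (bunconsP e y x).2 //.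
    by move/bcons_optP : E1 => [xe _]; rewrite xe eqxx.
  by case: eqP => // xe; move: E1; rewrite (bcons_opt_bcons (esym xe)).
- move=> e; apply: bop_eqP => f x; rewrite bop_mulE rep_vertE rep_range.
  case E1 : (buncons e x) => [y|]; last by case: ifP.
  by have [-> _] := buncons_rng E1; rewrite eqxx.
- move=> e f ef; apply: bop_eqP => k x; rewrite bop_mulE !rep_range.
  case E1 : (buncons e x) => [y|//]; case E2 : (buncons f x) => [z|//].
  by case: ef; exact: buncons_edge E1 E2.
- move=> v fin ne; apply: bop_eqP => f x.
  rewrite rep_vertE fsbig_finite //= bop_sumE.
  under eq_bigr do rewrite rep_range.
  (* The sum of ranges misses only the path of length zero at [v], and this is no boundary path
     because [v] receives finitely many edges and at least one. *)
  have [[ps xE]|[e [y [h xE]]]] := vpath_or_bcons x.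
    rewrite big1 => [|e _]; last by rewrite xE buncons_vpath.
    case: eqP => // xv; exfalso; move: (ps); rewrite /fp_src /= xv.
    by move=> [//|n0]; case: ne => e; rewrite n0.
  rewrite xE brng_bcons; under eq_bigr do rewrite buncons_bcons.
  case: eqP => [ev|ev].
    rewrite (bigD1_seq e) ?fset_uniq //=; last by rewrite in_fset_set ?inE.
    rewrite eqxx big1 ?addr0 // => f0 f0e.
    by rewrite (negbTE f0e).
  rewrite big_seq big1 // => f0; rewrite in_fset_set // inE /= => f0v.
  by case: eqP => // f0e; case: ev; rewrite -f0e.
Qed.

End PathRepresentation.

(** * The diagonal subalgebra *)

Section CuntzKriegerAlgebra.
Context (R : realType) (E : digraph) (A : cstarType R).
Context (s : edge E -> A) (p : vert E -> A).
Hypothesis ck : ck_family s p.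
Implicit Types (e f : edge E) (v w : vert E) (mu nu : fin_path E).

Lemma p_idem v : p v ** p v = p v. Proof. by have [] := ck_proj ck v. Qed.

Lemma p_star v : star (p v) = p v. Proof. by have [] := ck_proj ck v. Qed.

Lemma s_src e : s e ** p (src e) = s e.
Proof. by rewrite -(ck_src ck) cmulA (ck_partial_isometry ck). Qed.

Lemma s_rng e : p (rng e) ** s e = s e.
Proof.
rewrite -{1}(ck_partial_isometry ck e) cmulA.
by rewrite (ck_rng ck e : p _ ** _ = _) (ck_partial_isometry ck).
Qed.

Lemma ss_src e : p (src e) ** star (s e) = star (s e).
Proof. by rewrite -{1}p_star -starM s_src. Qed.

Lemma ss_rng e : star (s e) ** p (rng e) = star (s e).
Proof. by rewrite -{1}p_star -starM s_rng. Qed.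

Lemma ss_orth e f : e <> f -> star (s e) ** s f = 0.
Proof.
move=> ef; rewrite -(ck_partial_isometry ck f) -{1}(ck_partial_isometry ck e).
rewrite !starM starK !cmulA.
have := ck_range_orth ck ef; rewrite !cmulA => E0.
rewrite -(cmulA (star (s e))) -(cmulA (star (s e))) -(cmulA (star (s e))).
by rewrite E0 cmul0r cmul0l.
Qed.

Lemma p_s v e : v <> rng e -> p v ** s e = 0.
Proof. by move=> ve; rewrite -s_rng cmulA (ck_orth ck ve) cmul0l. Qed.

Lemma ss_p v e : v <> rng e -> star (s e) ** p v = 0.
Proof. by move=> ve; rewrite -[p v]p_star -starM p_s // star0. Qed.

Lemma nrm_p v : nrm (p v) <= 1.
Proof. exact: nrm_proj_le1 (ck_proj ck v). Qed.

Lemma nrm_s e : nrm (s e) <= 1.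
Proof.
rewrite -(ler_pXn2r (ltn0Sn 1)) ?nnegrE ?nrm_ge0 // expr1n -nrm_cstar.
by rewrite (ck_src ck) nrm_p.
Qed.

Lemma spath_fcons e mu (k : src e = fp_rng mu) :
  spath s p (fcons k) = s e ** spath s p mu.
Proof.
have fl (w : seq (edge E)) : forall x y : A, foldl (fun x f =>
  x ** s f) (x ** y) w =
    x ** foldl (fun x f => x ** s f) y w.
  by elim: w => //= f w IH x y; rewrite -cmulA IH.
rewrite /spath /=; case: (fp_word mu) => [|f w] /=; first by rewrite -k s_src.
exact: fl.
Qed.

Definition pproj mu : A := spath s p mu ** star (spath s p mu).

Lemma pproj_vpath v : pproj (vpath v) = p v.
Proof. by rewrite /pproj /spath /= p_star p_idem. Qed.

Lemma pproj_fcons e mu (k : src e = fp_rng mu) :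
  pproj (fcons k) = s e ** pproj mu ** star (s e).
Proof. by rewrite /pproj spath_fcons starM !cmulA. Qed.

Lemma pproj_star mu : star (pproj mu) = pproj mu.
Proof. by rewrite /pproj starM starK. Qed.

Lemma p_pproj v mu : p v ** pproj mu = if v == fp_rng mu then pproj mu else 0.
Proof.
have [E1|[e [nu [k E1]]]] := fin_pathP mu.
  rewrite E1 pproj_vpath /=; case: eqP => [->|]; first exact: p_idem.
  exact: (ck_orth ck).
rewrite E1 pproj_fcons /= !cmulA; case: eqP => [->|ve]; first by rewrite s_rng.
by rewrite p_s // !cmul0l.
Qed.

Lemma pproj_p v mu : pproj mu ** p v = if v == fp_rng mu then pproj mu else 0.
Proof.
rewrite -pproj_star -[p v]p_star -starM p_pproj; case: eqP => _ //.
exact: star0.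
Qed.

Lemma fin_path_ind (P : fin_path E -> Prop) :
  (forall v, P (vpath v)) ->
  (forall e mu (k : src e = fp_rng mu), P mu -> P (fcons k)) ->
  forall mu, P mu.
Proof.
move=> P0 PS mu; have [n le_n] := ubnP (size (fp_word mu)).
elim: n mu le_n => // n IH mu; have [->|[e [nu [k ->]]]] := fin_pathP mu => //.
by rewrite ltnS => le_n; apply: PS; apply: IH.
Qed.

Lemma s_pproj_fcons e f mu (k : src f = fp_rng mu) :
  star (s e) ** pproj (fcons k) = if e == f then pproj mu ** star (s e) else 0.
Proof.
rewrite pproj_fcons -(cmulA (s f)) cmulA; case: eqP => [->|ef].
  by rewrite (ck_src ck) cmulA p_pproj k eqxx.
by rewrite ss_orth // !cmul0l.
Qed.

(** Two cylinders are nested or disjoint. *)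
Lemma pproj_mul mu nu : pproj mu ** pproj nu \in [:: 0; pproj mu; pproj nu].
Proof.
elim/fin_path_ind: mu nu => [v|e mu k IH] nu.
  by rewrite pproj_vpath p_pproj; case: eqP => _; rewrite !inE eqxx ?orbT.
have [->|[f [eta [j ->]]]] := fin_pathP nu.
  by rewrite pproj_vpath pproj_p; case: eqP => _; rewrite !inE eqxx ?orbT.
rewrite {1}pproj_fcons -cmulA s_pproj_fcons; case: eqP => [E1|_]; last first.
  by rewrite cmul0r !inE eqxx.
subst f; rewrite cmulA -(cmulA (s e)).
have := IH eta; rewrite !inE => /or3P[] /eqP ->;
  rewrite ?pproj_fcons ?eqxx ?orbT //.
by rewrite cmul0r cmul0l eqxx.
Qed.

Lemma pproj_comm mu nu : pproj mu ** pproj nu = pproj nu ** pproj mu.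
Proof.
have := pproj_mul mu nu; rewrite !inE => /or3P[] /eqP E1; rewrite E1;
  by have := congr1 (@star _ _) E1; rewrite starM ?star0 !pproj_star.
Qed.

Lemma s_pproj_s e f mu : e <> f -> star (s e) ** pproj mu ** s f = 0.
Proof.
move=> ef; have [->|[g [nu [k ->]]]] := fin_pathP mu.
  rewrite pproj_vpath; case: (fp_rng mu =P rng e) => [->|/ss_p ->].
    by rewrite ss_rng ss_orth.
  by rewrite cmul0l.
rewrite s_pproj_fcons; case: eqP => _; last by rewrite cmul0l.
by rewrite -cmulA ss_orth // cmul0r.
Qed.

Definition epath e : fin_path E := @fcons E e (vpath (src e)) erefl.

Lemma pproj_epath e : pproj (epath e) = s e ** star (s e).
Proof. by rewrite pproj_fcons pproj_vpath s_src. Qed.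

(** Formal combinations are lists, so that one list determines both an element of the algebra and
    its symbol, the function [cylcomb l]. *)
Definition pcomb (l : seq (R[i] * fin_path E)) : A :=
  \sum_(q <- l) q.1 *: pproj q.2.

Lemma pcomb_nil : pcomb [::] = 0. Proof. exact: big_nil. Qed.

Lemma pcomb_cons c mu l : pcomb ((c, mu) :: l) = c *: pproj mu + pcomb l.
Proof. exact: big_cons. Qed.

Lemma pcomb_cat l l' : pcomb (l ++ l') = pcomb l + pcomb l'.
Proof. exact: big_cat. Qed.

Lemma pcomb_scale k l : pcomb [seq (k * q.1, q.2) | q <- l] = k *: pcomb l.
Proof.
by rewrite /pcomb big_map scaler_sumr; apply: eq_bigr => q _; rewrite scalerA.
Qed.

Lemma pcomb_pproj_comm l mu : pcomb l ** pproj mu = pproj mu ** pcomb l.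
Proof.
rewrite cmul_suml cmul_sumr; apply: eq_bigr => q _.
by rewrite cmulZl cmulZr pproj_comm.
Qed.

Lemma pcomb_mul l l' : exists l'', pcomb l ** pcomb l' = pcomb l''.
Proof.
have PPl c mu : exists l'', (c *: pproj mu) ** pcomb l' = pcomb l''.
  elim: l' => [|[d nu] l' [l'' IH]]; first by exists [::];
    rewrite !pcomb_nil cmul0r.
  rewrite pcomb_cons cmulDr IH cmulZl cmulZr scalerA.
  have := pproj_mul mu nu; rewrite !inE => /or3P[] /eqP ->.
  - by exists l''; rewrite scaler0 add0r.
  - by exists ((c * d, mu) :: l''); rewrite pcomb_cons.
  - by exists ((c * d, nu) :: l''); rewrite pcomb_cons.
elim: l => [|[c mu] l [l1 IH]]; first by exists [::]; rewrite pcomb_nil cmul0l.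
have [l2 E2] := PPl c mu; exists (l2 ++ l1).
by rewrite pcomb_cons cmulDl E2 IH pcomb_cat.
Qed.

Definition cylind mu (x : bpath E) : R[i] := (`[< begins_with x mu >])%:R.

Lemma cylind_vpath v x : cylind (vpath v) x = (brng x == v)%:R.
Proof.
rewrite /cylind; congr (_%:R); congr nat_of_bool; apply/asboolP/eqP.
  by move/begins_vpath.
by move=> h; apply/begins_vpath.
Qed.

Lemma cylind_bcons e y (h : src e = brng y) f mu (k : src f = fp_rng mu) :
  cylind (fcons k) (bcons h) = if e == f then cylind mu y else 0.
Proof.
rewrite /cylind; case: asboolP => [/begins_bcons[-> by_]|nb].
  by rewrite eqxx; case: asboolP.
case: eqP => // ef; case: asboolP => // by_.
by case: nb; apply/begins_bcons.
Qed.

Lemma cylind_bfin v (ps : singular (fp_src (vpath v))) f mu (k : src f = fp_rng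
  mu) :
  cylind (fcons k) (BFin ps) = 0.
Proof. by rewrite /cylind; case: asboolP => // /vpath_not_begins. Qed.

Definition cylcomb (l : seq (R[i] * fin_path E)) (x : bpath E) : R[i] :=
  \sum_(q <- l) q.1 * cylind q.2 x.

Lemma cylind_rng0 mu x : fp_rng mu <> brng x -> cylind mu x = 0.
Proof. by rewrite /cylind; case: asboolP => // -[-> _]. Qed.

Lemma cylcomb_cons c mu l x : cylcomb ((c,
  mu) :: l) x = c * cylind mu x + cylcomb l x.
Proof. exact: big_cons. Qed.

(** Compression by [s e] deletes a leading [e] and kills the paths that begin with another edge; a
    vertex [r(e)] becomes [s(e)]. This shortening drives the induction in the norm estimate, and the
    values of the new symbol are among the old ones and 0. *)
Lemma pcomb_compress e l N : all (fun q => size (fp_word q.2) <= N.+1)%N l ->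
  exists l', [/\ pcomb l' = star (s e) ** pcomb l ** s e,
    all (fun q => size (fp_word q.2) <= N)%N l',
    forall y (h : src e = brng y), cylcomb l' y = cylcomb l (bcons h) &
    forall y, src e <> brng y -> cylcomb l' y = 0].
Proof.
elim: l => [|[c mu] l IH] /=.
  move=> _; exists [::]; split=> //.
  - by rewrite !pcomb_nil cmul0r cmul0l.
  - by move=> y h; rewrite /cylcomb !big_nil.
  - by move=> y h; rewrite /cylcomb !big_nil.
move=> /andP[mN /IH [l' [E1 l'N E2 E3]]].
have [mE|[f [nu [k mE]]]] := fin_pathP mu; rewrite mE in mN *.
  case: (fp_rng mu =P rng e) => [->|ve].
    exists ((c, vpath (src e)) :: l'); split=> //.
    - rewrite !pcomb_cons E1 !pproj_vpath cmulDr cmulDl cmulZr cmulZl.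
      by rewrite ss_rng (ck_src ck).
    - by move=> y h; rewrite !cylcomb_cons (E2 y h) !cylind_vpath brng_bcons h
        !eqxx.
    - by move=> y h; rewrite cylcomb_cons E3 // cylind_rng0 // mulr0 addr0.
  exists l'; split=> //.
    by rewrite pcomb_cons E1 pproj_vpath cmulDr cmulDl cmulZr ss_p // scaler0
      cmul0l add0r.
  move=> y h; rewrite cylcomb_cons (E2 y h) cylind_rng0 ?mulr0 ?add0r //.
  by rewrite brng_bcons.
have [ef|ef] := eqVneq e f; last first.
  exists l'; split=> //.
    rewrite pcomb_cons E1 cmulDr cmulDl cmulZr cmulZl s_pproj_fcons.
    by rewrite (negbTE ef) cmul0l scaler0 add0r.
  by move=> y h; rewrite cylcomb_cons (E2 y h) cylind_bcons (negbTE ef) mulr0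
    add0r.
subst f; exists ((c, nu) :: l'); split.
- rewrite !pcomb_cons E1 cmulDr cmulDl cmulZr cmulZl s_pproj_fcons eqxx.
  by rewrite -(cmulA (pproj nu)) (ck_src ck) pproj_p k eqxx.
- by rewrite /= l'N andbT.
- by move=> y h; rewrite !cylcomb_cons (E2 y h) cylind_bcons eqxx.
- by move=> y h; rewrite cylcomb_cons E3 // cylind_rng0 ?mulr0 ?addr0 // -k.
Qed.

(** Since [a] commutes with the orthogonal cutters [q i], the pieces [a ** q i] are orthogonal on
    both sides, so the norm of their sum is governed by the largest piece. *)
Lemma commuting_proj_sum_le (I : eqType) (r : seq I) (q : I -> A) (a : A) (M :
  R) :
  uniq r -> 0 <= M -> (forall i, i \in r -> star (q i) = q i) ->
  (forall i j, i \in r -> j \in r -> i != j -> q i ** q j = 0) ->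
  (forall i, i \in r -> a ** q i = q i ** a) ->
  (forall i, i \in r -> nrm (a ** q i) <= M) ->
  nrm (\sum_(i <- r) a ** q i) <= M.
Proof.
move=> ur M0 qs qo qa qM; apply: orthogonal_sum_le => // i j ir jr ij; split.
  rewrite starM qs // -cmulA (qa j) // !cmulA.
  have -> : q i ** star a = star a ** q i.
    by rewrite -{1}(qs i ir) -starM qa // starM qs.
  by rewrite -(cmulA (star a)) qo // cmul0r cmul0l.
by rewrite starM qs // !cmulA -(cmulA a) qo // cmul0r cmul0l.
Qed.

Lemma pcomb_compress_norm l e : nrm (pcomb l ** (s e ** star (s e))) <=
  nrm (star (s e) ** pcomb l ** s e).
Proof.
have -> : pcomb l ** (s e ** star (s e)) =
    s e ** (star (s e) ** pcomb l ** s e) ** star (s e).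
  rewrite !cmulA -pproj_epath -pcomb_pproj_comm pproj_epath !cmulA.
  rewrite -(cmulA _ (star (s e)) (s e)) (ck_src ck).
  by rewrite -(cmulA (pcomb l) (s e) (p _)) s_src.
set b := star (s e) ** pcomb l ** s e.
apply: (@le_trans _ _ (nrm (s e ** b))).
  apply: le_trans (nrm_cmul _ _) _; apply: ler_piMr; first exact: nrm_ge0.
  by rewrite nrm_star nrm_s.
apply: le_trans (nrm_cmul _ _) _; apply: ler_piMl; first exact: nrm_ge0.
exact: nrm_s.
Qed.

End CuntzKriegerAlgebra.

(** * The norm of a combination is bounded by its symbol *)

HB.instance Definition _ (E : digraph) := gen_eqMixin (fin_path E).

Section Isometry.
Context (R : realType) (E : digraph) (A : cstarType R).
Context (s : edge E -> A) (p : vert E -> A).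
Hypothesis ck : ck_family s p.
Notation pproj := (pproj s p).
Notation pcomb := (pcomb s p).
Implicit Types (l : seq (R[i] * fin_path E)) (v : vert E) (e f : edge E).

Lemma pcomb_sum_vert l :
  pcomb l = \sum_(v <- undup [seq fp_rng q.2 | q <- l]) pcomb l ** p v.
Proof.
rewrite -cmul_sumr cmul_suml [LHS]big_seq [RHS]big_seq.
apply: eq_bigr => q ql.
have qv : fp_rng q.2 \in undup [seq fp_rng q.2 | q <- l].
  by rewrite mem_undup; apply/mapP; exists q.
rewrite cmulZl cmul_sumr (bigD1_seq (fp_rng q.2)) ?undup_uniq //=.
rewrite (pproj_p ck) eqxx big1 ?addr0 // => v vq.
by rewrite (pproj_p ck) (negbTE vq).
Qed.

(* Total coefficient of the path of length zero at [v]. *)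
Definition vcoef l v : R[i] :=
  \sum_(q <- l) q.1 * ((fp_word q.2 == [::]) && (fp_rng q.2 == v))%:R.

(** The part of [p v] not covered by the ranges of the edges in [F]. It is 0 when [F] lists all
    edges into a regular vertex [v]. *)
Definition vertex_rest v (F : seq (edge E)) : A :=
  p v - \sum_(e <- F) pproj (epath e).

Lemma pproj_epath_orth e f : e <> f -> pproj (epath e) ** pproj (epath f) = 0.
Proof. by move=> ef; rewrite !(pproj_epath ck) (ck_range_orth ck). Qed.

Lemma pproj_idem (mu : fin_path E) : pproj mu ** pproj mu = pproj mu.
Proof.
elim/fin_path_ind: mu => [v|e mu k IH].
  by rewrite (pproj_vpath ck) (p_idem ck).
rewrite {1}(pproj_fcons ck) -cmulA (s_pproj_fcons ck) eqxx cmulA -(cmulA (s e))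
  IH.
by rewrite (pproj_fcons ck).
Qed.

Section Rest.
Context (v : vert E) (F : seq (edge E)).
Hypotheses (uF : uniq F) (Fv : forall e, e \in F -> rng e = v).

Lemma vertex_rest_star : star (vertex_rest v F) = vertex_rest v F.
Proof.
rewrite /vertex_rest starB (p_star ck) star_sum; congr (_ - _).
by apply: eq_bigr => e _; rewrite pproj_star.
Qed.

Lemma pproj_vertex_rest e : e \in F -> pproj (epath e) ** vertex_rest v F = 0.
Proof.
move=> eF; rewrite cmulBr (pproj_p ck) /= Fv // eqxx cmul_sumr (bigD1_seq e)
  //=.
rewrite pproj_idem big1 ?addr0 ?subrr // => f fe.
by rewrite pproj_epath_orth //; apply/eqP; rewrite eq_sym.
Qed.

Lemma p_vertex_rest w :
  p w ** vertex_rest v F = if w == v then vertex_rest v F else 0.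
Proof.
rewrite cmulBr cmul_sumr; case: eqP => [->|wv].
  rewrite (p_idem ck) big_seq; congr (_ - _); rewrite [RHS]big_seq.
  by apply: eq_bigr => e eF; rewrite (p_pproj ck) /= Fv // eqxx.
rewrite (ck_orth ck wv) big_seq big1 ?subrr // => e eF.
by rewrite (p_pproj ck) /= Fv //; case: eqP.
Qed.

Lemma vertex_rest_idem : vertex_rest v F ** vertex_rest v F = vertex_rest v F.
Proof.
rewrite {1}/vertex_rest cmulBl p_vertex_rest eqxx cmul_suml big_seq big1 ?subr0
  //.
by move=> e eF; rewrite pproj_vertex_rest.
Qed.

(** The rest at [v] is orthogonal to every path of positive length in [l]: its first edge lies in
    [F] or has another range. Only the vertex [v] itself contributes. *)
Lemma pcomb_vertex_rest l :
  (forall q e w, q \in l -> fp_word q.2 = e :: w -> rng e = v -> e \in F) ->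
  pcomb l ** vertex_rest v F = vcoef l v *: vertex_rest v F.
Proof.
move=> lF; rewrite cmul_suml /vcoef scaler_suml [LHS]big_seq [RHS]big_seq.
apply: eq_bigr => -[c mu] ql; rewrite cmulZl /=.
have [mE|[e [nu [k mE]]]] := fin_pathP mu; rewrite mE /=.
  rewrite (pproj_vpath ck) p_vertex_rest; case: eqP => _.
    by rewrite mulr1.
  by rewrite scaler0 mulr0 scale0r.
rewrite mulr0 scale0r.
have ep : pproj (fcons k) = pproj (fcons k) ** pproj (epath e).
  rewrite (pproj_epath ck) {2}(pproj_fcons ck) -(cmulA (s e ** pproj nu)).
  by rewrite (cmulA (star (s e))) (ck_src ck) (ss_src ck) (pproj_fcons ck).
have [ev|ev] := eqVneq (rng e) v.
  rewrite ep -cmulA pproj_vertex_rest ?cmul0r ?scaler0 //.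
  by apply: lF ql _ ev; rewrite /= mE.
have -> : pproj (fcons k) = pproj (fcons k) ** p (rng e) by rewrite (pproj_p ck)
  eqxx.
by rewrite -cmulA p_vertex_rest (negbTE ev) cmul0r scaler0.
Qed.

End Rest.

Lemma vcoef_bfin l v (ps : singular (fp_src (vpath v))) :
  cylcomb l (BFin ps) = vcoef l v.
Proof.
apply: eq_bigr => -[c mu] _ /=.
have [->|[e [nu [k ->]]]] := fin_pathP mu; last by rewrite cylind_bfin.
by rewrite cylind_vpath /= eq_sym.
Qed.

Lemma vertex_rest_nil v : vertex_rest v [::] = p v.
Proof. by rewrite /vertex_rest big_nil subr0. Qed.

(* Cut the combination along the vertices, then along the first edges.
   Compressing by [s e] shortens the paths; on the remaining projection
   [vertex_rest] the combination acts as the scalar [vcoef l v], which is one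
   of the values of its symbol whenever that projection is nonzero. *)
Lemma pcomb_norm_le_size N l (M : R) : 0 <= M ->
  all (fun q => size (fp_word q.2) <= N)%N l ->
  (forall x, nrmc (cylcomb l x) <= M) -> nrm (pcomb l) <= M.
Proof.
move=> M0; elim: N l => [|N IH] l lN lM.
  rewrite pcomb_sum_vert; apply: (commuting_proj_sum_le (undup_uniq _) M0).
  - by move=> v _; exact: (p_star ck v).
  - by move=> v w _ _ /eqP vw; exact: (ck_orth ck vw).
  - by move=> v _; rewrite -(pproj_vpath ck) (pcomb_pproj_comm ck).
  move=> v _; rewrite -vertex_rest_nil pcomb_vertex_rest //; last first.
    by move=> q e w /(allP lN); case: (fp_word q.2).
  rewrite vertex_rest_nil nrmZ.
  (* With only vertices in [l], the symbol is constant on the paths with range [v], so any such path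
     takes the value [vcoef l v]. *)
  have [x xv] := bpath_ex v; rewrite -[M]mulr1; apply: ler_pM => //.
  - exact: nrm_ge0.
  - exact: nrm_ge0.
  - suff <- : cylcomb l x = vcoef l v by exact: lM.
    rewrite /cylcomb /vcoef big_seq [RHS]big_seq; apply: eq_bigr => q ql.
    have := allP lN _ ql; have [->|[e [nu [k ->]]]] := fin_pathP q.2 => // _.
    by rewrite cylind_vpath /= xv eq_sym.
  - exact: (nrm_p ck v).
rewrite pcomb_sum_vert; apply: (commuting_proj_sum_le (undup_uniq _) M0).
- by move=> v _; exact: (p_star ck v).
- by move=> v w _ _ /eqP vw; exact: (ck_orth ck vw).
- by move=> v _; rewrite -(pproj_vpath ck) (pcomb_pproj_comm ck).
move=> v _.
(* [fset_set] of an infinite set is empty, so [inv] contributes only at finite receivers, where it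
   makes [F] contain every incoming edge. *)
pose inv : seq (edge E) := fset_set (in_edges v).
pose F := [seq e <- undup (pmap (fun q =>
  ohead (fp_word q.2)) l ++ inv) | rng e == v].
have uF : uniq F by rewrite filter_uniq // undup_uniq.
have Fv e : e \in F -> rng e = v by rewrite mem_filter => /andP[/eqP].
have lF q e w : q \in l -> fp_word q.2 = e :: w -> rng e = v -> e \in F.
  move=> ql qw ev; rewrite mem_filter ev eqxx mem_undup mem_cat mem_pmap.
  by apply/orP; left; apply/mapP; exists q => //; rewrite qw.
pose Q (o : option (edge E)) := if o is Some e then pproj (epath e) else
  vertex_rest v F.
have -> : pcomb l ** p v = \sum_(o <- None :: map some F) pcomb l ** Q o.
  rewrite -cmul_sumr big_cons big_map /=; congr (_ ** _).
  by rewrite /vertex_rest subrK.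
apply: commuting_proj_sum_le => //.
- rewrite /= map_inj_uniq ?uF ?andbT; last by move=> ? ? [].
  by apply/mapP => -[].
- by move=> [e|] _ /=; [exact: pproj_star|exact: vertex_rest_star].
- have mS e : (Some e \in (None :: map some F)) = (e \in F).
    by rewrite inE /= mem_map // => ? ? [].
  move=> [e|] [f|] //=; rewrite ?mS => eF fF ef.
  + by apply: pproj_epath_orth => E1; rewrite E1 eqxx in ef.
  + exact: pproj_vertex_rest.
  + rewrite -vertex_rest_star -(pproj_star s p (epath f)) -starM.
    by rewrite pproj_vertex_rest // star0.
- move=> [e|] _ /=; first exact: pcomb_pproj_comm.
  rewrite /vertex_rest cmulBr cmulBl cmul_suml cmul_sumr.
  rewrite -(pproj_vpath ck) (pcomb_pproj_comm ck); congr (_ - _).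
  by apply: eq_bigr => e _; exact: pcomb_pproj_comm.
move=> [e|] _ /=.
  rewrite (pproj_epath ck); apply: le_trans (pcomb_compress_norm ck _ _) _.
  have [l' [<- l'N h1 h2]] := pcomb_compress ck e lN.
  apply: IH => // y; have [ey|ney] := pselect (src e = brng y).
    by rewrite (h1 y ey).
  by rewrite (h2 y ney) nrm0.
rewrite pcomb_vertex_rest // nrmZ.
have [rest0|rest0] := eqVneq (vertex_rest v F) 0.
  by rewrite rest0 nrm0 mulr0.
(* At a regular vertex the Cuntz-Krieger relation would make the rest 0. At a singular one [v] is a
   boundary path, where the symbol has the value [vcoef l v]. *)
have ps : singular (fp_src (vpath v)).
  apply: contrapT => /not_orP[/contrapT fin ne0]; move/eqP: rest0; apply.
  rewrite /vertex_rest (ck_sum ck fin); last by apply/set0P/eqP.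
  apply/eqP; rewrite subr_eq0; apply/eqP; rewrite fsbig_finite //=.
  under [RHS]eq_bigr do rewrite (pproj_epath ck).
  apply: perm_big; apply: uniq_perm => //; first exact: fset_uniq.
  move=> e.
  rewrite in_fset_set //; apply/idP/idP.
    rewrite inE => /= ev; rewrite mem_filter ev eqxx mem_undup mem_cat /inv.
    by rewrite in_fset_set // [X in _ || X]mem_set ?orbT.
  by move=> /Fv ev; rewrite inE.
rewrite -(vcoef_bfin _ ps) -[M]mulr1; apply: ler_pM => //.
- exact: nrm_ge0.
- exact: nrm_ge0.
- apply: nrm_proj_le1; split; first exact: vertex_rest_idem.
  exact: vertex_rest_star.
Qed.

Lemma pcomb_norm_le l (M : R) : 0 <= M ->
  (forall x, nrmc (cylcomb l x) <= M) -> nrm (pcomb l) <= M.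
Proof.
move=> M0; apply: (@pcomb_norm_le_size (\max_(q <- l) size (fp_word q.2))) =>
  //.
by apply/allP => q ql; rewrite (big_rem q) //= leq_maxl.
Qed.

End Isometry.

Section DiagonalAlgebra.
Context (R : realType) (E : digraph) (A : cstarType R).
Context (s : edge E -> A) (p : vert E -> A).
Hypothesis ck : ck_family s p.
Notation pproj := (pproj s p).
Notation pcomb := (pcomb s p).
Notation diag := (diag_subalg s p).
Implicit Types (l : seq (R[i] * fin_path E)) (v : vert E) (e f : edge E).
Implicit Types (a b : A) (x y : bpath E).

Lemma closure_nrm (S : set A) a : closure S a <->
  forall eps : R, 0 < eps -> exists2 b, S b & nrm (a - b) < eps.
Proof.
split=> [Sa eps e0|h B].
  have e0' : 0 < eps%:C%C by rewrite (ltcR 0).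
  have [b [Sb ab]] := Sa _ (nbhsx_ballx a eps%:C%C e0').
  by exists b => //; move: ab; rewrite -ball_normE /= nrm_lt.
move=> /nbhs_ballP[eps /= e0 hB].
have er : (complex.Re eps)%:C%C = eps by rewrite RRe_real// gtr0_real.
have e0' : 0 < complex.Re eps by rewrite -(ltcR 0) er.
have [b Sb ab] := h _ e0'; exists b; split=> //; apply: hB.
by rewrite -ball_normE /= -er -nrm_lt.
Qed.

Lemma diagP a : diag a <-> forall eps : R, 0 < eps -> exists l,
  nrm (a - pcomb l) < eps.
Proof.
rewrite /diag_subalg closure_nrm; split=> h eps /h.
  move=> [_ [n [c [mu ->]]] hb]; exists [seq (c i, mu i) | i <- enum 'I_n].
  rewrite /pcomb big_map /= (_ : \sum_(j <- _) _ =
     \sum_(i < n) c i *: (spath s p (mu i) ** star (spath s p (mu i)))) //.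
  by rewrite enumT.
move=> [l hl]; exists (pcomb l) => //.
exists (size l), (fun i => (tnth (in_tuple l) i).1), (fun i =>
  (tnth (in_tuple l) i).2).
by rewrite /pcomb big_tnth.
Qed.

Lemma diag_pcomb l : diag (pcomb l).
Proof. by apply/diagP => eps e0; exists l; rewrite subrr nrm0. Qed.

Lemma diag_pproj mu : diag (pproj mu).
Proof.
by have := @diag_pcomb [:: (1, mu)]; rewrite pcomb_cons pcomb_nil scale1r addr0.
Qed.

Lemma diag_p v : diag (p v).
Proof. by rewrite -(pproj_vpath ck); exact: diag_pproj. Qed.

Lemma diag0 : diag 0.
Proof. by have := @diag_pcomb [::]; rewrite pcomb_nil. Qed.

Lemma diag_lin (k : R[i]) a b : diag a -> diag b -> diag (k *: a + b).
Proof.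
move=> /diagP Da /diagP Db; apply/diagP => eps e0.
have k1 : 0 < nrmc k + 1 by rewrite ltr_wpDl // nrm_ge0.
have [la hla] := Da _ (divr_gt0 (divr_gt0 e0 (ltr0n _ 2)) k1).
have [lb hlb] := Db _ (divr_gt0 e0 (ltr0n _ 2)).
exists ([seq (k * q.1, q.2) | q <- la] ++ lb).
rewrite pcomb_cat pcomb_scale opprD addrACA -scalerBr.
apply: le_lt_trans (nrmD _ _) _; rewrite nrmZ (splitr eps).
apply: ler_ltD hlb; rewrite ltr_pdivlMr // in hla.
have := nrm_ge0 (a - pcomb la); nra.
Qed.

Lemma diagD a b : diag a -> diag b -> diag (a + b).
Proof. by move=> Da Db; have := @diag_lin 1 _ _ Da Db; rewrite scale1r. Qed.

Lemma diagZ k a : diag a -> diag (k *: a).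
Proof. by move=> Da; have := @diag_lin k _ _ Da diag0; rewrite addr0. Qed.

Lemma diag_sum (I : Type) (r : seq I) (F : I -> A) :
  (forall i, diag (F i)) -> diag (\sum_(i <- r) F i).
Proof.
by move=> h; elim/big_ind: _ => //; [exact: diag0|exact: diagD].
Qed.

Lemma diag_closed (T : Type) (F : set_system T) (FF : ProperFilter F) (u : T ->
  A) a :
  (forall t, diag (u t)) -> u @ F --> a -> diag a.
Proof.
move=> Du /cvg_nrm ua; apply/diagP => eps e0.
have e2 := divr_gt0 e0 (ltr0n R 2).
have [t ht] := filter_ex (ua _ e2); have /diagP /(_ _ e2) [l hl] := Du t.
exists l; apply: le_lt_trans (nrm_trans _ (u t) _) _.
by rewrite (splitr eps) ltrD.
Qed.

Lemma diag_seq_closed (u : nat -> A) a :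
  (forall n, diag (u n)) -> (forall eps : R, 0 < eps -> exists n,
    nrm (a - u n) < eps) ->
  diag a.
Proof.
move=> Du ua; apply/diagP => eps e0.
have e2 := divr_gt0 e0 (ltr0n R 2).
have [t ht] := ua _ e2; have /diagP /(_ _ e2) [l hl] := Du t.
exists l; apply: le_lt_trans (nrm_trans _ (u t) _) _.
by rewrite (splitr eps) ltrD.
Qed.

Lemma diag_compress e f a : diag a -> diag (star (s e) ** a ** s f).
Proof.
move=> /diagP Da.
have [->|/eqP ef] := eqVneq e f; last first.
  apply/diagP => eps e0; have [l hl] := Da _ e0; exists [::].
  rewrite pcomb_nil subr0; apply: le_lt_trans hl.
  have -> : star (s e) ** a ** s f = star (s e) ** (a - pcomb l) ** s f.
    rewrite cmulBr cmulBl cmul_sumr cmul_suml big1 ?subr0 // => q _.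
    by rewrite cmulZr cmulZl (s_pproj_s ck) // scaler0.
  apply: le_trans (nrm_cmul _ _) _.
  have := nrm_cmul (star (s e)) (a - pcomb l); rewrite nrm_star.
  have := nrm_s ck e; have := nrm_s ck f; have := nrm_ge0 (s e).
  have := nrm_ge0 (s f); have := nrm_ge0 (a - pcomb l).
  have := nrm_ge0 (star (s e) ** (a - pcomb l)); nra.
apply/diagP => eps e0; have [l hl] := Da _ e0.
have [|l' [E1 _ _ _]] := pcomb_compress ck f (N := \max_(q <- l) size (fp_word
  q.2)) (l := l).
  by apply/allP => q ql; rewrite (big_rem q) //= leqW // leq_maxl.
exists l'; rewrite E1 -cmulBl -cmulBr; apply: le_lt_trans hl.
apply: le_trans (nrm_cmul _ _) _.
have := nrm_cmul (star (s f)) (a - pcomb l); rewrite nrm_star.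
have := nrm_s ck f; have := nrm_ge0 (s f); have := nrm_ge0 (a - pcomb l).
have := nrm_ge0 (star (s f) ** (a - pcomb l)); nra.
Qed.

Context (pi : A -> bop R (bpath E)).
Hypotheses (pi_hom : star_hom pi) (pi_s : forall e, pi (s e) = rep_edge R e).
Hypothesis (pi_p : forall v, pi (p v) = rep_vert R v).

Let piL (k : R[i]) a b : pi (k *: a + b) = k *: pi a + pi b.
Proof. by case: pi_hom. Qed.
Let piM a b : pi (a ** b) = pi a ** pi b.
Proof. by case: pi_hom. Qed.
Let piS a : pi (star a) = star (pi a).
Proof. by case: pi_hom. Qed.

(* Defined on all of [A], this is the conditional expectation onto the diagonal
   of l2; it is multiplicative only on [diag]. *)
Definition Psi a x : R[i]^o := pi a (delta R x) x.

Lemma Psi_lin (k : R[i]) a b x : Psi (k *: a + b) x = k * Psi a x + Psi b x.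
Proof. by rewrite /Psi piL. Qed.

Lemma Psi0 x : Psi 0 x = 0.
Proof.
have := Psi_lin (-1) 0 0 x; rewrite scaler0 addr0 => ->.
by rewrite mulN1r addNr.
Qed.

Lemma PsiD a b x : Psi (a + b) x = Psi a x + Psi b x.
Proof. by have := Psi_lin 1 a b x; rewrite scale1r mul1r. Qed.

Lemma PsiZ k a x : Psi (k *: a) x = k * Psi a x.
Proof. by have := Psi_lin k a 0 x; rewrite addr0 Psi0 addr0. Qed.

Lemma PsiB a b x : Psi (a - b) x = Psi a x - Psi b x.
Proof. by rewrite PsiD -scaleN1r PsiZ mulN1r. Qed.

Lemma Psi_sum (I : Type) (r : seq I) (F : I -> A) x :
  Psi (\sum_(i <- r) F i) x = \sum_(i <- r) Psi (F i) x.
Proof.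
by elim/big_rec2: _ => [|i b a _ <-]; [exact: Psi0|exact: PsiD].
Qed.

Lemma pi_delta_le a x : hn (pi a (delta R x)) <= nrm a.
Proof.
apply: le_trans (opnormP _ _) _; rewrite hn_delta mulr1.
exact: hom_contractive.
Qed.

Lemma Psi_le a x : nrmc (Psi a x) <= nrm a.
Proof. exact: le_trans (nrm_le_hn _ _) (pi_delta_le a x). Qed.

Lemma Psi_star a x : Psi (star a) x = (Psi a x)^*%C.
Proof.
rewrite /Psi piS -!ip_delta -ipC.
by rewrite -[star (pi a)]/(bop_adj (pi a)) -adjointP'.
Qed.

Lemma pi_pproj mu (g : l2 R (bpath E)) x : pi (pproj mu) g x = cylind R mu x * g
  x.
Proof.
elim/fin_path_ind: mu g x => [v|e mu k IH] g x.
  rewrite (pproj_vpath ck) pi_p rep_vertE cylind_vpath.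
  by case: eqP => _; rewrite ?mul1r ?mul0r.
have -> : pi (pproj (fcons k)) = rep_edge R e ** (pi (pproj mu) ** star
  (rep_edge R e)).
  by rewrite (pproj_fcons ck) piM (piM (s e)) piS pi_s cmulA.
rewrite bop_mulE rep_edgeE bop_mulE.
have [[ps ->]|[f [y [h ->]]]] := vpath_or_bcons x.
  by rewrite buncons_vpath cylind_bfin mul0r.
rewrite buncons_bcons cylind_bcons [f == e]eq_sym; case: eqP => [fe|_];
  last by rewrite mul0r.
by subst f; rewrite IH rep_edge_starE (bcons_opt_bcons h).
Qed.

Lemma Psi_pproj mu x : Psi (pproj mu) x = cylind R mu x.
Proof. by rewrite /Psi pi_pproj deltaE eqxx mulr1. Qed.

Lemma Psi_pcomb l x : Psi (pcomb l) x = cylcomb l x.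
Proof.
by rewrite -[pcomb l]/(\sum_(q <- l) q.1 *: pproj q.2) Psi_sum;
  apply: eq_bigr => q _; rewrite PsiZ Psi_pproj.
Qed.

Lemma pi_diag a x : diag a -> pi a (delta R x) = Psi a x *: delta R x.
Proof.
have lcE l : pi (pcomb l) (delta R x) = Psi (pcomb l) x *: delta R x.
  have pi0 : pi 0 = 0.
    have := piL (-1) 0 0; rewrite scaler0 addr0 => ->.
    by rewrite scaleN1r addNr.
  elim: l => [|[c mu] l IH]; first by rewrite pcomb_nil pi0 Psi0 scale0r.
  rewrite pcomb_cons piL Psi_lin scalerDl -IH; congr (_ + _).
  apply: l2_ext => y; rewrite Psi_pproj -[LHS]/(c * pi (pproj mu) (delta R x) y)
    pi_pproj.
  rewrite -[RHS]/(c * cylind R mu x * delta R x y) deltaE mulrA.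
  by case: eqP => [->//|_]; rewrite !mulr0.
move=> /diagP Da; apply/eqP; rewrite -subr_eq0; apply/eqP/hn_eq0.
apply/eqP; rewrite eq_le hn_ge0 andbT; apply/ler_addgt0Pr => eps e0;
  rewrite add0r.
have [l hl] := Da _ (divr_gt0 e0 (ltr0n R 2)).
have -> : pi a (delta R x) - Psi a x *: delta R x =
    pi (a - pcomb l) (delta R x) + (- Psi (a - pcomb l) x) *: delta R x.
  have piB : pi (a - pcomb l) (delta R x) = pi a (delta R x) - pi (pcomb l)
    (delta R x).
    rewrite [a - _]addrC -[- pcomb l]scaleN1r piL scaleN1r addrC.
    by apply: l2_ext.
  by rewrite PsiB opprB scalerBl -lcE piB addrA subrK.
apply: le_trans (hnD _ _) _; rewrite hnZ hn_delta mulr1 nrmN (splitr eps).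
apply: lerD; apply: ltW; apply: le_lt_trans hl.
  exact: pi_delta_le.
exact: Psi_le.
Qed.

(** The basis vector at [x] is an eigenvector of [pi b], with eigenvalue [Psi b x]. *)
Lemma Psi_mul a b x : diag b -> Psi (a ** b) x = Psi a x * Psi b x.
Proof.
by move=> Db; rewrite {1}/Psi piM bop_mulE pi_diag // bopZ [RHS]mulrC.
Qed.

(** Together with [Psi_le] this makes [Psi] isometric on the diagonal; injectivity and closed range
    follow from it. *)
Lemma Psi_norm_le a (M : R) : diag a -> 0 <= M ->
  (forall x, nrmc (Psi a x) <= M) -> nrm a <= M.
Proof.
move=> /diagP Da M0 aM; apply/ler_addgt0Pr => eps e0.
have [l hl] := Da _ (divr_gt0 e0 (ltr0n R 2)).
have : nrm (pcomb l) <= M + eps / 2.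
  apply: (pcomb_norm_le ck) => [|x];
    first by rewrite addr_ge0 // ltW // divr_gt0.
  rewrite -Psi_pcomb; apply: le_trans (nrm_dist _ (Psi a x)) _.
  have := Psi_le (a - pcomb l) x; rewrite PsiB; have := aM x; lra.
have := nrm_dist a (pcomb l); rewrite nrmBC; lra.
Qed.

Lemma Psi_inj a b : diag a -> diag b -> Psi a =1 Psi b -> a = b.
Proof.
move=> Da Db ab; apply/eqP; rewrite -subr_eq0 -nrm_eq0 eq_le nrm_ge0 andbT.
apply: Psi_norm_le => //; last by move=> x; rewrite PsiB ab subrr nrm0.
by apply: diagD => //; rewrite -scaleN1r; exact: diagZ.
Qed.

(** Products of cylinder functions are computed in the algebra and carried over by [Psi]. *)
Lemma cylcomb_mul l l' : exists l'', forall x,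
  cylcomb l x * cylcomb l' x = cylcomb l'' x.
Proof.
have [l'' E1] := pcomb_mul ck l l'; exists l'' => x.
by rewrite -!Psi_pcomb -E1 Psi_mul //; exact: diag_pcomb.
Qed.

Lemma rep_edge_delta f y : rep_edge R f (delta R y) =
  if bcons_opt f y is Some z then delta R z else 0.
Proof.
apply: l2_ext => x; rewrite rep_edgeE.
case E1 : (buncons f x) => [w|].
  move/bunconsP : E1 => E1; rewrite deltaE.
  have [wy|wy] := eqVneq w y; first by rewrite -wy E1 deltaE eqxx.
  case E2 : (bcons_opt f y) => [z|//]; rewrite deltaE; case: eqP => // xz.
  move: E1 E2 => /bcons_optP[h1 xE] /bcons_optP[h2 zE].
  have [_ E3] : f = f /\ w = y by apply: (@bcons_inj _ _ _ _ _ h1 h2);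
    rewrite -xE -zE.
  by rewrite E3 eqxx in wy.
case E2 : (bcons_opt f y) => [z|//]; rewrite deltaE; case: eqP => // xz.
by move/bunconsP : E2; rewrite -xz E1.
Qed.

Lemma Psi_compress e f a y : diag a -> Psi (star (s e) ** a ** s f) y =
  if e == f then (if bcons_opt e y is Some x then Psi a x else 0) else 0.
Proof.
move=> Da; rewrite /Psi !piM piS !pi_s !bop_mulE rep_edge_delta rep_edge_starE.
case: eqP => [->|ef].
  by case: (bcons_opt f y).
case E1 : (bcons_opt e y) => [x|//]; case E2 : (bcons_opt f y) => [z|];
  last first.
  have := bopZ (pi a) 0 0; rewrite scale0r => ->.
  by rewrite scale0r.
rewrite pi_diag // -[LHS]/(Psi a z * delta R z x) deltaE; case: eqP => [xz|_].
  move: E1 E2 => /bcons_optP[h1 xE] /bcons_optP[h2 zE].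
  by case: ef; have [] : e = f /\ y = y by apply: (@bcons_inj _ _ _ _ _ h1 h2);
    rewrite -xE -zE.
by rewrite mulr0.
Qed.

End DiagonalAlgebra.

(** * Functions vanishing at infinity *)

Section VanishingAtInfinity.
Context (R : realType) (T : topologicalType).
Implicit Types (f g : T -> R[i]^o).

(** Here any compact set may replace the superlevel set, which suits sums and uniform limits. *)
Lemma C0P f : C0 f <-> continuous f /\ forall eps : R, 0 < eps ->
  exists2 K, compact K & forall x, ~ K x -> nrm (f x) < eps.
Proof.
split=> -[fc fv]; split=> // eps e0.
  exists [set x | eps%:C%C <= `|f x|]; first exact: fv.
  by move=> x /= /negP; rewrite normE lecR -ltNge.
have [K Kc Kf] := fv _ e0; apply: subclosed_compact Kc _.
  rewrite (_ : mkset _ = (fun x => nrm (f x)) @^-1` [set r | eps <= r]).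
    apply: closed_comp; last exact: closed_ge.
    move=> x _; apply: cvg_nrmR; exact: fc.
  by apply/seteqP; split=> x; rewrite /= normE lecR.
move=> x /=; rewrite normE lecR leNgt => fx; apply: contrapT => /Kf.
exact/negP.
Qed.

Lemma locally_constant_continuous f :
  (forall x, \forall y \near x, f y = f x) -> continuous f.
Proof.
move=> fl x; apply/cvg_nrm => eps e0; apply: filterS (fl x) => y ->.
by rewrite subrr nrm0.
Qed.

Lemma C0_0 : C0 (fun _ : T => 0 : R[i]^o).
Proof.
apply/C0P; split=> [x|eps e0]; first exact: cvg_cst.
by exists set0 => [|x _]; [exact: compact0|rewrite nrm0].
Qed.

Lemma C0_uniform_limit f :
  (forall eps : R, 0 < eps -> exists2 g, C0 g & forall x,
    nrm (f x - g x) < eps) ->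
  C0 f.
Proof.
move=> fl; apply/C0P; split=> [x|eps e0].
  apply/cvg_nrm => eps e0.
  have e3 : 0 < eps / 3 by rewrite divr_gt0.
  have [g [gc _] fg] := fl _ e3.
  have /cvg_nrm /(_ _ e3) := gc x; apply: filterS => y gxy.
  apply: le_lt_trans (nrm_trans _ (g x) _) _.
  have := nrm_trans (g x) (g y) (f y); have := fg x; have := fg y.
  rewrite (nrmBC (f y)); lra.
have [g /C0P[_ gv] fg] := fl _ (divr_gt0 e0 (ltr0n R 2)).
have [K Kc Kg] := gv _ (divr_gt0 e0 (ltr0n R 2)).
exists K => // x /Kg; have := nrm_dist (f x) (g x); have := fg x.
rewrite (nrmBC (g x)); lra.
Qed.

Lemma C0_lin (k : R[i]) f g : C0 f -> C0 g -> C0 (fun x =>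
  k * f x + g x : R[i]^o).
Proof.
move=> /C0P[fc fv] /C0P[gc gv]; apply/C0P; split=> [x|eps e0].
  by apply: cvgD; [apply: cvgMl_tmp; exact: fc|exact: gc].
have k1 : 0 < nrmc k + 1 by rewrite ltr_wpDl // nrm_ge0.
have [K Kc Kf] := fv _ (divr_gt0 (divr_gt0 e0 (ltr0n _ 2)) k1).
have [L Lc Lg] := gv _ (divr_gt0 e0 (ltr0n _ 2)).
exists (K `|` L); first exact: compactU.
move=> x /not_orP[/Kf h1 /Lg h2]; apply: le_lt_trans (nrmD _ _) _.
rewrite nrmM (splitr eps); apply: ler_ltD h2; rewrite ltr_pdivlMr // in h1.
have := nrm_ge0 (f x); nra.
Qed.

Lemma C0_bounded f : C0 f -> exists M : R, forall x, nrm (f x) <= M.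
Proof.
move=> [fc /(_ 1 ltr01) Kc].
have : compact ((fun x => nrm (f x)) @` [set x | 1%:C%C <= `|f x|]).
  apply: continuous_compact => //; apply: continuous_subspaceT => x.
  by apply: cvg_nrmR; exact: fc.
move=> /compact_bounded [M0 [_ /(_ (M0 + 1))]]; rewrite ltrDl => /(_ ltr01) hM.
exists (`|M0| + 1) => x; have [h|/ltW h] := leP 1 (nrm (f x)); last first.
  by apply: le_trans h _; rewrite lerDr.
apply: (@le_trans _ _ (M0 + 1)); last by rewrite lerD2r ler_norm.
rewrite -(ger0_norm (nrm_ge0 (f x))); apply: hM.
by exists x => //=; rewrite normE lecR.
Qed.

Lemma has_sup_nrm f (M : R) (x0 : T) : (forall x, nrm (f x) <= M) ->
  has_sup [set complex.Re `|f x| | x in [set: T]].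
Proof.
move=> fM; split; first by exists (nrm (f x0)); exists x0.
by exists M => _ [x _ <-]; exact: fM.
Qed.

Lemma nrm_le_supnorm f x : C0 f -> nrm (f x) <= supnorm f.
Proof.
move=> /C0_bounded[M fM]; apply: sup_upper_bound; first exact: has_sup_nrm fM.
by exists x.
Qed.

Lemma supnorm_le f (M : R) : 0 <= M -> (forall x, nrm (f x) <= M) ->
  supnorm f <= M.
Proof.
move=> M0 fM; rewrite /supnorm.
have [[x0 _]|/set0P/negP/negPn/eqP E0] := pselect ([set: T] !=set0).
  apply: ge_sup; first by exists (nrm (f x0)); exists x0.
  by move=> _ [x _ <-]; exact: fM.
by rewrite E0 image_set0 sup0.
Qed.

End VanishingAtInfinity.

(** * Density of the cylinder functions in C_0 *)

Section CylinderFunctions.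
Context (R : realType) (E : digraph).
Implicit Types (l : seq (R[i] * fin_path E)) (x y : bpath E).

Lemma cylind_C0 (mu : fin_path E) : C0 (fun x => cylind R mu x : R[i]^o).
Proof.
apply/C0P; split=> [|eps e0]; last first.
  exists (bcylinder mu); first exact: bcylinder_compact.
  by move=> x; rewrite /cylind; case: asboolP => // _ _; rewrite nrm0.
apply: locally_constant_continuous => x.
have [xm|xm] := pselect (begins_with x mu).
  have : nbhs x (bcylinder mu).
    by apply: open_nbhs_nbhs; split=> //; exact: bcylinder_open.
  by apply: filterS => y ym; rewrite /cylind !asboolT.
have : nbhs x (~` bcylinder mu).
  apply: open_nbhs_nbhs; split=> //; apply: closed_openC;
    exact: bcylinder_closed.
by apply: filterS => y ym; rewrite /cylind !asboolF.
Qed.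

Lemma cylcomb_C0 l : C0 (fun x => cylcomb l x : R[i]^o).
Proof.
elim: l => [|[c mu] l IH].
  rewrite (_ : (fun x => _) = fun=> 0); first exact: C0_0.
  by apply/funext => x; rewrite /cylcomb big_nil.
rewrite (_ : (fun x => _) = (fun x => c * cylind R mu x + cylcomb l x)).
  by apply: (@C0_lin _ _ c (fun x => cylind R mu x)) => //; exact: cylind_C0.
by apply/funext => x; rewrite cylcomb_cons.
Qed.

Hypothesis cylcomb_mul : forall l l', exists l'', forall x,
  cylcomb l x * cylcomb l' x = cylcomb l'' x.

Lemma cylcomb_lin (k : R[i]) l l' :
  exists l'', forall x, cylcomb l'' x = k * cylcomb l x + cylcomb l' x.
Proof.
exists ([seq (k * q.1, q.2) | q <- l] ++ l') => x.
rewrite /cylcomb big_cat big_map big_distrr /=; congr (_ + _).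
by apply: eq_bigr => q _; rewrite mulrA.
Qed.

(** These sets form a base of the topology, and step functions over them are again cylinder
    combinations. *)
Definition tame (U : set (bpath E)) :=
  open U /\ exists l, forall x, cylcomb l x = (`[< U x >])%:R :> R[i].

Lemma tame_cylinder mu : tame (bcylinder mu).
Proof.
split; first exact: bcylinder_open.
by exists [:: (1, mu)] => x; rewrite cylcomb_cons /cylcomb big_nil addr0 mul1r.
Qed.

Lemma tameI U V : tame U -> tame V -> tame (U `&` V).
Proof.
move=> [oU [l hl]] [oV [l' hl']]; split; first exact: openI.
have [l'' hl''] := cylcomb_mul l l'; exists l'' => x.
by rewrite -hl'' hl hl' asbool_and; case: asboolP; rewrite ?mul1r ?mul0r.
Qed.

Lemma tame_diff_cylinder U mu : tame U -> tame (U `&` ~` bcylinder mu).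
Proof.
move=> tU; have [_ [l' hl']] := tameI tU (tame_cylinder mu).
have [oU [l hl]] := tU; split.
  by apply: openI => //; apply: closed_openC; exact: bcylinder_closed.
have [l'' hl''] := cylcomb_lin (-1) l' l; exists l'' => x.
rewrite hl'' hl hl' mulN1r.
have [Ux|nU] := pselect (U x); last first.
  by rewrite !asboolF ?oppr0 ?addr0 // => -[].
have [mx|nm] := pselect (bcylinder mu x).
  rewrite (asboolT Ux) (@asboolT ((U `&` bcylinder mu) x)) // asboolF ?addNr //.
  by case.
rewrite (asboolT Ux) (@asboolF ((U `&` bcylinder mu) x)) ?oppr0 ?add0r ?asboolT
  //.
by case.
Qed.

Lemma tame_nbhs x (W : set (bpath E)) : nbhs x W ->
  exists U, [/\ tame U, U x & U `<=` W].
Proof.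
pose F : set_system (bpath E) := [set W | exists U, [/\ tame U,
  U x & U `<=` W]].
have xr : begins_with x (vpath (brng x)) by apply/begins_vpath.
have FF : Filter F.
  split.
  - by exists (bcylinder (vpath (brng x))); split=> //; exact: tame_cylinder.
  - move=> P Q [U [tU Ux UP]] [V [tV Vx VQ]]; exists (U `&` V); split=> //.
      exact: tameI.
    by move=> y [/UP ? /VQ].
  - by move=> P Q PQ [U [tU Ux UP]]; exists U; split=> // y /UP/PQ.
apply: (@bpath_nbhs _ x F) => eta xe.
  by exists (bcylinder eta); split=> //; exact: tame_cylinder.
exists (bcylinder (vpath (brng x)) `&` ~` bcylinder eta); split=> //.
exact: tame_diff_cylinder (tame_cylinder _).
Qed.

(** Finitely many tame sets on which [f] varies by less than [eps] cover the compact set where [f]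
    is large. A step function over them approximates [f] on their union, and off the union both it
    and [f] are small. *)
Lemma cylcomb_dense (f : bpath E -> R[i]^o) (eps : R) : C0 f -> 0 < eps ->
  exists l, forall x, nrm (f x - cylcomb l x) < eps.
Proof.
move=> [fc fv] e0; pose K := [set x | eps%:C%C <= `|f x|].
have nb x : exists U, [/\ tame U, U x & forall y, U y -> nrm (f x - f y) < eps].
  have /cvg_nrm /(_ _ e0) /tame_nbhs [U [tU Ux UW]] := fc x.
  by exists U; split.
pose U x := projT1 (cid (nb x)).
have UP x : [/\ tame (U x), U x x & forall y, U x y -> nrm (f x - f y) < eps].
  by rewrite /U; case: cid.
pose P (G : {fset bpath E}) y := exists2 x, x \in G & U x y.
have [G KG] : exists G, K `<=` P G.
  have /compact_near_coveringP cK := fv _ e0.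
  apply: (@filter_ex _ (finsubsets (bpath E))).
  apply: (cK _ (finsubsets (bpath E)) P) => x Kx; exists (U x,
    [set G : {fset bpath E} | x \in G]) => /=; last first.
    by move=> [y G] /= [Uy xG]; exists x.
  split; first by have [[oU _] Ux _] := UP x; exact: open_nbhs_nbhs.
  by exists [fset x]%fset => // G /=; rewrite fsub1set.
have [l [h1 h2]] : exists l,
    (forall y, (exists2 x, x \in enum_fset G & U x y) -> nrm (f y - cylcomb l y)
      < eps)
    /\ (forall y, ~ (exists2 x, x \in enum_fset G & U x y) -> cylcomb l y = 0).
  elim: (enum_fset G) => [|x r [l [h1 h2]]].
    by exists [::]; split=> [y []//|y _]; rewrite /cylcomb big_nil.
  have [[_ [lx hx]] _ Ux] := UP x.
  have [l1 hl1] := cylcomb_mul l lx.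
  have [l2 hl2] := cylcomb_lin (-1) l1 l.
  have [l3 hl3] := cylcomb_lin (f x) lx l2.
  (* [l3] codes [f x] times the indicator of [U x], plus the previous step function cut off outside
     [U x]; the cover thus need not be made disjoint. *)
  have E3 y : cylcomb l3 y = if `[< U x y >] then f x else cylcomb l y.
    rewrite hl3 hl2 -hl1 hx; case: asboolP => _.
      by rewrite !mulr1 mulN1r addNr addr0.
    by rewrite !mulr0 !add0r.
  exists l3; split=> y.
    rewrite E3; case: asboolP => [Uy _|nU [z]]; first by rewrite nrmBC Ux.
    rewrite inE => /orP[/eqP ->//|zr Uz]; apply: h1; by exists z.
  move=> ny; rewrite E3; case: asboolP => [Uy|nU].
    by case: ny; exists x => //; rewrite inE eqxx.
  by apply: h2 => -[z zr Uz]; apply: ny; exists z => //; rewrite inE zr orbT.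
exists l => y.
have [hy|hy] := pselect (exists2 x, x \in enum_fset G & U x y); first exact: h1.
rewrite (h2 _ hy) subr0 ltNge; apply/negP => fy; apply: hy.
have Ky : K y by rewrite /K /= normE lecR.
exact: KG.
Qed.

End CylinderFunctions.

Lemma esum_leP (R : realType) (I : choiceType) (P : pred I) (lam : I -> R) (M :
  R) :
  (\esum_(e in [set e | P e]) (lam e)%:E <= M%:E)%E <->
  forall F : {fset I}, \sum_(e <- F | P e) lam e <= M.
Proof.
split=> [h F|h].
  rewrite -lee_fin; apply: le_trans h; apply: esum_ge.
  exists [set` [fset e in F | P e]%fset].
    split; first exact: finite_fset.
    by move=> e /=; rewrite !inE /= => /andP[].
  rewrite fsbig_finite ?finite_fset //= set_fsetK big_fset_condE /=.
  by rewrite sumEFin.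
apply: ge_ereal_sup => _ [X [finX XP] <-].
rewrite fsbig_finite //= sumEFin lee_fin; apply: le_trans (h (fset_set X)).
rewrite le_eqVlt; apply/orP; left; apply/eqP.
rewrite [LHS]big_seq [RHS]big_seq_cond; apply: eq_bigl => e.
case E1 : (e \in fset_set X) => //=.
by move: E1; rewrite in_fset_set // => /set_mem/XP /= ->.
Qed.

(** * The diagonal isomorphism and the partial sums *)

Section DiagonalIsomorphism.
Context (R : realType) (E : digraph) (A : cstarType R).
Context (s : edge E -> A) (p : vert E -> A).
Hypothesis ck : ck_family s p.
Notation pproj := (pproj s p).
Notation pcomb := (pcomb s p).
Notation diag := (diag_subalg s p).
Context (pi : A -> bop R (bpath E)).
Hypotheses (pi_hom : star_hom pi) (pi_s : forall e, pi (s e) = rep_edge R e).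
Hypothesis (pi_p : forall v, pi (p v) = rep_vert R v).
Notation Psi := (Psi pi).
Implicit Types (a b : A) (x y : bpath E) (F : {fset edge E}).

Lemma Psi_C0 a : diag a -> C0 (Psi a).
Proof.
move=> /(diagP s p) Da; apply: C0_uniform_limit => eps /Da [l hl].
exists (fun x => cylcomb l x); first exact: cylcomb_C0.
move=> x; rewrite -(Psi_pcomb ck pi_hom pi_s pi_p) -(PsiB pi_hom).
exact: le_lt_trans (Psi_le pi_hom _ _) hl.
Qed.

(** Cylinder functions within [2^-n] of [f] lift to combinations that form a Cauchy sequence in [A],
    because [Psi] is isometric on the diagonal. *)
Lemma Psi_surj (f : bpath E -> R[i]^o) : C0 f -> exists2 a, diag a & Psi a = f.
Proof.
move=> fC.
have h2 n : 0 < (2^-1 : R) ^+ n by rewrite exprn_gt0 // invr_gt0.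
have ex_l n : exists l, forall x, nrm (f x - cylcomb l x) < 2^-1 ^+ n.
  by apply: cylcomb_dense => //; exact: (cylcomb_mul ck pi_hom pi_s pi_p).
pose l n := projT1 (cid (ex_l n)).
have lP n x : nrm (f x - cylcomb (l n) x) < 2^-1 ^+ n by rewrite /l; case: cid.
have PsilE := Psi_pcomb ck pi_hom pi_s pi_p.
(* The constant 2 bounds the two errors [2^-n] and [2^-(n+1)] together. *)
have [|n|a aP] := @geometric_cvg _ _ (fun n => pcomb (l n)) 2 (2^-1).
- by rewrite invr_ge0 ler0n /= invf_lt1 // ltr1n.
- apply: (Psi_norm_le ck pi_hom pi_s pi_p).
  + apply: diagD; first exact: diag_pcomb.
    by rewrite -scaleN1r; apply: diagZ; exact: diag_pcomb.
  + by rewrite mulr_ge0 // ltW.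
  + move=> x; rewrite (PsiB pi_hom) !PsilE.
    apply: le_trans (nrm_trans _ (f x) _) _; rewrite (nrmBC _ (f x)).
    have := lP n x; have := lP n.+1 x; rewrite exprS; have := h2 n; lra.
have a_lim eps : 0 < eps -> exists n,
  nrm (a - pcomb (l n)) < eps /\ 2^-1 ^+ n < eps.
  move=> e0.
  have c0 : (2 * 2^-1 ^+ n / (1 - 2^-1)) @[n --> \oo] --> (0 : R).
    rewrite (_ : 0 = 2 * 0 / (1 - 2^-1)); last by rewrite mulr0 mul0r.
    apply: cvgMr_tmp; apply: cvgMl_tmp; apply: cvg_expr.
    by rewrite ger0_norm ?invr_ge0 // invf_lt1 // ltr1n.
  move/cvgrPdist_lt : c0 => /(_ _ e0) [N _ /(_ N (leqnn N))].
  rewrite sub0r normrN => h.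
  have h3 : 2 * 2^-1 ^+ N / (1 - 2^-1) < eps by apply: le_lt_trans h;
    exact: ler_norm.
  exists N; split; first exact: le_lt_trans (aP N) h3.
  have -> : 2^-1 ^+ N = (2 * 2^-1 ^+ N / (1 - 2^-1)) / 4 :> R by field.
  have := h2 N; move: h3; set z := _ / (1 - _); lra.
have Da : diag a.
  apply: (@diag_seq_closed _ _ _ s p (fun n => pcomb (l n))).
    by move=> n; exact: diag_pcomb.
  by move=> eps /a_lim[n [? _]]; exists n.
exists a => //; apply/funext => x; apply/eqP; rewrite -subr_eq0 -nrm_eq0.
rewrite eq_le nrm_ge0 andbT; apply/ler_addgt0Pr => eps e0; rewrite add0r.
have [n [h h']] := a_lim _ (divr_gt0 e0 (ltr0n R 2)).
apply: le_trans (nrm_trans _ (cylcomb (l n) x : R[i]^o) _) _.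
have := le_lt_trans (Psi_le pi_hom (a - pcomb (l n)) x) h.
rewrite (PsiB pi_hom) PsilE (nrmBC _ (f x)); have := lP n x; lra.
Qed.

Lemma Psi_diag_iso : diag_iso s p Psi.
Proof.
split.
- split.
  + by move=> a /= /Psi_C0.
  + move=> a b /set_mem Da /set_mem Db ab.
    by apply: (Psi_inj ck pi_hom pi_s pi_p) => // x; rewrite ab.
  + by move=> f /Psi_surj[a Da <-]; exists a.
- by move=> k a b _ _; apply/funext => x; rewrite (Psi_lin pi_hom).
- by move=> a b Da Db; apply/funext => x; rewrite (Psi_mul ck pi_hom pi_s pi_p).
- by move=> a Da; apply/funext => x; rewrite (Psi_star pi_hom).
Qed.

Lemma Psi_spath (mu : fin_path E) :
  Psi (spath s p mu ** star (spath s p mu)) = \1_(bcylinder mu).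
Proof.
apply/funext => x; rewrite -/(pproj mu) (Psi_pproj ck pi_hom pi_s pi_p) indicE
  /cylind.
by congr (nat_of_bool _)%:R; apply/asboolP/idP => [/mem_set|/set_mem].
Qed.

Context (lam : edge E -> R).
Hypothesis lam_gt0 : forall e, 0 < lam e.

Let lam0 e : 0 <= lam e := ltW (lam_gt0 e).

Lemma Phi_partialE a F :
  Phi_partial s lam a F = star (u_partial s lam F) ** a ** u_partial s lam F.
Proof.
rewrite /Phi_partial /u_partial /partial_sum star_sum !cmul_suml.
apply: eq_bigr => e _; rewrite cmul_sumr; apply: eq_bigr => f _.
by rewrite starZR !cmulZl cmulZr scalerA sqrtrM // rmorphM.
Qed.

Lemma transfer_termE (f : bpath E -> R[i]^o) y e :
  transfer_term lam f y e = (lam e)%:C%C * (if bcons_opt e y is Some x then f x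
    else 0).
Proof.
by rewrite /transfer_term /bcons_opt; case: pselect => // _; rewrite mulr0.
Qed.

Lemma diag_Phi_partial a F : diag a -> diag (Phi_partial s lam a F).
Proof.
move=> Da; apply: diag_sum => e; apply: diag_sum => f; apply: diagZ.
exact: (diag_compress ck).
Qed.

Lemma Psi_Phi_partial a F y : diag a ->
  Psi (Phi_partial s lam a F) y = partial_sum (transfer_term lam (Psi a) y) F.
Proof.
move=> Da; rewrite (Psi_sum pi_hom) [LHS]big_seq [RHS]big_seq.
apply: eq_bigr => e eF; rewrite (Psi_sum pi_hom) (bigD1_seq e) ?fset_uniq //=.
rewrite (PsiZ pi_hom) (Psi_compress ck pi_hom pi_s pi_p) // eqxx.
rewrite big1 => [|f fe]; last first.
  rewrite (PsiZ pi_hom) (Psi_compress ck pi_hom pi_s pi_p) //.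
  by rewrite eq_sym (negbTE fe) mulr0.
rewrite addr0 transfer_termE sqrtrM // -expr2 sqr_sqrtr //.
Qed.

Definition gram F : A := \sum_(e <- F) (lam e)%:C%C *: p (src e).

Lemma u_gram F : star (u_partial s lam F) ** u_partial s lam F = gram F.
Proof.
rewrite /u_partial /partial_sum star_sum cmul_suml [LHS]big_seq [RHS]big_seq.
apply: eq_bigr => e eF; rewrite cmul_sumr (bigD1_seq e) ?fset_uniq //=.
rewrite big1 => [|f fe]; last first.
  rewrite starZR cmulZl cmulZr (ss_orth ck) ?scaler0 //.
  by apply/eqP; rewrite eq_sym.
rewrite addr0 starZR cmulZl cmulZr scalerA -rmorphM -expr2 sqr_sqrtr //.
by rewrite (ck_src ck).
Qed.

Lemma diag_gram F : diag (gram F).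
Proof. by apply: diag_sum => e; apply: diagZ; exact: (diag_p ck). Qed.

Lemma Psi_p v y : Psi (p v) y = (brng y == v)%:R.
Proof. by rewrite -(pproj_vpath ck) (Psi_pproj ck pi_hom pi_s pi_p)
  cylind_vpath. Qed.

Lemma Psi_gram F y :
  Psi (gram F) y = (\sum_(e <- F | src e == brng y) lam e)%:C%C.
Proof.
rewrite (Psi_sum pi_hom) rmorph_sum [RHS]big_mkcond /=; apply: eq_bigr => e _.
rewrite (PsiZ pi_hom) Psi_p eq_sym.
by case: eqP => _; rewrite ?mulr1 ?mulr0.
Qed.

Lemma wsum_ge0 (P : pred (edge E)) F : 0 <= \sum_(e <- F | P e) lam e.
Proof. by apply: sumr_ge0 => e _. Qed.

Lemma nrm_u_le F (K : R) : 0 <= K ->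
  (forall v, \sum_(e <- F | src e == v) lam e <= K) ->
  nrm (u_partial s lam F) ^+ 2 <= K.
Proof.
move=> K0 hK; rewrite -nrm_cstar u_gram.
apply: (Psi_norm_le ck pi_hom pi_s pi_p) => //; first exact: diag_gram.
by move=> y; rewrite Psi_gram nrmR ger0_norm // wsum_ge0.
Qed.

Lemma u_partial_subD F0 F : (F0 `<=` F)%fset ->
  u_partial s lam F - u_partial s lam F0 = u_partial s lam (F `\` F0)%fset.
Proof.
by move=> FF; rewrite /u_partial (partial_sum_subD _ FF) addrAC subrr add0r.
Qed.

End DiagonalIsomorphism.

(** * The equivalences *)

Section CStarLimits.
Context (R : realType) (A : cstarType R) (T : Type) (F : set_system T).
Context {FF : Filter F}.

Lemma cvg_cmul (f g : T -> A) l m : f @ F --> l -> g @ F --> m ->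
  (fun t => f t ** g t) @ F --> l ** m.
Proof.
move=> /cvg_nrm fl /cvg_nrm gm; apply/cvg_nrm => eps e0.
have m1 : 0 < nrm m + 1 by rewrite ltr_wpDl // nrm_ge0.
have l1 : 0 < nrm l + 1 by rewrite ltr_wpDl // nrm_ge0.
have h1 := fl _ (divr_gt0 (divr_gt0 e0 (ltr0n _ 2)) m1).
have h2 := gm _ (divr_gt0 (divr_gt0 e0 (ltr0n _ 2)) l1).
apply: filterS (filterI (fl _ ltr01) (filterI h1 h2)) => t [ft1 [ft gt]].
have -> : l ** m - f t ** g t = (l - f t) ** m + f t ** (m - g t).
  by rewrite cmulBl cmulBr addrA subrK.
apply: le_lt_trans (nrmD _ _) _; rewrite (splitr eps).
rewrite ltr_pdivlMr // in ft; rewrite ltr_pdivlMr // in gt.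
have := nrm_cmul (l - f t) m; have := nrm_cmul (f t) (m - g t).
have := nrm_dist (f t) l; have := nrm_ge0 (l - f t); have := nrm_ge0 (m - g t).
have := nrm_ge0 m; have := nrm_ge0 (f t); nra.
Qed.

Lemma cvg_star (f : T -> A) l : f @ F --> l ->
  (fun t => star (f t)) @ F --> star l.
Proof.
move=> /cvg_nrm fl; apply/cvg_nrm => eps /fl; apply: filterS => t.
by rewrite -starB nrm_star.
Qed.

Lemma cvg_cmull (f : T -> A) l a : f @ F --> l ->
  (fun t => a ** f t) @ F --> a ** l.
Proof. by apply: cvg_cmul; exact: cvg_cst. Qed.

Lemma cvg_cmulr (f : T -> A) l a : f @ F --> l ->
  (fun t => f t ** a) @ F --> l ** a.
Proof. by move=> fl; apply: cvg_cmul => //; exact: cvg_cst. Qed.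

End CStarLimits.

Section GraphAlgebraNets.
Context (R : realType) (E : digraph) (A : cstarType R).
Context (s : edge E -> A) (p : vert E -> A).
Hypothesis AE : is_graph_algebra s p.
Let ck := ga_ck AE.

(* The vertex projections form an approximate unit, so they suffice to test
   the strict convergence of a bounded net. *)
Lemma left_net_cvg (I : choiceType) (w : {fset I} -> A) (K : R) :
  (forall F, nrm (w F) <= K) ->
  (forall v, cvg ((fun F => w F ** p v) @ finsubsets I)) ->
  forall a, cvg ((fun F => w F ** a) @ finsubsets I).
Proof.
move=> wK wp.
pose G a := cvg ((fun F => w F ** a) @ finsubsets I).
have K0 : 0 <= K := le_trans (nrm_ge0 _) (wK fset0).
have GR a b : G a -> G (a ** b).
  move=> /cvg_ex[l hl]; apply/cvg_ex; exists (l ** b).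
  rewrite (_ : (fun F => _) = (fun F => (w F ** a) ** b));
    first exact: cvg_cmulr.
  by apply/funext => F; rewrite cmulA.
have GL k a b : G a -> G b -> G (k *: a + b).
  move=> /cvg_ex[l hl] /cvg_ex[m hm]; apply/cvg_ex; exists (k *: l + m).
  rewrite (_ : (fun F => _) = (fun F => k *: (w F ** a) + w F ** b)).
    by apply: cvgD => //; apply: cvgZr.
  by apply/funext => F; rewrite cmulDr cmulZr.
have GC a : (forall eps : R, 0 < eps -> exists2 b,
  G b & nrm (a - b) < eps) -> G a.
  move=> Ga; apply: cauchy_cvg; apply/cauchy_netP => eps e0.
  have K1 : 0 < 3 * (K + 1) by rewrite mulr_gt0 // ltr_wpDl.
  have [b Gb ab] := Ga _ (divr_gt0 e0 K1).
  have [F0 hF0] := cvg_net_cauchy Gb (divr_gt0 e0 (ltr0n R 3)).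
  exists F0 => F /hF0 h.
  have -> : w F ** a - w F0 ** a =
      w F ** (a - b) + (w F ** b - w F0 ** b) - w F0 ** (a - b).
    rewrite !cmulBr opprB addrA [_ - w F ** b + _]addrA subrK.
    by rewrite subrK.
  apply: le_lt_trans (nrmD _ _) _; rewrite nrmN.
  have := nrmD (w F ** (a - b)) (w F ** b - w F0 ** b).
  have := nrm_cmul (w F) (a - b); have := nrm_cmul (w F0) (a - b).
  have := wK F; have := wK F0; have := nrm_ge0 (a - b).
  have := nrm_ge0 (w F); have := nrm_ge0 (w F0).
  by rewrite ltr_pdivlMr // in ab; nra.
(* [G] is stable under right multiplication but not visibly under [star], so adjoints are built into
   the subalgebra. *)
pose B a := G a /\ G (star a).
have BT : B = setT.
  apply: (ga_generated AE).
  - split.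
    + move=> a Ba; split; apply: GC => eps e0.
        by have [b [Gb _] ab] := (closure_nrm B a).1 Ba _ e0; exists b.
      have [b [_ Gb] ab] := (closure_nrm B a).1 Ba _ e0; exists (star b) => //.
      by rewrite -starB nrm_star.
    + have G0 : G 0.
        apply/cvg_ex; exists 0; rewrite (_ : (fun F => _) = fun=> 0).
          exact: cvg_cst.
        by apply/funext => F; rewrite cmul0r.
      by split; rewrite ?star0.
    + move=> k a b [Ga Gas] [Gb Gbs]; split; first exact: GL.
      by rewrite starD starZ; exact: GL.
    + move=> a b [Ga Gas] [Gb Gbs]; split; first exact: GR.
      by rewrite starM; exact: GR.
    + by move=> a [Ga Gas]; split=> //; rewrite starK.
  (* Each generator and its adjoint has a vertex projection as left factor, and there convergence is
     given. *)
  - move=> e; split; first by rewrite -(s_rng ck); exact/GR/wp.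
    by rewrite -(ss_src ck); exact/GR/wp.
  - by move=> v; split; rewrite ?(p_star ck); exact: wp.
by move=> a; have [] : B a by rewrite BT.
Qed.

End GraphAlgebraNets.

Section Equivalences.
Context (R : realType) (E : digraph) (A : cstarType R).
Context (s : edge E -> A) (p : vert E -> A).
Hypothesis AE : is_graph_algebra s p.
Let ck := ga_ck AE.
Notation diag := (diag_subalg s p).
Context (pi : A -> bop R (bpath E)).
Hypotheses (pi_hom : star_hom pi) (pi_s : forall e, pi (s e) = rep_edge R e).
Hypothesis (pi_p : forall v, pi (p v) = rep_vert R v).
Notation Psi := (Psi pi).
Context (lam : edge E -> R).
Hypothesis lam_gt0 : forall e, 0 < lam e.
Implicit Types (a b : A) (x y : bpath E) (F G : {fset edge E}).
Notation u := (u_partial s lam).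

Let lam0 e : 0 <= lam e := ltW (lam_gt0 e).

(** The l_infinity half of (ii), expressed by finite real sums. *)
Definition fiber_sums_bounded :=
  exists M : R, forall v F, \sum_(e <- F | src e == v) lam e <= M.

Lemma sum_fsubset (P : pred (edge E)) F G : (F `<=` G)%fset ->
  \sum_(e <- F | P e) lam e <= \sum_(e <- G | P e) lam e.
Proof.
move=> FG; rewrite !(big_mkcond P).
apply: (partial_sum_le (g := fun e => if P e then lam e else 0)) => // e.
by case: ifP.
Qed.

Lemma fiber_sums_unbounded : ~ fiber_sums_bounded ->
  forall B : R, exists v F, B < \sum_(e <- F | src e == v) lam e.
Proof.
move=> h B; apply: contrapT => nB; apply: h; exists B => v F.
by rewrite leNgt; apply/negP => h; apply: nB; exists v, F.
Qed.

Lemma Re_ge (z : R[i]^o) (c : R) :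
  (forall eps : R, 0 < eps -> exists2 t : R, c <=
    t & nrm (z - t%:C%C : R[i]^o) < eps) ->
  c <= complex.Re z.
Proof.
move=> h; apply/ler_addgt0Pr => eps /h [t ct zt].
have := le_lt_trans (nrm_ge_Re _) zt; rewrite ltr_norml => /andP[h1 _].
move: h1; rewrite (_ : complex.Re (z - t%:C%C) = complex.Re z - t); last first.
  by case: (z).
lra.
Qed.

(** The test element of both gliding humps, the sum of [2^-n x_n]. All symbols are nonnegative, so
    no cancellation can push the total below its [n]-th term. *)
Lemma dyadic_series (x : nat -> A) (chi : nat -> bpath E -> R) :
  (forall n, diag (x n)) ->
  (forall n y, Psi (x n) y = (chi n y)%:C%C) -> (forall n y, 0 <= chi n y <=
    1) ->
  exists2 a, diag a & forall y, 0 <= complex.Re (Psi a y) /\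
    forall n, chi n y = 1 -> 2^-1 ^+ n <= complex.Re (Psi a y).
Proof.
move=> Dx xchi chi01.
have h0 n : 0 <= 2^-1 ^+ n :> R by rewrite exprn_ge0 // invr_ge0.
have x1 n : nrm (x n) <= 1.
  apply: (Psi_norm_le ck pi_hom pi_s pi_p) => // y.
  by rewrite xchi nrmR; have /andP[c0 c1] := chi01 n y; rewrite ger0_norm.
pose w n := \sum_(k < n) (2^-1 ^+ k)%:C%C *: x k.
have Dw n : diag (w n) by apply: diag_sum => k; apply: diagZ.
pose t n y := \sum_(k < n) 2^-1 ^+ k * chi k y.
have wt n y : Psi (w n) y = (t n y)%:C%C.
  rewrite (Psi_sum pi_hom) rmorph_sum; apply: eq_bigr => k _.
  by rewrite (PsiZ pi_hom) xchi rmorphM.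
have [|n|a aP] := @geometric_cvg _ _ w 1 (2^-1).
- by rewrite invr_ge0 ler0n /= invf_lt1 // ltr1n.
- rewrite /w big_ord_recr /= [X in X - _]addrC addrK nrmZR // mul1r.
  by rewrite ler_piMr.
have a_lim eps : 0 < eps -> exists N, forall n, (N <=
  n)%N -> nrm (a - w n) < eps.
  move=> e0.
  have c0 : (1 * 2^-1 ^+ n / (1 - 2^-1)) @[n --> \oo] --> (0 : R).
    rewrite (_ : 0 = 1 * 0 / (1 - 2^-1)); last by rewrite mulr0 mul0r.
    apply: cvgMr_tmp; apply: cvgMl_tmp; apply: cvg_expr.
    by rewrite ger0_norm ?invr_ge0 // invf_lt1 // ltr1n.
  move/cvgrPdist_lt : c0 => /(_ _ e0) [N _ hN]; exists N => n /hN.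
  rewrite sub0r normrN => h; apply: le_lt_trans (aP n) _.
  by apply: le_lt_trans h; exact: ler_norm.
exists a.
  apply: diag_seq_closed Dw _ => eps /a_lim[N hN].
  by exists N; exact: hN.
have ReP y c N : (forall n, (N <= n)%N -> c <= t n y) -> c <=
  complex.Re (Psi a y).
  move=> ct; apply: Re_ge => eps /a_lim[N' hN].
  exists (t (maxn N N') y); first by apply: ct; exact: leq_maxl.
  rewrite -wt -(PsiB pi_hom); apply: le_lt_trans (Psi_le pi_hom _ _) _.
  by apply: hN; exact: leq_maxr.
have t0 k y : 0 <= 2^-1 ^+ k * chi k y.
  by apply: mulr_ge0 => //; have /andP[] := chi01 k y.
move=> y; split=> [|n cn].
  by apply: (ReP y 0 0%N) => n _; apply: sumr_ge0.
(* The partial sum over [k < m] contains the term of index [n] only from [m = n.+1] on. *)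
apply: (ReP y _ n.+1) => m nm.
rewrite /t (bigD1 (Ordinal nm)) //= cn mulr1 lerDl; apply: sumr_ge0 => *.
exact: t0.
Qed.

Lemma Psi_epath_sum F y : Psi (\sum_(e <- F) pproj s p (epath e)) y =
  (`[< exists2 e, e \in F & exists z, buncons e y = Some z >])%:R.
Proof.
rewrite (Psi_sum pi_hom).
have [[ps ->]|[e [z [h ->]]]] := vpath_or_bcons y.
  rewrite big1 => [|e _].
    by rewrite asboolF // => -[e _ [z]]; rewrite buncons_vpath.
  by rewrite (Psi_pproj ck pi_hom pi_s pi_p) cylind_bfin.
have Pe f : Psi (pproj s p (epath f)) (bcons h) = (f == e)%:R.
  rewrite (Psi_pproj ck pi_hom pi_s pi_p) cylind_bcons cylind_vpath eq_sym.
  by case: eqP => // ->; rewrite h eqxx.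
have [eF|eF] := boolP (e \in F); last first.
  rewrite big_seq big1 => [|f fF].
    rewrite asboolF // => -[f fF [z']]; rewrite buncons_bcons.
    by case: eqP => // fe; move: eF; rewrite -fe fF.
  by rewrite Pe; case: eqP => // fe; move: eF; rewrite -fe fF.
rewrite asboolT; last by exists e => //; exists z; rewrite buncons_bcons eqxx.
rewrite (bigD1_seq e) ?fset_uniq //= Pe eqxx big1 ?addr0 // => f /negbTE fe.
by rewrite Pe fe.
Qed.

Lemma Re_Psi_Phi_partial a F y : diag a ->
  complex.Re (Psi (Phi_partial s lam a F) y) =
  \sum_(e <- F) lam e * (if bcons_opt e y is Some x then complex.Re (Psi a x)
    else 0).
Proof.
move=> Da; rewrite (Psi_Phi_partial ck pi_hom pi_s pi_p lam_gt0) //.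
rewrite /partial_sum.
have ReD (z w : R[i]) : complex.Re (z + w) = complex.Re z + complex.Re w.
  by case: z w => [? ?] [? ?].
rewrite (big_morph _ ReD (erefl _)); apply: eq_bigr => e _;
  rewrite transfer_termE.
have ReM (c : R) (z : R[i]) : complex.Re (c%:C%C * z) = c * complex.Re z.
  by case: z => [? ?]; rewrite /= mul0r subr0.
by rewrite ReM; case: (bcons_opt e y).
Qed.

Lemma sandwich_le (h q S : R) : h * h * q = 1 -> 0 < q -> h * S * h <=
  1 -> S <= q.
Proof.
move=> hq q0; rewrite -(ler_pM2r q0) mul1r.
rewrite (_ : h * S * h * q = h * h * q * S); last by ring.
by rewrite hq mul1r.
Qed.

Lemma pow_half_four n : 2^-1 ^+ n * 4 ^+ n = 2 ^+ n :> R.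
Proof.
by rewrite -exprMn; congr (_ ^+ _); field.
Qed.

(* Gliding hump: [a = sum_n 2^-n (sum_(e in G n) s_e s_e^* )], where the edges
   of [G n] have source [v n] and total weight above [4 ^ n]. *)
Lemma Phi_cvg_bounded :
  (forall a, cvg (Phi_partial s lam a @ finsubsets (edge E))) ->
  fiber_sums_bounded.
Proof.
move=> Pc; apply: contrapT => /fiber_sums_unbounded nb.
have /choice [v nbv] := fun n => nb (4 ^+ n).
have /choice [F FP] := nbv.
pose G n := [fset e in F n | src e == v n]%fset.
have [|n y|n y|a Da aP] := @dyadic_series (fun n =>
  \sum_(e <- G n) pproj s p (epath e))
  (fun n y => (`[< exists2 e, e \in G n & exists z,
    buncons e y = Some z >])%:R).
- by move=> n; apply: diag_sum => e; exact: diag_pproj.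
- by rewrite Psi_epath_sum rmorph_nat.
- by case: asboolP; rewrite ?lexx ?ler01.
have /cvg_net_cauchy /(_ _ ltr01) [F0 hF0] := Pc a.
pose C := nrm (Phi_partial s lam a F0) + 1.
(* Beyond [F0] the net moves by less than 1, so one constant [C] serves all [n], whereas adding
   [F n] raises the symbol over [v n] to at least [2^-n * 4^n]. *)
have CP n : 2 ^+ n <= C.
  have [y yv] := bpath_ex (v n).
  have h1 : nrm (Phi_partial s lam a (F0 `|` F n)%fset) <= C.
    have := nrm_dist (Phi_partial s lam a (F0 `|` F n)%fset) (Phi_partial s lam
      a F0).
    have := hF0 _ (fsubsetUl F0 (F n)); rewrite nrmBC /C; lra.
  apply: le_trans h1; apply: le_trans (Psi_le pi_hom _ y).
  apply: le_trans (nrm_ge_Re _); apply: le_trans (ler_norm _).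
  rewrite Re_Psi_Phi_partial // -pow_half_four.
  apply: (@le_trans _ _ (2^-1 ^+ n * \sum_(e <- F n | src e == v n) lam e)).
    by rewrite ler_wpM2l ?exprn_ge0 ?invr_ge0 // ltW.
  have t0 e : 0 <= lam e * (if bcons_opt e y is Some x then complex.Re (Psi a x)
    else 0).
    by apply: mulr_ge0 => //; case: (bcons_opt e y) => // x; have [] := aP x.
  apply: le_trans (partial_sum_le t0 (fsubsetUr F0 (F n))).
  rewrite /partial_sum big_distrr /= big_mkcond [X in X <=
    _]big_seq [X in _ <= X]big_seq.
  apply: ler_sum => e eF; case: eqP => [ev|_]; last exact: t0.
  rewrite mulrC ler_wpM2l // (bcons_opt_bcons (etrans ev (esym yv))).
  have [_] := aP (bcons (etrans ev (esym yv))); apply.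
  rewrite asboolT //; exists e; first by rewrite !inE eF ev eqxx.
  by exists y; rewrite buncons_bcons eqxx.
have := CP (Num.truncn C).+1; have := truncnS_gt C.
set N := (Num.truncn C).+1; have : N%:R <= 2 ^+ N :> R.
  by rewrite -natrX ler_nat ltnW // ltn_expl.
lra.
Qed.

(* Gliding hump with [a = sum_n 2^-n p_(v n)]; the factor [n.+1] in [B n]
   absorbs the weight of the finite set of edges beyond which the net varies by
   less than 1. *)
Lemma strict_sum_bounded (w : multiplier A) :
  is_strict_sum s lam w -> fiber_sums_bounded.
Proof.
move=> uw; apply: contrapT => /fiber_sums_unbounded nb.
pose B n : R := 4 ^+ n * n.+1%:R.
have /choice [v nbv] := fun n => nb (B n).
have /choice [F FP] := nbv.
have [|n y|n y|a Da aP] := @dyadic_series (fun n => p (v n))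
  (fun n y => (brng y == v n)%:R).
- by move=> n; exact: (diag_p ck).
- by rewrite (Psi_p ck pi_hom pi_s pi_p) rmorph_nat.
- by case: eqP; rewrite ?lexx ?ler01.
have [uwl _] := uw a.
have [F0 hF0] := cvg_net_cauchy (cvgP _ uwl) ltr01.
pose C := \sum_(e <- F0) lam e.
have C0 : 0 <= C by apply: sumr_ge0.
(* In the sum over [F n], the edges in [F0] account for at most [C]. For the rest [G], the norm of
   [u_G a] is below 1 while the symbol of [a] over [v n] is at least [2^-n], which leaves at most
   [4^n]. *)
have bound n : B n <= 4 ^+ n + C.
  have [y yv] := bpath_ex (v n).
  have := hF0 _ (fsubsetUl F0 (F n));
    rewrite /= -cmulBl u_partial_subD ?fsubsetUl //.
  set G := (_ `\` F0)%fset => hG.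
  have h1 : nrm (star a ** gram p lam G ** a) <= 1.
    rewrite -(u_gram ck lam_gt0) cmulA -cmulA -starM nrm_cstar.
    by rewrite exprn_ile1 ?nrm_ge0 // ltW.
  have Dg : diag (gram p lam G) by exact: diag_gram.
  have h2 := le_trans (Psi_le pi_hom _ y) h1.
  rewrite (Psi_mul ck pi_hom pi_s pi_p) // (Psi_mul ck pi_hom pi_s pi_p) // in
    h2.
  rewrite (Psi_gram ck pi_hom pi_s pi_p) (Psi_star pi_hom) !nrmM nrmJ nrmR in
    h2.
  rewrite ger0_norm ?wsum_ge0 // yv in h2.
  have [_ /(_ n)] := aP y; rewrite yv eqxx => /(_ erefl) h3.
  have h4 : 2^-1 ^+ n <= nrmc (Psi a y).
    by apply: le_trans h3 _; apply: le_trans (ler_norm _) _; exact: nrm_ge_Re.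
  have h5 : \sum_(e <- F n | src e == v n) lam e <=
      C + \sum_(e <- G | src e == v n) lam e.
    apply: (@le_trans _ _ (\sum_(e <- (F0 `|` F n)%fset | src e == v n) lam e)).
      by apply: sum_fsubset; exact: fsubsetUr.
    rewrite !(big_mkcond (fun e => src e == v n)) -/(partial_sum _ _).
    rewrite (partial_sum_subD _ (fsubsetUl F0 (F n))) lerD2r.
    by apply: ler_sum => e _; case: eqP.
  have h6 : \sum_(e <- G | src e == v n) lam e <= 4 ^+ n.
    have S0 := wsum_ge0 lam_gt0 (fun e => src e == v n) G.
    set S := \sum_(e <- G | _) _ in h2 S0 *.
    have hh : 0 <= 2^-1 ^+ n :> R by rewrite exprn_ge0 // invr_ge0.
    have : 2^-1 ^+ n * S * 2^-1 ^+ n <= 1.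
      apply: le_trans h2; apply: ler_pM => //; first exact: mulr_ge0.
      by apply: ler_pM.
    have q4 : 2^-1 ^+ n * 2^-1 ^+ n * 4 ^+ n = 1 :> R.
      rewrite -!exprMn (_ : 2^-1 * 2^-1 * 4 = 1) ?expr1n //; by field.
    have q0 : 0 < 4 ^+ n :> R by rewrite exprn_gt0.
    exact: sandwich_le.
  have := FP n; lra.
have := bound (Num.truncn C).+1; have := truncnS_gt C.
set N := (Num.truncn C).+1; rewrite /B -[N.+1%:R]natr1.
have : 1 <= 4 ^+ N :> R by rewrite exprn_ege1 // ler1n.
have : 0 <= N%:R :> R by [].
move: (4 ^+ N) (N%:R) => q r r0 q1 Cr; nra.
Qed.

End Equivalences.

(** * From (iv) to (i) and from (i) to (ii) *)

Section Implications.
Context (R : realType) (E : digraph) (A : cstarType R).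
Context (s : edge E -> A) (p : vert E -> A).
Hypothesis AE : is_graph_algebra s p.
Let ck := ga_ck AE.
Notation diag := (diag_subalg s p).
Context (pi : A -> bop R (bpath E)).
Hypotheses (pi_hom : star_hom pi) (pi_s : forall e, pi (s e) = rep_edge R e).
Hypothesis (pi_p : forall v, pi (p v) = rep_vert R v).
Notation Psi := (Psi pi).
Context (lam : edge E -> R).
Hypothesis lam_gt0 : forall e, 0 < lam e.
Implicit Types (a b : A) (x y : bpath E) (F G : {fset edge E}).
Notation u := (u_partial s lam).
Notation Phip := (Phi_partial s lam).

Let lam0 e : 0 <= lam e := ltW (lam_gt0 e).

(** Evaluation of the symbol at a point is norm-contractive, so norm convergence in [A] forces
    convergence of the transfer sums at every point. *)
Lemma transfer_Psi a b : diag a -> Phip a @ finsubsets (edge E) --> b ->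
  [/\ diag b, forall y, partial_sum (transfer_term lam (Psi a) y) @
         finsubsets (edge E) --> Psi b y & transfer lam (Psi a) = Psi b].
Proof.
move=> Da ab.
have cy y : partial_sum (transfer_term lam (Psi a) y) @
    finsubsets (edge E) --> Psi b y.
  move/cvg_netP : ab => ab; apply/cvg_netP => eps /ab[F0 h]; exists F0 => F /h.
  rewrite -(Psi_Phi_partial ck pi_hom pi_s pi_p lam_gt0) // -(PsiB pi_hom).
  exact: le_lt_trans (Psi_le pi_hom _ _).
split=> //; last by apply/funext => y; exact: lim_net (cy y).
by apply: diag_closed ab => F; exact: (diag_Phi_partial ck).
Qed.

Lemma cp_map_transfer :
  Phi_defines_cp_map s lam -> transfer_defines_bounded_operator lam.
Proof.
move=> [Pc [Plin _]].
(* The bound on the fiber sums will bound the transfer operator: at [y] only edges with source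
   [r(y)] contribute. *)
have [M hM] := Phi_cvg_bounded AE pi_hom pi_s pi_p lam_gt0 Pc.
have key f : C0 f -> exists a, [/\ diag a, Psi a = f,
    diag (Phi s lam a), transfer lam f = Psi (Phi s lam a) &
    forall y, partial_sum (transfer_term lam f y) @ finsubsets (edge E) -->
      transfer lam f y].
  move=> /(Psi_surj ck pi_hom pi_s pi_p) [a Da <-]; exists a.
  by have [Db cy ->] := transfer_Psi Da (Pc a).
split.
  by move=> f /key[a [_ _ _ _ h]] mu; exact: cvgP (h mu).
split.
- by move=> f /key[a [_ _ Db -> _]]; exact: (Psi_C0 ck pi_hom pi_s pi_p).
- move=> k f g /[dup] fC /key[a [Da fa _ fT _]] /[dup] gC /key[b [Db gb _ gT
    _]].
  have Dab := diag_lin (k := k) Da Db.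
  have [_ _] := transfer_Psi Dab (Pc (k *: a + b)).
  rewrite (_ : Psi (k *: a + b) = (fun x => k * f x + g x)); last first.
    by apply/funext => x; rewrite (Psi_lin pi_hom) fa gb.
  move=> ->; apply/funext => x; rewrite -/(Phi s lam _) Plin (Psi_lin pi_hom).
  by rewrite fT gT.
exists `|M| => f /[dup] fC /key[a [_ _ _ _ h]].
have S0 x : nrm (f x) <= supnorm f by exact: nrm_le_supnorm.
(* A point is needed to see that [supnorm f] is nonnegative; on the empty space both sides are 0. *)
have [[x0 _]|/set0P/negP/negPn/eqP E0] := pselect ([set: bpath E] !=set0);
  last first.
  by rewrite /supnorm E0 !image_set0 sup0 mulr0.
have Sf : 0 <= supnorm f by exact: le_trans (nrm_ge0 _) (S0 x0).
apply: supnorm_le => [|y]; first by rewrite mulr_ge0.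
apply: (cvg_net_le (h y)) => F; apply: le_trans (nrm_sum _ _ _) _.
apply: (@le_trans _ _ (\sum_(e <- F | src e == brng y) lam e * supnorm f)).
  rewrite [X in _ <= X]big_mkcond; apply: ler_sum => e _.
  rewrite transfer_termE nrmM nrmR ger0_norm //.
  case E1 : (bcons_opt e y) => [x|]; last first.
    by rewrite nrm0 mulr0; case: eqP => // _; exact: mulr_ge0.
  by have [ey _] := (bcons_optP e x y).1 E1; rewrite ey eqxx ler_wpM2l.
rewrite -big_distrl ler_wpM2r //; apply: le_trans (hM _ _) _; exact: ler_norm.
Qed.

Lemma weight_cond1P : in_linfty (range (@src E))
    (fun v => \esum_(e in out_edges v) (lam e)%:E) <-> fiber_sums_bounded lam.
Proof.
have oE v : out_edges v = [set e | src e == v].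
  by apply/seteqP; split=> e /= /eqP.
split=> [[M hM]|[M hM]].
  (* A vertex that is not a source has the empty sum 0, which [M] does not control. *)
  exists (Num.max M 0) => v F.
  have [[e ev]|nv] := pselect (exists e, src e = v).
    have := hM v (ex_intro2 _ _ e I ev).
    rewrite gee0_abs ?esum_ge0 // => [|e' _]; last by rewrite lee_fin.
    rewrite oE => /esum_leP /(_ F) /le_trans; apply.
    by rewrite le_max lexx.
  rewrite big1 => [|e /eqP ev]; first by rewrite le_max lexx orbT.
  by case: nv; exists e.
exists M => v _; rewrite gee0_abs ?esum_ge0 // => [|e _];
  last by rewrite lee_fin.
by rewrite oE; apply/esum_leP.
Qed.

Lemma transfer_weight :
  transfer_defines_bounded_operator lam -> weight_conditions lam.
Proof.
move=> [Tc [TC0 _ [M hM]]].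
have bd : fiber_sums_bounded lam.
  exists `|M| => v F.
  have [y yv] := bpath_ex v.
  (* The indicator of the paths whose first edge lies in [F]: its supremum norm is at most 1, and
     its transfer at [y] is exactly the finite fiber sum over [F]. *)
  pose f x : R[i]^o := cylcomb [seq (1, epath e) | e <- F] x.
  have fE x : f x = (`[< exists2 e, e \in F & exists z,
    buncons e x = Some z >])%:R.
    rewrite -(Psi_epath_sum AE pi_hom pi_s pi_p) /f -(Psi_pcomb ck pi_hom pi_s
      pi_p).
    rewrite /pcomb big_map; congr (Psi _ x); apply: eq_bigr => e _.
    by rewrite scale1r.
  have fC : C0 f by exact: cylcomb_C0.
  have f1 : supnorm f <= 1.
    apply: supnorm_le => // x; rewrite fE; case: asboolP => _.
      by rewrite (nrmR 1) normr1.
    by rewrite nrm0.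
  have Tf : transfer lam f y = (\sum_(e <- F | src e == v) lam e)%:C%C.
    apply: lim_net; apply/cvg_netP => eps e0; exists F => G FG.
    rewrite (_ : partial_sum _ G = (\sum_(e <- F | src e == v) lam e)%:C%C)
      ?subrr ?nrm0 //.
    rewrite /partial_sum -(big_fset_incl _ FG) => [|e _ eF]; last first.
      rewrite transfer_termE; case E1 : (bcons_opt e y) => [x|];
        last by rewrite mulr0.
      rewrite fE asboolF ?mulr0 // => -[e' e'F [z ez]].
      have := buncons_edge ez ((bunconsP e x y).2 E1) => ee.
      by move: eF; rewrite -ee e'F.
    rewrite rmorph_sum [RHS]big_mkcond [LHS]big_seq [RHS]big_seq /=.
    apply: eq_bigr => e eF; rewrite transfer_termE.
    case: eqP => [ev|ev].
      rewrite (bcons_opt_bcons (etrans ev (esym yv))) fE asboolT ?mulr1 //.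
      by exists e => //; exists y; rewrite buncons_bcons eqxx.
    case E1 : (bcons_opt e y) => [x|]; last by rewrite mulr0.
    by move/bcons_optP : E1 => [h]; case: ev; rewrite h.
  have S0 := wsum_ge0 lam_gt0 (fun e => src e == v) F.
  have <- : nrm (transfer lam f y) = \sum_(e <- F | src e == v) lam e.
    by rewrite Tf nrmR ger0_norm.
  apply: le_trans (nrm_le_supnorm _ (TC0 _ fC)) _; apply: le_trans (hM _ fC) _.
  apply: (@le_trans _ _ (`|M| * supnorm f)).
    rewrite ler_wpM2r ?ler_norm //.
    exact: le_trans (nrm_ge0 _) (nrm_le_supnorm y fC).
  by rewrite ler_piMr.
split; first exact/weight_cond1P.
move=> v _.
have iE w : in_edges v `&` out_edges w = [set e | (rng e == v) && (src e == w)].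
  apply/seteqP; split=> e /=; first by move=> [-> ->]; rewrite !eqxx.
  by move=> /andP[/eqP ? /eqP ?].
have [B hB] := bd.
have wB w : (\esum_(e in in_edges v `&` out_edges w) (lam e)%:E <= B%:E)%E.
  rewrite iE; apply/esum_leP => F; apply: le_trans (hB w F).
  rewrite big_mkcond [X in _ <= X]big_mkcond; apply: ler_sum => e _ /=.
  by case: (rng e == v) => //=; case: ifP.
have w0 w : (0 <= \esum_(e in in_edges v `&` out_edges w) (lam e)%:E)%E.
  by apply: esum_ge0 => e _; rewrite lee_fin.
split=> [w _|eps e0].
  by rewrite ge0_fin_numE //; apply: le_lt_trans (wB w) _; exact: ltry.
pose f x : R[i]^o := cylind R (vpath v) x.
have fC : C0 f by exact: cylind_C0.
have [_ Tv] := TC0 _ fC.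
(* Halving [eps] leaves room for a finite partial sum of an infinite sum that is at least [eps]. *)
have Kc := Tv _ (divr_gt0 e0 (ltr0n R 2)).
(* The open sets [D_w] partition the boundary space, so a compact set meets only finitely many of
   them. *)
have [W hG] : exists W : {fset vert E},
    forall y, (eps / 2)%:C%C <= `|transfer lam f y| -> brng y \in W.
  have /compact_near_coveringP cK := Kc.
  have [|W hW] := @filter_ex _ (finsubsets (vert E)) _
    (fun W : {fset vert E} => [set x | (eps / 2)%:C%C <=
      `|transfer lam f x|] `<=` (fun y => brng y \in W)).
    apply: (cK _ (finsubsets (vert E)) (fun (W : {fset vert E}) y =>
      brng y \in W)) => x _.
    exists (bcylinder (vpath (brng x)),
      [set W : {fset vert E} | brng x \in W]) => /=.
      split.
        apply: open_nbhs_nbhs; split; first exact: bcylinder_open.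
        exact/begins_vpath.
      by exists [fset brng x]%fset => // W /=; rewrite fsub1set.
    by move=> [y W] /= [/begins_vpath -> xG].
  by exists W => y hy; exact: hW.
apply: (sub_finite_set _ (finite_fset W)) => w /= [_].
rewrite gee0_abs // => ew; have [y yw] := bpath_ex w.
rewrite -yw; apply: hG; rewrite normE lecR.
have [F hF] : exists F : {fset edge E},
    eps / 2 < \sum_(e <- F | (rng e == v) && (src e == w)) lam e.
  apply: contrapT => nF; have : (\esum_(e in in_edges v `&` out_edges w) (lam
    e)%:E
      <= (eps / 2)%:E)%E.
    rewrite iE; apply/esum_leP => F; rewrite leNgt; apply/negP => h.
    by apply: nF; exists F.
  by move=> /(le_trans ew); rewrite lee_fin; lra.
apply: le_trans (nrm_ge_Re _); apply: le_trans (ler_norm _).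
have /cvg_netP cT : partial_sum (transfer_term lam f y) @ finsubsets (edge E)
  -->
  transfer lam f y := Tc f fC y.
apply: Re_ge => d /cT[F0 hF0].
exists (\sum_(e <- (F0 `|` F)%fset | (rng e == v) && (src e == w)) lam e).
  apply: le_trans (ltW hF) _; apply: (sum_fsubset lam_gt0); exact: fsubsetUr.
have := hF0 _ (fsubsetUl F0 F); congr (nrm (_ - _) < _).
rewrite rmorph_sum [RHS]big_mkcond; apply: eq_bigr => e _ /=.
rewrite transfer_termE /f; case: (src e =P w) => [ew'|ew'].
  rewrite (bcons_opt_bcons (etrans ew' (esym yw))) cylind_vpath brng_bcons
    andbT.
  by case: eqP => _; rewrite ?mulr1 ?mulr0.
rewrite andbF; case E1 : (bcons_opt e y) => [x|]; last by rewrite mulr0.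
by move/bcons_optP : E1 => [h]; case: ew'; rewrite h.
Qed.

End Implications.

(** * Strict convergence and the completely positive map *)

Section StrictSum.
Context (R : realType) (E : digraph) (A : cstarType R).
Context (s : edge E -> A) (p : vert E -> A).
Hypothesis AE : is_graph_algebra s p.
Let ck := ga_ck AE.
Context (pi : A -> bop R (bpath E)).
Hypotheses (pi_hom : star_hom pi) (pi_s : forall e, pi (s e) = rep_edge R e).
Hypothesis (pi_p : forall v, pi (p v) = rep_vert R v).
Context (lam : edge E -> R).
Hypothesis lam_gt0 : forall e, 0 < lam e.
Implicit Types (a b : A) (F G : {fset edge E}) (v : vert E).
Notation u := (u_partial s lam).
Notation Phip := (Phi_partial s lam).

Let lam0 e : 0 <= lam e := ltW (lam_gt0 e).

Lemma u_p F v : u F ** p v = u [fset e in F | src e == v]%fset.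
Proof.
rewrite /u_partial /partial_sum cmul_suml -big_fset_condE [RHS]big_mkcond /=.
apply: eq_bigr => e _; rewrite cmulZl; case: eqP => [<-|ev].
  by rewrite (s_src ck).
by rewrite -(s_src ck) -cmulA (ck_orth ck ev) cmul0r scaler0.
Qed.

Lemma p_u F v : p v ** u F = u [fset e in F | rng e == v]%fset.
Proof.
rewrite /u_partial /partial_sum cmul_sumr -big_fset_condE [RHS]big_mkcond /=.
apply: eq_bigr => e _; rewrite cmulZr; case: eqP => [<-|ev].
  by rewrite (s_rng ck).
by rewrite (p_s ck) ?scaler0 // => /esym.
Qed.

Lemma fiber_sums_u_bounded : fiber_sums_bounded lam ->
  exists K : R, forall F, nrm (u F) <= K.
Proof.
move=> [M hM]; exists (Num.sqrt `|M|) => F.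
rewrite -(ler_pXn2r (ltn0Sn 1)) ?nnegrE ?nrm_ge0 ?sqrtr_ge0 // sqr_sqrtr //.
apply: (nrm_u_le ck pi_hom pi_s pi_p lam_gt0) => // v.
by apply: le_trans (hM v F) _; exact: ler_norm.
Qed.

Lemma fiber_tail (P : pred (edge E)) (M eps : R) :
  (forall F, \sum_(e <- F | P e) lam e <= M) -> 0 < eps ->
  exists F0, forall F, (F0 `<=` F)%fset ->
    \sum_(e <- (F `\` F0)%fset | P e) lam e < eps.
Proof.
move=> hM e0; have [| |F0 hF0] := @bounded_tail _ _
    (fun e => if P e then lam e else 0) M _ _ eps e0.
- by move=> e; case: ifP.
- by move=> F; rewrite /partial_sum -big_mkcond.
by exists F0 => F /hF0; rewrite /partial_sum -big_mkcond.
Qed.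

(** Uniformity in [w]: outside a finite set [W] of sources the whole sum is at most [eps], and for
    each [w] in [W] a finite set of edges settles its tail; [F0] is the union of these sets. *)
Lemma c0_tail v (eps : R) : weight_conditions lam -> 0 < eps ->
  exists F0, forall F, (F0 `<=` F)%fset -> forall w,
    \sum_(e <- (F `\` F0)%fset | (rng e == v) && (src e == w)) lam e <= eps.
Proof.
move=> [/weight_cond1P -/(_ lam_gt0) [M hM] c0] e0.
have [[e0' ev0]|nv] := pselect (exists e, rng e = v); last first.
  exists fset0 => F _ w; rewrite big1 ?ltW // => e /andP[/eqP ev _].
  by case: nv; exists e.
have [_ /(_ _ e0) fin] := c0 v (ex_intro2 _ _ e0' Logic.I ev0).
set W := [set w | _] in fin.
have hMw w F : \sum_(e <- F | (rng e == v) && (src e == w)) lam e <= M.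
  apply: le_trans (hM w F).
  rewrite big_mkcond [X in _ <= X]big_mkcond; apply: ler_sum => e _ /=.
  by case: (rng e == v) => //=; case: ifP.
have /choice [Fw FwP] := fun w => fiber_tail (hMw w) e0.
exists (\bigcup_(w <- fset_set W) Fw w)%fset => F FF w.
have [Ww|nW] := pselect (W w).
  have FwF : (Fw w `<=` \bigcup_(w <- fset_set W) Fw w)%fset.
    by apply: bigfcup_sup => //; rewrite in_fset_set // mem_set.
  apply: ltW; apply: le_lt_trans (FwP w _ (fsubset_trans FwF FF)).
  by apply: sum_fsubset => //; exact: fsetDS.
have [[e ev ew]|ne] := pselect ((@src E @` in_edges v) w); last first.
  rewrite big1 ?ltW // => e /andP[/eqP ev /eqP ew].
  by case: ne; exists e.
have ltw : (\esum_(e in in_edges v `&` out_edges w) (lam e)%:E <= eps%:E)%E.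
  rewrite leNgt; apply/negP => h; apply: nW; split; first by exists e.
  rewrite gee0_abs; first exact: ltW.
  by apply: esum_ge0 => e' _; rewrite lee_fin.
move: ltw; rewrite (_ : in_edges v `&` out_edges w =
    [set e | (rng e == v) && (src e == w)]); last first.
  apply/seteqP; split=> e' /=; first by move=> [-> ->]; rewrite !eqxx.
  by move=> /andP[/eqP ? /eqP ?].
by move=> /esum_leP.
Qed.

Lemma weight_strict_sum : weight_conditions lam ->
  exists w : multiplier A, is_strict_sum s lam w.
Proof.
move=> /[dup] wc [/weight_cond1P -/(_ lam_gt0) bd _].
have [K uK] := fiber_sums_u_bounded bd; have [M hM] := bd.
have cl a : cvg ((fun F => u F ** a) @ finsubsets (edge E)).
  apply: (left_net_cvg AE uK) => v.
  apply: cauchy_cvg; apply/cauchy_netP => eps e0.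
  (* The fiber sums control the square of the norm, hence the tail at [eps ^ 2]. *)
  have [F0 hF0] := fiber_tail (hM v) (exprn_gt0 2 e0).
  exists F0 => F FF; rewrite -cmulBl u_partial_subD // u_p.
  rewrite -(ltr_pXn2r (ltn0Sn 1)) ?nnegrE ?nrm_ge0 ?ltW //.
  apply: le_lt_trans (hF0 F FF); apply: (nrm_u_le ck pi_hom pi_s pi_p lam_gt0).
    exact: wsum_ge0.
  move=> w; rewrite [X in _ <= X]big_fset_condE /=.
  rewrite big_mkcond; apply: ler_sum => e _; by case: ifP.
have cr a : cvg ((fun F => star (u F) ** a) @ finsubsets (edge E)).
  have uK' F : nrm (star (u F)) <= K by rewrite nrm_star.
  apply: (left_net_cvg AE uK') => v.
  apply: cauchy_cvg; apply/cauchy_netP => eps e0.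
  (* [c0_tail] gives a non-strict bound, and [eps / 2] makes it strict. *)
  have e2 : 0 < (eps / 2) ^+ 2 by rewrite exprn_gt0 // divr_gt0.
  have [F0 hF0] := c0_tail v wc e2.
  exists F0 => F FF; rewrite -cmulBl -starB -(p_star ck) -starM nrm_star.
  rewrite u_partial_subD // p_u.
  apply: (@le_lt_trans _ _ (eps / 2)); last first.
    by rewrite ltr_pdivrMr // mulr_natr mulr2n ltrDl.
  have e2' : 0 <= eps / 2 by rewrite divr_ge0 // ltW.
  rewrite -(ler_pXn2r (ltn0Sn 1)) ?nnegrE ?nrm_ge0 //.
  apply: (nrm_u_le ck pi_hom pi_s pi_p lam_gt0); first exact: ltW.
  move=> w; apply: le_trans (hF0 F FF w).
  rewrite [X in _ <= X]big_mkcondr [X in _ <= X]big_fset_condE /=.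
  by rewrite [X in X <= _]big_mkcond.
pose L a := lim ((fun F => u F ** a) @ finsubsets (edge E)).
(* The convergence criterion concerns nets acting from the left, so the right products are obtained
   by taking adjoints. *)
pose L' a := star (lim ((fun F => star (u F) ** star a) @ finsubsets (edge E))).
have LP a : (fun F => u F ** a) @ finsubsets (edge E) --> L a by exact: cl.
have LP' a : (fun F => a ** u F) @ finsubsets (edge E) --> L' a.
  rewrite (_ : (fun F => a ** u F) = (fun F => star (star (u F) ** star a))).
    by apply: cvg_star; exact: cr.
  by apply/funext => F; rewrite starM !starK.
have LL a b : a ** L b = L' a ** b.
  apply: (@cvg_net_unique _ _ _ (fun F => a ** (u F ** b))).
    exact: cvg_cmull.
  rewrite (_ : (fun F => _) = (fun F => a ** u F ** b)); first exact: cvg_cmulr.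
  by apply/funext => F; rewrite cmulA.
by exists (Multiplier LL) => a; split; [exact: LP|exact: LP'].
Qed.

(** The two sides are passed to the limit in turn: [star (u F) ** a] tends to an element [c] of [A],
    then [c ** u F] converges, and the uniform bound on [u F] absorbs the error of the first
    step. *)
Lemma strict_sum_Phi (w : multiplier A) : is_strict_sum s lam w ->
  forall a, Phip a @ finsubsets (edge E) --> mult_compress w a.
Proof.
move=> uw a.
have [K uK] := fiber_sums_u_bounded (strict_sum_bounded AE pi_hom pi_s pi_p
  lam_gt0 uw).
pose c := lmul (mult_adj w) a.
have cP : (fun F => star (u F) ** a) @ finsubsets (edge E) --> c.
  rewrite (_ : (fun F => _) = (fun F => star (star a ** u F))).
    by apply: cvg_star; have [_] := uw (star a).
  by apply/funext => F; rewrite starM starK.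
have [_ cw] := uw c.
have K0 : 0 <= K := le_trans (nrm_ge0 _) (uK fset0).
have K1 : 0 < K + 1 by rewrite ltr_wpDl.
rewrite /mult_compress -/c -[rmul w c]add0r.
rewrite (_ : Phip a = (fun F => (star (u F) ** a - c) ** u F + c ** u F)).
  apply: cvgD => //; apply/cvg_netP => eps e0.
  have [F0 hF0] := (cvg_netP _ _).1 cP _ (divr_gt0 e0 K1).
  exists F0 => F /hF0; rewrite nrmBC sub0r nrmN ltr_pdivlMr // => h.
  apply: le_lt_trans (nrm_cmul _ _) _; apply: le_lt_trans h.
  rewrite ler_wpM2l ?nrm_ge0 //; apply: le_trans (uK F) _.
  by rewrite lerDl.
apply/funext => F; rewrite Phi_partialE // cmulBl subrK.
by [].
Qed.

Lemma strict_sum_cp (w : multiplier A) : is_strict_sum s lam w ->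
  Phi_defines_cp_map s lam.
Proof.
move=> uw; have PhiP := strict_sum_Phi uw.
have PE a : Phi s lam a = mult_compress w a by exact: lim_net (PhiP a).
have Pc a : Phip a @ finsubsets (edge E) --> Phi s lam a by rewrite PE.
have Plin k a b : Phi s lam (k *: a + b) = k *: Phi s lam a + Phi s lam b.
  apply: (cvg_net_unique (Pc _)).
  rewrite (_ : Phip (k *: a + b) = (fun F => k *: Phip a F + Phip b F)).
    by apply: cvgD => //; apply: cvgZr.
  apply/funext => F; rewrite !Phi_partialE //.
  by rewrite cmulDr cmulDl cmulZr cmulZl.
split; first by move=> a; exact: cvgP (PhiP a).
split=> // n X [Y ->].
(* The image of [Y^* Y] is [(Y w)^* (Y w)], and [Y w] has entries in [A] although [w] is only a
   multiplier. *)
exists (map_mx (rmul w) Y); apply/matrixP => i j; rewrite !mxE.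
have Psum (r : seq 'I_n) (f : 'I_n -> A) :
    Phi s lam (\sum_(k <- r) f k) = \sum_(k <- r) Phi s lam (f k).
  have P0 : Phi s lam 0 = 0.
    have := Plin (-1) 0 0; rewrite scaler0 addr0 => ->.
    by rewrite scaleN1r addNr.
  elim/big_rec2: _ => [|k y1 y2 _ <-]; first exact: P0.
  by have := Plin 1 (f k) y2; rewrite !scale1r.
rewrite Psum; apply: eq_bigr => k _; rewrite !mxE.
apply: (cvg_net_unique (Pc _)).
have [_ h1] := uw (Y k i); have [_ h2] := uw (Y k j).
rewrite (_ : Phip _ = (fun F => star (Y k i ** u F) ** (Y k j ** u F))).
  by apply: cvg_cmul => //; apply: cvg_star.
by apply/funext => F; rewrite Phi_partialE // starM !cmulA.
Qed.

End StrictSum.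

Theorem proposition5p4 (R : realType) (E : digraph)
  (lam : edge E -> R) (lam_gt0 : forall e, 0 < lam e)
  (A : cstarType R) (s : edge E -> A) (p : vert E -> A)
  (AE : is_graph_algebra s p) :
  [<-> transfer_defines_bounded_operator lam;
       weight_conditions lam;
       exists u : multiplier A, is_strict_sum s lam u;
       Phi_defines_cp_map s lam] /\
  (transfer_defines_bounded_operator lam ->
    (forall u : multiplier A, is_strict_sum s lam u ->
       forall a : A, Phi s lam a = mult_compress u a) /\
    exists Psi : A -> (bpath E -> R[i]^o),
      [/\ diag_iso s p Psi,
          forall mu : fin_path E,
            Psi (spath s p mu ** star (spath s p mu)) = \1_(bcylinder mu) &
          forall a : A, diag_subalg s p a ->
            diag_subalg s p (Phi s lam a) /\
            Psi (Phi s lam a) = transfer lam (Psi a)]).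
Proof.
have ck := ga_ck AE.
have [pi [pi_hom pi_s pi_p]] := ga_universal AE (rep_ck R E).
have i_ii := transfer_weight AE pi_hom pi_s pi_p lam_gt0.
have ii_iii := weight_strict_sum AE pi_hom pi_s pi_p lam_gt0.
have iii_iv (w : multiplier A) := strict_sum_cp AE pi_hom pi_s pi_p lam_gt0 (w
  := w).
split.
  tfae=> //.
    by move=> [w /iii_iv].
  exact: (cp_map_transfer AE pi_hom pi_s pi_p lam_gt0).
move=> /i_ii/ii_iii[w uw]; split.
  move=> w' uw' a; apply: lim_net.
  exact: (strict_sum_Phi AE pi_hom pi_s pi_p lam_gt0 uw').
exists (Psi pi); split.
- exact: (Psi_diag_iso ck pi_hom pi_s pi_p).
- exact: (Psi_spath ck pi_hom pi_s pi_p).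
move=> a Da; have [Pc _] := iii_iv w uw.
by have [? _ ->] := transfer_Psi AE pi_hom pi_s pi_p lam_gt0 Da (Pc a).
Qed.
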